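(* Let $V_2=\mathbb{R}^2$ be the natural $\mathrm{SL}_2(\mathbb{R})$-module and let $\widetilde G_0=(\mathrm{SL}_2(\mathbb{R}))^4$ act on $V_2^{\otimes 4}=V_2\otimes V_2\otimes V_2\otimes V_2$ by $(g_1,g_2,g_3,g_4)\cdot(v_1\otimes v_2\otimes v_3\otimes v_4)=(g_1v_1)\otimes(g_2v_2)\otimes(g_3v_3)\otimes(g_4v_4)$. Then there are exactly $145$ nonzero nilpotent $\widetilde G_0$-orbits in $V_2^{\otimes 4}$. A complete and irredundant list of representatives of these orbits is given by the following $30$ families, where all the signs ''$\pm$'' within an expression are chosen independently of each other, and different choices of signs give representatives of different orbits (the $145$ elements so obtained are pairwise non-conjugate under $\widetilde G_0$, and every nonzero nilpotent element is $\widetilde G_0$-conjugate to one of them). Moreover, two of these elements lie in the same orbit of $(\mathrm{SL}_2(\mathbb{C}))^4$ on $(\mathbb{C}^2)^{\otimes 4}$ if and only if they belong to the same family, and the dimension of the orbit is as indicated. Dimension 5: (1) $(++--)$. Dimension 6: (2) $(++--)\pm(----)$; (3) $(++--)\pm(+--+)$; (4) $(++--)\pm(+-+-)$; (5) $(++-+)\pm(-+--)$; (6) $(+++-)\pm(-+--)$; (7) $(+++-)\pm(++-+)$. Dimension 8: (8) $(++-+)\pm(-+--)\pm(+---)$; (9) $(+++-)\pm(-+--)\pm(+---)$; (10) $(+++-)\pm(++-+)\pm(+---)$; (11) $(+++-)\pm(++-+)\pm(-+--)$. Dimension 9: (12) the five elements $\epsilon_1(-+-+)+\epsilon_2(++--)+\epsilon_3(+--+)+\epsilon_4(----)$;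 (13) the five elements $\epsilon_1(-++-)+\epsilon_2(++--)+\epsilon_3(+-+-)+\epsilon_4(----)$; (14) the five elements $\epsilon_1(++++)+\epsilon_2(++--)+\epsilon_3(+--+)+\epsilon_4(+-+-)$; (15) the five elements $\epsilon_1(-+++)+\epsilon_2(+++-)+\epsilon_3(++-+)+\epsilon_4(-+--)$; where in each of (12)–(15) the tuple $(\epsilon_1,\epsilon_2,\epsilon_3,\epsilon_4)\in\{1,-1\}^4$ runs over the five tuples having at most one entry equal to $-1$; (16) $(+++-)\pm(++-+)\pm(-+--)\pm(+---)$. Dimension 10: (17) $(+++-)\pm(++-+)\pm(----)$; (18) $(+++-)\pm(-+--)\pm(+--+)$; (19) $(++-+)\pm(-+--)\pm(+-+-)$; (20) $(-+-+)\pm(+++-)\pm(+---)$; (21) $(-++-)\pm(++-+)\pm(+---)$; (22) $(++++)\pm(-+--)\pm(+---)$. Dimension 11: (23) $(+++-)\pm(-+--)\pm(----)\pm(+--+)$; (24) $(-++-)\pm(++-+)\pm(+---)\pm(----)$; (25) $(++++)\pm(-+--)\pm(+---)\pm(+--+)$; (26) $(++++)\pm(-+--)\pm(+---)\pm(+-+-)$. Dimension 12: (27) $(-+-+)\pm(+++-)\pm(----)\pm(+--+)$; (28) $(-++-)\pm(++-+)\pm(----)\pm(+-+-)$; (29) $(++++)\pm(-+--)\pm(+--+)\pm(+-+-)$; (30) $(++++)\pm(-++-)\pm(-+-+)\pm(+---)$.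
   Context: Put $v^{(+)}=(1,0)$ and $v^{(-)}=(0,1)$, the standard basis of $V_2=\mathbb{R}^2$. For signs $s_1,s_2,s_3,s_4\in\{+,-\}$ the symbol $(s_1s_2s_3s_4)$ denotes the basis vector $v^{(s_1)}\otimes v^{(s_2)}\otimes v^{(s_3)}\otimes v^{(s_4)}$ of $V_2^{\otimes 4}$; for example $(++--)=v^{(+)}\otimes v^{(+)}\otimes v^{(-)}\otimes v^{(-)}$. An orbit (and each of its elements) is called nilpotent if the closure of the orbit contains $0$. Equivalently, $V_2^{\otimes 4}$ is identified with the odd part $\mathfrak{g}_1$ of the $\mathbb{Z}/2\mathbb{Z}$-grading $\mathfrak{g}=\mathfrak{g}_0\oplus\mathfrak{g}_1$ of the split real Lie algebra $\mathfrak{g}$ of type $D_4$ with $\mathfrak{g}_0\cong\mathfrak{sl}_2(\mathbb{R})^{\oplus 4}$ (the action of $\widetilde G_0$ on $V_2^{\otimes 4}$ corresponding to its adjoint action on $\mathfrak{g}_1$), and an element of $\mathfrak{g}_1$ is nilpotent if its adjoint map on $\mathfrak{g}$ is nilpotent. The dimension of an orbit is its dimension as a real manifold. *)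

(* Defs.v *)
From mathcomp Require Import all_boot all_order all_algebra.
From mathcomp Require Import all_classical all_reals all_analysis.
From mathcomp Require Import mxtens complex.

Set Implicit Arguments.
Unset Strict Implicit.
Unset Printing Implicit Defensive.

Import GRing.Theory numFieldNormedType.Exports.

Local Open Scope classical_set_scope.
Local Open Scope ring_scope.

(* K^2 (x) K^2 (x) K^2 (x) K^2, modelled by Kronecker products of columns:
   v1 (x) v2 (x) v3 (x) v4 is v1 *t v2 *t v3 *t v4. *)
Notation tensor4 K := 'cV[K]_(2 * 2 * 2 * 2).

Definition act4 (K : fieldType) (g1 g2 g3 g4 : 'M[K]_2) (x : tensor4 K) :
  tensor4 K := (g1 *t g2 *t g3 *t g4) *m x.

Lemma act4_pure (K : fieldType) (g1 g2 g3 g4 : 'M[K]_2)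
    (v1 v2 v3 v4 : 'cV[K]_2) :
  act4 g1 g2 g3 g4 (v1 *t v2 *t v3 *t v4) =
  (g1 *m v1) *t (g2 *m v2) *t (g3 *m v3) *t (g4 *m v4).
Proof. by rewrite /act4 -!tensmx_mul. Qed.

Definition SL2_conj (K : fieldType) (x y : tensor4 K) : Prop :=
  exists g1 g2 g3 g4 : 'M[K]_2,
    [/\ \det g1 = 1, \det g2 = 1, \det g3 = 1, \det g4 = 1
      & y = act4 g1 g2 g3 g4 x].

Definition orbit4 (K : fieldType) (x : tensor4 K) : set (tensor4 K) :=
  [set y | SL2_conj x y].

Definition nilpotent4 (R : realType) (x : tensor4 R) : Prop :=
  closure (orbit4 x) 0.

Definition nilp_orbits (R : realType) : set (set (tensor4 R)) :=
  [set O | exists x : tensor4 R, [/\ x <> 0, nilpotent4 x & O = orbit4 x]].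

Arguments nilp_orbits : clear implicits.

Definition complexify4 (R : realType) (x : tensor4 R) : tensor4 R[i] :=
  map_mx (real_complex R) x.

(* S, with the subspace topology, is locally homeomorphic to open subsets of
   R^d.  For an orbit in R^16 the Hausdorff and second countability axioms are
   automatic, and, orbits of real algebraic groups being locally closed, the
   subspace topology is that of the homogeneous space. *)
Definition manifold_of_dim (R : realType) (T : topologicalType) (S : set T)
    (d : nat) : Prop :=
  forall p, S p ->
  exists (U : set T) (W : set 'rV[R]_d) (f : T -> 'rV[R]_d) (g : 'rV[R]_d -> T),
    [/\ open U, U p & open W] /\
    [/\ set_fun (S `&` U) W f, set_fun W (S `&` U) g,
        (forall q, (S `&` U) q -> g (f q) = q)
      & (forall w, W w -> f (g w) = w)] /\
    {within S `&` U, continuous f} /\ {within W, continuous g}.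

(* true stands for the sign +, false for the sign - *)
Definition sign_vec (K : fieldType) (s : bool) : 'cV[K]_2 :=
  delta_mx (if s then 0 else 1) 0.

Definition basis4 (K : fieldType) (s1 s2 s3 s4 : bool) : tensor4 K :=
  sign_vec K s1 *t sign_vec K s2 *t sign_vec K s3 *t sign_vec K s4.

(* x +- t_1 +- ... +- t_k, all 2 ^ k choices of signs *)
Fixpoint pm (V : zmodType) (x : V) (ts : seq V) : seq V :=
  if ts is t :: ts' then pm (x + t) ts' ++ pm (x - t) ts' else [:: x].

(* at most one minus sign *)
Definition five (V : zmodType) (a b c d : V) : seq V :=
  [:: a + b + c + d; - a + b + c + d; a - b + c + d; a + b - c + d;
      a + b + c - d].

Declare Custom Entry sign4.
Local Notation "+" := true (in custom sign4).
Local Notation "-" := false (in custom sign4).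
Local Notation "'e(' a b c d )" := (basis4 _ a b c d)
  (a custom sign4, b custom sign4, c custom sign4, d custom sign4).

(* Each family is paired with the dimension of its orbits. *)
Definition nilp_families (K : fieldType) : seq (nat * seq (tensor4 K)) := [::
 (* 1 *)  (5%N, pm e(+ + - -) [::]);
 (* 2 *)  (6%N, pm e(+ + - -) [:: e(- - - -)]);
 (* 3 *)  (6%N, pm e(+ + - -) [:: e(+ - - +)]);
 (* 4 *)  (6%N, pm e(+ + - -) [:: e(+ - + -)]);
 (* 5 *)  (6%N, pm e(+ + - +) [:: e(- + - -)]);
 (* 6 *)  (6%N, pm e(+ + + -) [:: e(- + - -)]);
 (* 7 *)  (6%N, pm e(+ + + -) [:: e(+ + - +)]);
 (* 8 *)  (8%N, pm e(+ + - +) [:: e(- + - -); e(+ - - -)]);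
 (* 9 *)  (8%N, pm e(+ + + -) [:: e(- + - -); e(+ - - -)]);
 (* 10 *) (8%N, pm e(+ + + -) [:: e(+ + - +); e(+ - - -)]);
 (* 11 *) (8%N, pm e(+ + + -) [:: e(+ + - +); e(- + - -)]);
 (* 12 *) (9%N, five e(- + - +) e(+ + - -) e(+ - - +) e(- - - -));
 (* 13 *) (9%N, five e(- + + -) e(+ + - -) e(+ - + -) e(- - - -));
 (* 14 *) (9%N, five e(+ + + +) e(+ + - -) e(+ - - +) e(+ - + -));
 (* 15 *) (9%N, five e(- + + +) e(+ + + -) e(+ + - +) e(- + - -));
 (* 16 *) (9%N, pm e(+ + + -) [:: e(+ + - +); e(- + - -); e(+ - - -)]);
 (* 17 *) (10%N, pm e(+ + + -) [:: e(+ + - +); e(- - - -)]);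
 (* 18 *) (10%N, pm e(+ + + -) [:: e(- + - -); e(+ - - +)]);
 (* 19 *) (10%N, pm e(+ + - +) [:: e(- + - -); e(+ - + -)]);
 (* 20 *) (10%N, pm e(- + - +) [:: e(+ + + -); e(+ - - -)]);
 (* 21 *) (10%N, pm e(- + + -) [:: e(+ + - +); e(+ - - -)]);
 (* 22 *) (10%N, pm e(+ + + +) [:: e(- + - -); e(+ - - -)]);
 (* 23 *) (11%N, pm e(+ + + -) [:: e(- + - -); e(- - - -); e(+ - - +)]);
 (* 24 *) (11%N, pm e(- + + -) [:: e(+ + - +); e(+ - - -); e(- - - -)]);
 (* 25 *) (11%N, pm e(+ + + +) [:: e(- + - -); e(+ - - -); e(+ - - +)]);
 (* 26 *) (11%N, pm e(+ + + +) [:: e(- + - -); e(+ - - -); e(+ - + -)]);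
 (* 27 *) (12%N, pm e(- + - +) [:: e(+ + + -); e(- - - -); e(+ - - +)]);
 (* 28 *) (12%N, pm e(- + + -) [:: e(+ + - +); e(- - - -); e(+ - + -)]);
 (* 29 *) (12%N, pm e(+ + + +) [:: e(- + - -); e(+ - - +); e(+ - + -)]);
 (* 30 *) (12%N, pm e(+ + + +) [:: e(- + + -); e(- + - +); e(+ - - -)])].

Definition fam_dim (K : fieldType) (k : nat) : nat :=
  (nth (0%N, [::]) (nilp_families K) k).1.

Definition fam (K : fieldType) (k : nat) : seq (tensor4 K) :=
  (nth (0%N, [::]) (nilp_families K) k).2.

Definition nilp_reps (K : fieldType) : seq (tensor4 K) :=
  flatten [seq F.2 | F <- nilp_families K].

(* Main.v *)
(* A one-parameter subgroup of the torus contracts a tensor to 0 exactly when the weights of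
   the tensor lie in an open half space. By the Cartan decomposition of SL_2(R) and the
   compactness of SO_2^4, every nilpotent tensor can be rotated into one of twelve such half
   spaces. Descending through smaller and smaller half spaces, one makes it generic, up to a
   permutation of the slots, for one of eight standard types; generic means that finitely
   many polynomials, semi-invariant under the parabolic subgroup of the type, do not vanish.

   By the Bruhat decomposition, conjugate generic tensors differ by parabolic elements and a
   Weyl group element. Comparing weights, their types agree and the Weyl group element lies
   in the parabolic subgroup (the theorem of Kempf and Rousseau in this case), so the signs
   of the semi-invariants are invariants of the real orbit, and the type is an invariant of
   the complex one. Conversely, unipotent elements and the positive torus bring a generic
   tensor of type T to one of finitely many normal forms with coefficients 1 and -1, and
   normal forms with the same signs are conjugate by a Weyl group element. Over the complex
   numbers, diagonal matrices of eighth roots of unity remove the signs.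

   For the dimension, let v0 be generic of type T. Near v0 the orbit is parametrised by
   (s, v) |-> u(s) v, where u(s) is lower unipotent in the slots in which the parabolic
   subgroup is a Borel subgroup, and v runs over the tensors of the half space whose
   semi-invariants have the signs of those of v0. The parameter s is recovered from the
   first two coefficients of covariants of the tensor. *)

Require Import Defs.
From mathcomp Require Import all_boot all_order all_algebra.
From mathcomp Require Import ring lra.
From mathcomp Require Import all_classical all_reals all_analysis.
From mathcomp Require Import mxtens complex.

Set Implicit Arguments.
Unset Strict Implicit.
Unset Printing Implicit Defensive.

Import Order.TTheory GRing.Theory Num.Theory.
Import numFieldNormedType.Exports.

Local Open Scope classical_set_scope.
Local Open Scope ring_scope.

Local Notation "+" := true (in custom sign4).
Local Notation "-" := false (in custom sign4).
Local Notation "'w(' a b c d )" := (a, b, c, d)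
  (a custom sign4, b custom sign4, c custom sign4, d custom sign4).

(** * The action on coordinates *)

(** The count rests on parity. Every polynomial in [invs] has even degree, so its weight in each
    slot is even, the torus scales it by squares, and over the reals exactly its sign survives. The
    families of one type are the distinct slot permutations of its [lam], so the types 0 to 7
    contribute 1 + 6*2 + 4*4 + 4*5 + 8 + 6*4 + 4*8 + 4*8 = 145 orbits. Type 3 is the exception that
    needs extra invariants: its only semi-invariant is a hyperdeterminant. Where it is positive
    there is one orbit. Where it is negative, three binary forms are definite and the product of
    their signs is negative, which leaves four orbits; hence the five sign tuples of families 12 to
    15. Slot permutations lie outside the group, so they are carried along explicitly and undone at
    the end. Weights, permutations, polynomials and representatives are stored as finite data, so
    that the case checks over Weyl elements, permutations and sign patterns are evaluations over
    booleans and integers. *)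

Definition weight := (bool * bool * bool * bool)%type.

Definition bt (i : nat) (w : weight) : bool :=
  let: (a, b, c, d) := w in nth d [:: a; b; c] i.

Definition fl (i : nat) (w : weight) : weight :=
  let: (a, b, c, d) := w in
  nth (a, b, c, ~~ d) [:: (~~ a, b, c, d); (a, ~~ b, c, d); (a, b, ~~ c, d)] i.

Definition weights : seq weight :=
  [seq (p.1, p.2, q.1, q.2) |
     p <- [:: (true, true); (true, false); (false, true); (false, false)],
     q <- [:: (true, true); (true, false); (false, true); (false, false)]].

Lemma mem_weights w : w \in weights.
Proof. by case: w => [[[[] []] []] []]. Qed.

Lemma forall_weightP (P : pred weight) : reflect (forall w, P w) (all P weights).
Proof.
apply: (iffP allP) => [h w|h w _]; last exact: h.
exact/h/mem_weights.
Qed.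

Section SlotAction.
Variable K : comPzRingType.
Implicit Types x y : weight -> K.

(* The matrix [[a, b], [c, d]] acting on the slot [i]; [true] is the index of its first row. *)
Definition sl (i : nat) (a b c d : K) x : weight -> K := fun w =>
  if bt i w then a * x w + b * x (fl i w) else c * x (fl i w) + d * x w.

(** Conjugacy is generated by determinant-one matrices in single slots, so that an invariance need
    only be checked for one 2x2 matrix at a time. [cj_actsP] sorts the steps into one matrix per
    slot, since different slots commute. *)
Inductive cj x : (weight -> K) -> Prop :=
| cj_refl : cj x x
| cj_step y i a b c d : (i < 4)%N -> a * d - b * c = 1 -> cj x y ->
    cj x (sl i a b c d y).

Lemma fl_inv i w : fl i (fl i w) = w.
Proof.
by case: w => [[[a b] c] d]; case: i => [|[|[|[|i]]]] /=; rewrite negbK.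
Qed.

Lemma bt_fl i w : (i < 4)%N -> bt i (fl i w) = ~~ bt i w.
Proof. by case: w => [[[a b] c] d]; case: i => [|[|[|[|i]]]]. Qed.

Lemma bt_flN i j w : (i < 4)%N -> (j < 4)%N -> i != j -> bt i (fl j w) = bt i w.
Proof.
by case: w => [[[a b] c] d]; case: i => [|[|[|[|i]]]]; case: j => [|[|[|[|j]]]].
Qed.

Lemma flC i j w : (i < 4)%N -> (j < 4)%N -> fl i (fl j w) = fl j (fl i w).
Proof.
by case: w => [[[a b] c] d]; case: i => [|[|[|[|i]]]]; case: j => [|[|[|[|j]]]].
Qed.

Lemma sl1 i x : sl i 1 0 0 1 x = x.
Proof.
by apply/funext => w; rewrite /sl; case: ifP => _; rewrite !(mul1r, mul0r) ?addr0 ?add0r.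
Qed.

Lemma sl_comp i a b c d a' b' c' d' x : (i < 4)%N ->
  sl i a b c d (sl i a' b' c' d' x) =
  sl i (a * a' + b * c') (a * b' + b * d') (c * a' + d * c') (c * b' + d * d') x.
Proof.
move=> i4; apply/funext => w; rewrite /sl bt_fl // fl_inv.
by case: (bt i w) => /=; ring.
Qed.

Lemma slC i j a b c d a' b' c' d' x : (i < 4)%N -> (j < 4)%N -> i != j ->
  sl i a b c d (sl j a' b' c' d' x) = sl j a' b' c' d' (sl i a b c d x).
Proof.
move=> i4 j4 ij; apply/funext => w.
have ji : j != i by rewrite eq_sym.
rewrite /sl (bt_flN w i4 j4 ij) (bt_flN w j4 i4 ji) (flC w i4 j4).
by case: (bt i w); case: (bt j w) => /=; ring.
Qed.

Lemma cj_sl i a b c d x : (i < 4)%N -> a * d - b * c = 1 -> cj x (sl i a b c d x).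
Proof. by move=> *; apply: cj_step => //; apply: cj_refl. Qed.

End SlotAction.

Section ConjugacyRelation.
Variable K : comPzRingType.
Implicit Types x y z : weight -> K.

Lemma cj_trans y x z : cj x y -> cj y z -> cj x z.
Proof. by move=> xy; elim=> // {}z i a b c d i4 D _ IH; apply: cj_step. Qed.

Lemma cj_sym x y : cj x y -> cj y x.
Proof.
elim=> [|{}y i a b c d i4 D _ IH]; first exact: cj_refl.
apply: cj_trans IH.
suff {2}-> : y = sl i d (- b) (- c) a (sl i a b c d y).
  by apply: cj_sl => //; rewrite -D; ring.
rewrite sl_comp // -[LHS](sl1 i); congr (sl i _ _ _ _ y); rewrite -?D; ring.
Qed.

Definition mat2 := (K * K * K * K)%type.
Definition det2 (g : mat2) := g.1.1.1 * g.2 - g.1.1.2 * g.1.2.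
(** Representatives in SL_2 of the two Weyl group elements. *)
Definition J2 (e : bool) : mat2 := if e then (0, 1, -1, 0) else (1, 0, 0, 1).
Definition slm i (g : mat2) x := sl i g.1.1.1 g.1.1.2 g.1.2 g.2 x.
Definition mul2 (g h : mat2) : mat2 :=
  let: (a, b, c, d) := g in let: (a', b', c', d') := h in
  (a * a' + b * c', a * b' + b * d', c * a' + d * c', c * b' + d * d').

Lemma slm_comp i g h x : (i < 4)%N -> slm i g (slm i h x) = slm i (mul2 g h) x.
Proof. by move: g h => [[[a b] c] d] [[[a' b'] c'] d'] i4; exact: sl_comp. Qed.

Lemma det2M g h : det2 (mul2 g h) = det2 g * det2 h.
Proof.
by move: g h => [[[a b] c] d] [[[a' b'] c'] d']; rewrite /det2 /=; ring.
Qed.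

Definition acts (s : seq nat) (g : nat -> mat2) x :=
  foldr (fun i z => slm i (g i) z) x s.

Definition slots := [:: 0; 1; 2; 3]%N.

Lemma slm_acts i h s g x : (i < 4)%N -> all (gtn 4%N) s -> i \notin s ->
  slm i h (acts s g x) = acts s g (slm i h x).
Proof.
move=> i4; elim: s => //= j s IH /andP[j4 s4]; rewrite inE negb_or => /andP[ij si].
by rewrite -IH // /slm slC.
Qed.

Lemma cj_acts s g x : all (gtn 4%N) s -> (forall i, det2 (g i) = 1) -> cj x (acts s g x).
Proof.
move=> + D; elim: s => [|i s IH] /=; first by move=> _; apply: cj_refl.
by case/andP=> i4 /IH xs; apply: cj_step => //; exact: D.
Qed.

Lemma slm_slots i h g x : (i < 4)%N ->
  slm i h (acts slots g x) = acts slots (fun j => if j == i then mul2 h (g j) else g j) x.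
Proof.
have frame s : (i \notin s)%N ->
    acts s (fun j => if j == i then mul2 h (g j) else g j) x = acts s g x.
  elim: s => //= j s IH; rewrite inE negb_or => /andP[ij si].
  by rewrite eq_sym (negbTE ij) IH.
move=> i4; suff ext s : i \in s -> uniq s -> all (gtn 4%N) s ->
    slm i h (acts s g x) = acts s (fun j => if j == i then mul2 h (g j) else g j) x.
  by apply: (ext slots) => //; case: i i4 {frame ext} => [|[|[|[|]]]].
elim: s => //= j s IH; rewrite inE => /orP[/eqP<-|si] /andP[js us] /andP[j4 s4].
  by rewrite eqxx slm_comp // frame.
have ij : i != j by apply: contraNneq js => <-.
by rewrite eq_sym (negbTE ij) -IH // /slm slC.
Qed.

Lemma cj_actsP x y :
  cj x y -> exists2 g, forall i, det2 (g i) = 1 & y = acts slots g x.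
Proof.
elim=> [|{}y i a b c d i4 D _ [g Dg ->]].
  exists (fun=> (1, 0, 0, 1)); first by move=> i; rewrite /det2 /=; ring.
  by rewrite /acts /= /slm /= !sl1.
exists (fun j => if j == i then mul2 (a, b, c, d) (g j) else g j).
  move=> j; case: eqP => _ //; by rewrite det2M Dg mulr1; exact: D.
exact: (slm_slots (a, b, c, d)).
Qed.

End ConjugacyRelation.
Arguments J2 : clear implicits.

(** * Bruhat decomposition, slot by slot *)

Section Bruhat.
Variable K : fieldType.
Implicit Types x y : weight -> K.

Definition upper2 (g : mat2 K) := det2 g = 1 /\ g.1.2 = 0.

(** The lower left entry decides the cell: if it vanishes, the matrix is already upper triangular;
    otherwise it lies in the big cell. *)
Lemma bruhat2 (g : mat2 K) : det2 g = 1 ->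
  exists b b' e, [/\ upper2 b, upper2 b' & g = mul2 b (mul2 (J2 K e) b')].
Proof.
case: g => [[[a b] c] d]; rewrite /det2 /= => D.
have [c0|c0] := eqVneq c 0.
  exists (a, b, c, d), (1, 0, 0, 1), false; split; rewrite /upper2 /det2 /=;
    [by split|by split=> //; ring|].
  by congr (_, _, _, _); ring.
exists (1, a / c, 0, 1), (- c, - d, 0, - c^-1), true.
split; rewrite /upper2 /det2 /=; [by split=> //; ring|by split=> //; field|].
have -> : b = (a * d - 1) / c by rewrite -D; field.
by congr (_, _, _, _); field.
Qed.

Lemma cj_bruhat x y : cj x y -> exists (b b' : nat -> mat2 K) (e : nat -> bool),
  [/\ forall i, upper2 (b i), forall i, upper2 (b' i) &
   y = acts slots b (acts slots (fun i => J2 K (e i)) (acts slots b' x))].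
Proof.
move=> /cj_actsP[g Dg ->].
have /(_ _)/cid-/all_sig[b hb] := fun i => bruhat2 (Dg i).
have /(_ _)/cid-/all_sig[b' hb'] := hb.
have /(_ _)/cid-/all_sig[e he] := hb'.
exists b, b', e; split=> [i|i|]; [by case: (he i)|by case: (he i)|].
suff : forall s, uniq s -> all (gtn 4%N) s ->
    acts s g x = acts s b (acts s (fun i => J2 K (e i)) (acts s b' x)) by exact.
elim=> //= i s IH /andP[si us] /andP[i4 s4].
have [_ _ ->] := he i.
rewrite (IH us s4) -(slm_comp _ _ _ i4) -(slm_comp _ _ _ i4).
by rewrite !(slm_acts _ _ _ i4 s4 si).
Qed.

End Bruhat.

(** * Permutations of the slots *)

Definition pw (p : seq nat) (w : weight) : weight :=
  (bt (nth 0 p 0) w, bt (nth 0 p 1) w, bt (nth 0 p 2) w, bt (nth 0 p 3) w).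

Definition S4 : seq (seq nat) :=
  [seq s <- [seq [:: t.1.1; t.1.2; t.2.1; t.2.2] |
     t <- allpairs pair (allpairs pair (iota 0 4) (iota 0 4))
                        (allpairs pair (iota 0 4) (iota 0 4))] | uniq s].

Lemma pw_slot p i w : p \in S4 -> (i < 4)%N ->
  [/\ (nth 0 p i < 4)%N, bt i (pw p w) = bt (nth 0 p i) w &
      fl i (pw p w) = pw p (fl (nth 0 p i) w)].
Proof.
have H : all (fun p => all (fun i => all (fun w =>
    [&& nth 0 p i < 4, bt i (pw p w) == bt (nth 0 p i) w &
      fl i (pw p w) == pw p (fl (nth 0 p i) w)]%N) weights) (iota 0 4)) S4.
  by vm_compute.
move=> pS i4; have ii : i \in iota 0 4 by rewrite mem_iota.
by have /and3P[? /eqP ? /eqP ?] := allP (allP (allP H p pS) i ii) w (mem_weights w).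
Qed.

(** The quotient of [q] by [p]: it passes from a tensor read through [pw p] to the same tensor read
    through [pw q]. *)
Definition permq (p q : seq nat) : seq nat := [seq nth 0%N q (index i p) | i <- iota 0 4].

Lemma permqP p q : p \in S4 -> q \in S4 -> permq p q \in S4 /\ pw p \o pw (permq p q) = pw q.
Proof.
have H : all (fun p => all (fun q =>
   (permq p q \in S4) && all (fun w => pw p (pw (permq p q) w) == pw q w) weights) S4) S4.
  by vm_compute.
move=> pS qS; have /andP[rS /forall_weightP h] := allP (allP H p pS) q qS.
by split; [exact: rS|apply/funext => w; apply/eqP; exact: h].
Qed.

Lemma pw_id : pw [:: 0; 1; 2; 3] = id.
Proof. by apply/funext=> -[[[a b] c] d]. Qed.

Section PermConj.
Variable K : comPzRingType.

Lemma sl_pw p i a b c d (x : weight -> K) : p \in S4 -> (i < 4)%N ->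
  sl i a b c d x \o pw p = sl (nth 0 p i) a b c d (x \o pw p).
Proof.
move=> pS i4; apply/funext => w; rewrite /sl /comp.
by have [_ -> ->] := pw_slot w pS i4.
Qed.

Lemma cj_pw p (x y : weight -> K) : p \in S4 -> cj x y -> cj (x \o pw p) (y \o pw p).
Proof.
move=> pS; elim=> [|{}y i a b c d i4 D _ IH]; first exact: cj_refl.
rewrite sl_pw //; apply: cj_step => //.
by have [] := pw_slot (true, true, true, true) pS i4.
Qed.

Lemma cj_pwI p (x y : weight -> K) : p \in S4 -> cj (x \o pw p) (y \o pw p) -> cj x y.
Proof.
move=> pS; have i4S : [:: 0; 1; 2; 3]%N \in S4 by [].
have [rS pr] := permqP pS i4S.
have E (z : weight -> K) : (z \o pw p) \o pw (permq p [:: 0; 1; 2; 3]%N) = z.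
  by rewrite -compA pr pw_id.
by move/(cj_pw rS); rewrite !E.
Qed.

End PermConj.

(** * The eight standard types *)

(* [lam T] is a one-parameter subgroup, and [hsup T] is the half space of the weights whose
   pairing with it is at least [thr T]. *)
Definition lam (T : nat) : seq nat :=
  nth [::] [:: [:: 1; 1; 1; 1]; [:: 1; 1; 0; 0]; [:: 3; 1; 1; 1]; [:: 1; 0; 0; 0];
    [:: 1; 1; 1; 1]; [:: 2; 2; 1; 1]; [:: 1; 1; 1; 0]; [:: 2; 1; 1; 1]]%N T.

Definition thr (T : nat) : nat := nth 0 [:: 4; 2; 4; 1; 2; 2; 1; 1]%N T.

Definition hsup (T : nat) (w : weight) : bool :=
  (sumn (lam T) + thr T <= 2 * sumn [seq nth 0 (lam T) i * bt i w | i <- slots])%N.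

(** Integer polynomials as lists of monomials: the same data are evaluated over every ring, and
    their vanishing on a coordinate subspace can be tested by computation. *)
Definition poly4 := seq (int * seq weight).

(** Squared, because minus the identity in one slot flips the sign of the coordinate itself. *)
Definition polyA : poly4 := [:: (1%Z, [:: w(+ + + +); w(+ + + +)])].
(** The determinant of the 2x2 slice [x w(+ + _ _)]. *)
Definition polyB : poly4 :=
  [:: (1%Z, [:: w(+ + + +); w(+ + - -)]); ((-1)%Z, [:: w(+ + + -); w(+ + - +)])].
(* The hyperdeterminant of the 2x2x2 slice [x w(+ _ _ _)]. *)
Definition polyD : poly4 := [::
  (1%Z, [:: w(+ + + +); w(+ + + +); w(+ - - -); w(+ - - -)]);
  (1%Z, [:: w(+ + + -); w(+ + + -); w(+ - - +); w(+ - - +)]);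
  (1%Z, [:: w(+ + - +); w(+ + - +); w(+ - + -); w(+ - + -)]);
  (1%Z, [:: w(+ - + +); w(+ - + +); w(+ + - -); w(+ + - -)]);
  ((-2)%Z, [:: w(+ + + +); w(+ + + -); w(+ - - +); w(+ - - -)]);
  ((-2)%Z, [:: w(+ + + +); w(+ + - +); w(+ - + -); w(+ - - -)]);
  ((-2)%Z, [:: w(+ + + +); w(+ - + +); w(+ + - -); w(+ - - -)]);
  ((-2)%Z, [:: w(+ + + -); w(+ + - +); w(+ - + -); w(+ - - +)]);
  ((-2)%Z, [:: w(+ + + -); w(+ - + +); w(+ + - -); w(+ - - +)]);
  ((-2)%Z, [:: w(+ + - +); w(+ - + +); w(+ + - -); w(+ - + -)]);
  (4%Z, [:: w(+ + + +); w(+ + - -); w(+ - + -); w(+ - - +)]);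
  (4%Z, [:: w(+ + + -); w(+ + - +); w(+ - + +); w(+ - - -)])].

Definition mono2 (w w' : weight) : poly4 := [:: (1%Z, [:: w; w'])].
Definition minor2 (w1 w2 w3 w4 : weight) : poly4 :=
  [:: (1%Z, [:: w1; w4]); ((-1)%Z, [:: w2; w3])].

(** Where single coordinates are semi-invariant, products of two are listed, because one coordinate
    has no invariant sign; the signs of the remaining products follow. *)
Definition invs (T : nat) : seq poly4 := nth [::] [::
  [:: polyA];
  [:: polyB];
  [:: mono2 w(+ - + +) w(+ + - +); mono2 w(+ - + +) w(+ + + -)];
  [:: polyD];
  [:: mono2 w(- + + +) w(+ - + +); mono2 w(- + + +) w(+ + - +);
      mono2 w(- + + +) w(+ + + -)];
  [:: mono2 w(+ + - -) w(- + + +); mono2 w(+ + - -) w(+ - + +)];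
  [:: minor2 w(- + + +) w(- + + -) w(+ - + +) w(+ - + -);
      minor2 w(- + + +) w(- + + -) w(+ + - +) w(+ + - -);
      minor2 w(+ - + +) w(+ - + -) w(+ + - +) w(+ + - -)];
  [:: mono2 w(- + + +) w(+ + - -); mono2 w(- + + +) w(+ - + -);
      mono2 w(- + + +) w(+ - - +)]] T.

Section Generic.
Variable K : idomainType.
Implicit Types x : weight -> K.

Definition evm x (m : seq weight) : K := foldr (fun w r => x w * r) 1 m.
Definition evp x (p : poly4) : K := foldr (fun t r => t.1%:~R * evm x t.2 + r) 0 p.

Definition supported (S : pred weight) x := all (fun w => S w || (x w == 0)) weights.

Definition gen (T : nat) x := supported (hsup T) x && all (fun p => evp x p != 0) (invs T).

Lemma supportedP S x : reflect (forall w, ~~ S w -> x w = 0) (supported S x).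
Proof.
apply: (iffP (forall_weightP _)) => h w.
  by move=> nS; move: (h w); rewrite (negbTE nS) => /eqP.
by case: (boolP (S w)) => //= /h ->.
Qed.

Definition restr (S : pred weight) x w := if S w then x w else 0.

Lemma supported_restr S x : supported S x -> x = restr S x.
Proof.
by move/supportedP=> h; apply/funext => w; rewrite /restr; case: ifPn => // /h.
Qed.

(** Only the lower left entry moves a coordinate to a weight of smaller pairing, and where [lam] is
    zero no entry changes the pairing. *)
Lemma supported_parabolic T i (g : mat2 K) x : (T < 8)%N -> (i < 4)%N ->
  g.1.2 = 0 \/ nth 0 (lam T) i = 0%N -> supported (hsup T) x ->
  supported (hsup T) (slm i g x).
Proof.
have H : all (fun T => all (fun i => all (fun w => ~~ hsup T w ==>
   ~~ hsup T (fl i w) || ~~ bt i w && (nth 0%N (lam T) i != 0%N)) weights)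
   (iota 0 4)) (iota 0 8) by vm_compute.
move=> T8 i4 g0 /supportedP xS; apply/supportedP => w nw.
have Ti : T \in iota 0 8 by rewrite mem_iota.
have ii : i \in iota 0 4 by rewrite mem_iota.
have /implyP/(_ nw) := allP (allP (allP H T Ti) i ii) w (mem_weights w).
rewrite /slm /sl xS // !mulr0 addr0 add0r.
case/orP=> [/xS->|/andP[/negbTE-> /eqP l0]]; first by rewrite !mulr0; case: ifP.
by case: g0 => [->|//]; rewrite mul0r.
Qed.

Lemma evp_parabolic T i (g : mat2 K) x : (T < 8)%N -> (i < 4)%N -> det2 g = 1 ->
  g.1.2 = 0 \/ nth 0%N (lam T) i = 0%N -> supported (hsup T) x ->
  List.Forall (fun p => exists2 m : K, m != 0 & evp (slm i g x) p = m ^+ 2 * evp x p)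
    (invs T).
Proof.
move=> T8 i4; case: g => [[[a b] c] d]; rewrite /det2 /= => D + /supported_restr ->.
have oneM (P : K -> Prop) : P 1 -> exists2 m : K, m != 0 & P m.
  by exists 1 => //; exact: oner_neq0.
case=> [c0|]; last first.
  (* The two sides agree only modulo determinant 1; [D1] and [D2] put back the missing power of the
     determinant so that [ring] applies. *)
  have D1 (r s : K) : r = (a * d - b * c) * s -> r = s by rewrite D mul1r.
  have D2 (r s : K) : r = (a * d - b * c) ^+ 2 * s -> r = s by rewrite D expr1n mul1r.
  move=> l0; case: T T8 l0 => [|[|[|[|[|[|[|[|//]]]]]]]] _;
  case: i i4 => [|[|[|[|//]]]] _ //= _; rewrite ?andbT;
  repeat constructor; apply: oneM;
  rewrite /slm /sl /restr /evp /evm /=;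
  solve [ring|apply: D1; ring|apply: D2; ring].
move: D; rewrite c0 mulr0 subr0 => D.
have a0 : a != 0 by apply: contraTneq (oner_neq0 K) => a0; rewrite -D a0 mul0r eqxx.
have d0 : d != 0 by apply: contraTneq (oner_neq0 K) => d0; rewrite -D d0 mulr0 eqxx.
have aa0 : a ^+ 2 != 0 by rewrite expf_eq0 /= a0.
have D1 (r s : K) : r = (a * d) * s -> r = s by rewrite D mul1r.
have D2 (r s : K) : r = (a * d) ^+ 2 * s -> r = s by rewrite D expr1n mul1r.
case: T T8 => [|[|[|[|[|[|[|[|//]]]]]]]] _;
case: i i4 => [|[|[|[|//]]]] _ /=;
  repeat constructor;
  rewrite /slm /sl /restr /evp /evm /=;
  (* The polynomial has weight 2, -2, 4 or 0 in this slot, and [m] is [a], [d], [a ^+ 2] or 1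
     accordingly. *)
  solve [exists a => //; ring|exists d => //; ring| exists (a ^+ 2) => //; ring
   |apply: oneM; solve [ring|apply: D1; ring|apply: D2; ring]].
Qed.

Definition sq_scaled T x y :=
  List.Forall (fun p => exists2 m : K, m != 0 & evp y p = m ^+ 2 * evp x p) (invs T).

Lemma in_ListP (T : eqType) (a : T) s : reflect (List.In a s) (a \in s).
Proof.
elim: s => [|b s IH] /=; first by right.
rewrite inE; apply: (iffP orP) => [[/eqP->|/IH]|[->|/IH]]; rewrite ?eqxx; by [left|right].
Qed.

Lemma gen_sq_scaled T x y :
  supported (hsup T) y -> sq_scaled T x y -> gen T x -> gen T y.
Proof.
move=> yS /List.Forall_forall xy /andP[_ /allP gx]; rewrite /gen yS.
apply/allP => p pT; have [m m0 ->] := xy p (elimT (in_ListP _ _) pT).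
by rewrite mulf_neq0 ?expf_neq0 // gx.
Qed.

Definition parabolic T i (g : mat2 K) :=
  det2 g = 1 /\ (g.1.2 = 0 \/ nth 0%N (lam T) i = 0%N).

Lemma gen_parabolic T i g x : (T < 8)%N -> (i < 4)%N -> parabolic T i g ->
  gen T x -> gen T (slm i g x) /\ sq_scaled T x (slm i g x).
Proof.
move=> T8 i4 [D g0] xg; have /andP[xS _] := xg.
have sc : sq_scaled T x (slm i g x) by apply: evp_parabolic.
by split => //; apply: gen_sq_scaled sc xg; apply: supported_parabolic.
Qed.

Definition xorw (e w : weight) : weight :=
  (bt 0 e (+) bt 0 w, bt 1 e (+) bt 1 w, bt 2 e (+) bt 2 w, bt 3 e (+) bt 3 w).

(** A sufficient criterion that is purely syntactic, so that [disjoint_flipT] can be evaluated. *)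
Definition vanishing (S : pred weight) (p : poly4) :=
  all (fun t => has (fun w => ~~ S w) t.2) p.

Lemma evp_vanishing S x p : supported S x -> vanishing S p -> evp x p = 0.
Proof.
move/supportedP=> xS; elim: p => //= t p IH /andP[/hasP[w wt wS] /IH ->].
suff -> : evm x t.2 = 0 by rewrite mulr0 addr0.
elim: t.2 wt => //= v m IHm; rewrite inE => /orP[/eqP<-|/IHm ->]; last exact: mulr0.
by rewrite (xS _ wS) mul0r.
Qed.

End Generic.

Section Signs.
Variable K : realDomainType.
Implicit Types x : weight -> K.

(* [polyD] is the discriminant of three binary quadratic forms with leading coefficients
   [q2], [q3] and [q4]. If it is negative, these forms are definite, and their signs are
   further invariants. *)
Definition q2 := minor2 w(+ + + +) w(+ + + -) w(+ + - +) w(+ + - -).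
Definition q3 := minor2 w(+ + + +) w(+ + + -) w(+ - + +) w(+ - + -).
Definition q4 := minor2 w(+ + + +) w(+ + - +) w(+ - + +) w(+ - - +).

Definition sgv (T : nat) x : seq K :=
  [seq Num.sg (evp x p) | p <- invs T] ++
  (if (T == 3) && (evp x polyD < 0) then [seq Num.sg (evp x q) | q <- [:: q2; q3; q4]]
   else [::]).

(** Completing the square writes [4 * A] times the value as a square minus the negative discriminant
    times [b ^+ 2], hence as a positive number. *)
Lemma sg_definite (A B C a b : K) : B ^+ 2 - 4 * A * C < 0 -> (a != 0) || (b != 0) ->
  Num.sg (A * a ^+ 2 + B * a * b + C * b ^+ 2) = Num.sg A.
Proof.
move=> D ab; set v := _ + _.
have pos : 0 < 4 * A * v.
  have -> : 4 * A * v = (2 * A * a + B * b) ^+ 2 - (B ^+ 2 - 4 * A * C) * b ^+ 2.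
    by rewrite /v; ring.
  have [b0|b0] := eqVneq b 0.
    have A0 : A != 0 by apply: contraTneq D => ->; rewrite mulr0 mul0r subr0 -leNgt sqr_ge0.
    move: ab; rewrite b0 eqxx orbF => a0.
    by rewrite !mulr0 expr0n !mulr0 subr0 addr0 exprn_even_gt0 // !mulf_neq0 // pnatr_eq0.
  rewrite ltr_wpDl ?sqr_ge0 // oppr_gt0 pmulr_llt0 // exprn_even_gt0 //.
move: pos; rewrite -mulrA pmulr_rgt0 ?ltr0n //.
have [A0|A0|->] := ltrgt0P A; last by rewrite mul0r ltxx.
  by rewrite pmulr_rgt0 // => v0; rewrite !gtr0_sg.
by rewrite nmulr_rgt0 // => v0; rewrite !ltr0_sg.
Qed.

Lemma sgr_sqM (m r : K) : m != 0 -> Num.sg (m ^+ 2 * r) = Num.sg r.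
Proof. by move=> m0; rewrite sgrM gtr0_sg ?mul1r // exprn_even_gt0. Qed.

Lemma sgv_sq T x y : T != 3 -> sq_scaled T x y -> sgv T y = sgv T x.
Proof.
move=> /negbTE T3 /List.Forall_forall h; rewrite /sgv T3 /= !cats0.
apply/eq_in_map => p pT; have [m m0 ->] := h p (elimT (in_ListP _ _) pT).
exact: sgr_sqM.
Qed.

Lemma sgv_parabolic T i g x : (T < 8)%N -> (i < 4)%N -> parabolic T i g ->
  gen T x -> sgv T (slm i g x) = sgv T x.
Proof.
move=> T8 i4 gp xg; have [yg sc] := gen_parabolic T8 i4 gp xg.
have [T3|T3] := eqVneq T 3; last exact: sgv_sq.
have [m m0 yD] : exists2 m : K, m != 0 & evp (slm i g x) polyD = m ^+ 2 * evp x polyD.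
  by move: (sc); rewrite T3 => h; exact: (List.Forall_inv h).
have sD : Num.sg (evp (slm i g x) polyD) = Num.sg (evp x polyD).
  by rewrite yD sgr_sqM.
rewrite /sgv T3 /= sD; congr (_ :: _).
rewrite -sgr_lt0 sD sgr_lt0; case: ifP => // D0.
move: gp; rewrite T3 => -[Dg].
case: g Dg {yg sc yD sD} => [[[a b] c] d]; rewrite /det2 /= => Dg p0.
have D1 (r s : K) : r = (a * d - b * c) * s -> r = s by rewrite Dg mul1r.
have ab : (a != 0) || (b != 0).
  rewrite -negb_and; apply: contra_eqN Dg => /andP[/eqP-> /eqP->].
  by rewrite !mul0r subr0 eq_sym oner_eq0.
have := xg; rewrite T3 => /andP[/supported_restr xE _].
(* Slot 0 multiplies all three leading coefficients by [a ^+ 2]. Each other slot replaces one of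
   them by the value of its definite form at [(a, b)] and leaves the other two alone. *)
case: i i4 p0 => [|[|[|[|//]]]] _ /= p0.
- case: p0 => // c0; rewrite c0 mulr0 subr0 in Dg.
  have a0 : a != 0 by apply: contraTneq (oner_neq0 K) => a0; rewrite -Dg a0 mul0r eqxx.
  have a2 (r s : K) : r = a ^+ 2 * s -> Num.sg r = Num.sg s.
    by move=> ->; exact: sgr_sqM.
  by congr [:: _; _; _]; rewrite xE; apply: a2; rewrite /slm /sl /restr /evp /evm /=; ring.
- have /sg_definite/(_ ab) sgA :
    (x w(+ + + +) * x w(+ - - -) + x w(+ - + +) * x w(+ + - -)
       - x w(+ + + -) * x w(+ - - +) - x w(+ - + -) * x w(+ + - +)) ^+ 2
    - 4 * (x w(+ + + +) * x w(+ + - -) - x w(+ + + -) * x w(+ + - +))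
      * (x w(+ - + +) * x w(+ - - -) - x w(+ - + -) * x w(+ - - +)) < 0.
    by move: D0; rewrite /evp /evm /=; congr (_ < 0); ring.
  congr [:: _; _; _]; solve [congr Num.sg; apply: D1; rewrite /slm /sl /=; ring |
    transitivity (Num.sg (x w(+ + + +) * x w(+ + - -) - x w(+ + + -) * x w(+ + - +)));
    [rewrite -sgA|]; congr Num.sg; rewrite /slm /sl /=; ring].
- have /sg_definite/(_ ab) sgA :
    (x w(+ + + +) * x w(+ - - -) + x w(+ + - +) * x w(+ - + -)
       - x w(+ + + -) * x w(+ - - +) - x w(+ + - -) * x w(+ - + +)) ^+ 2
    - 4 * (x w(+ + + +) * x w(+ - + -) - x w(+ + + -) * x w(+ - + +))
      * (x w(+ + - +) * x w(+ - - -) - x w(+ + - -) * x w(+ - - +)) < 0.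
    by move: D0; rewrite /evp /evm /=; congr (_ < 0); ring.
  congr [:: _; _; _]; solve [congr Num.sg; apply: D1; rewrite /slm /sl /=; ring |
    transitivity (Num.sg (x w(+ + + +) * x w(+ - + -) - x w(+ + + -) * x w(+ - + +)));
    [rewrite -sgA|]; congr Num.sg; rewrite /slm /sl /=; ring].
- have /sg_definite/(_ ab) sgA :
    (x w(+ + + +) * x w(+ - - -) + x w(+ + + -) * x w(+ - - +)
       - x w(+ + - +) * x w(+ - + -) - x w(+ + - -) * x w(+ - + +)) ^+ 2
    - 4 * (x w(+ + + +) * x w(+ - - +) - x w(+ + - +) * x w(+ - + +))
      * (x w(+ + + -) * x w(+ - - -) - x w(+ + - -) * x w(+ - + -)) < 0.
    by move: D0; rewrite /evp /evm /=; congr (_ < 0); ring.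
  congr [:: _; _; _]; solve [congr Num.sg; apply: D1; rewrite /slm /sl /=; ring |
    transitivity (Num.sg (x w(+ + + +) * x w(+ - - +) - x w(+ + - +) * x w(+ - + +)));
    [rewrite -sgA|]; congr Num.sg; rewrite /slm /sl /=; ring].
Qed.

End Signs.

(** * Uniqueness of the type *)

Definition invp (r : seq nat) : seq nat := [seq index i r | i <- iota 0 4].

Lemma pw_invp r w : r \in S4 -> pw r (pw (invp r) w) = w.
Proof.
have H : all (fun r => all (fun w => pw r (pw (invp r) w) == w) weights) S4.
  by vm_compute.
by move=> rS; apply/eqP/(allP (allP H r rS))/mem_weights.
Qed.

Lemma xorwK e w : xorw e (xorw e w) = w.
Proof. by move: e w => [[[[] []] []] []] [[[[] []] []] []]. Qed.

(* A Weyl group element can relate generic tensors of types [T] and [T'] only in the third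
   case: in the first two it forces a semi-invariant to vanish. *)
Definition disjoint_flip (T T' : nat) (r : seq nat) (e : weight) : bool :=
  [|| has (vanishing (fun w => hsup T w && hsup T' (pw (invp r) (xorw e w)))) (invs T),
      has (vanishing (fun w' => hsup T' w' && hsup T (xorw e (pw r w')))) (invs T') |
      [&& T == T', all (fun i => nth 0 (lam T) (nth 0 r i) == nth 0 (lam T) i) slots &
          all (fun i => bt i e ==> (nth 0 (lam T) i == 0)) slots]]%N.

Lemma disjoint_flipT T T' r e : (T < 8)%N -> (T' < 8)%N -> r \in S4 ->
  disjoint_flip T T' r e.
Proof.
have H : all (fun T => all (fun T' => all (fun r => all (disjoint_flip T T' r) weights) S4)
   (iota 0 8)) (iota 0 8) by vm_compute.
move=> T8 T'8 rS; have Ti : T \in iota 0 8 by rewrite mem_iota.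
have T'i : T' \in iota 0 8 by rewrite mem_iota.
exact: (allP (allP (allP (allP H T Ti) T' T'i) r rS) e (mem_weights e)).
Qed.

Section Kempf.
Variable K : fieldType.
Implicit Types x y z : weight -> K.

Lemma slm_J2_eq0 i e y w : (slm i (J2 K e) y w == 0) = (y (if e then fl i w else w) == 0).
Proof.
rewrite /slm /sl; case: e => /=; case: (bt i w);
  by rewrite !(mul0r, mul1r, mulN1r, addr0, add0r) ?oppr_eq0.
Qed.

Lemma acts_J2_eq0 e y w :
  (acts slots (fun i => J2 K (bt i e)) y w == 0) = (y (xorw e w) == 0).
Proof.
rewrite /acts /= !slm_J2_eq0; congr (y _ == 0); move: e w.
by case=> [[[[] []] []] []] [[[[] []] []] []].
Qed.

(** The tensor [z] lives on its own half space and on the transported one of [T']. In the first two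
    cases of [disjoint_flip] the intersection is so small that a semi-invariant of one side
    vanishes, against genericity. *)
Lemma kempf T T' r e z : (T < 8)%N -> (T' < 8)%N -> r \in S4 ->
  gen T z -> gen T' (acts slots (fun i => J2 K (bt i e)) z \o pw r) ->
  [/\ T = T', all (fun i => nth 0 (lam T) (nth 0 r i) == nth 0 (lam T) i)%N slots &
      all (fun i => bt i e ==> (nth 0 (lam T) i == 0))%N slots].
Proof.
move=> T8 T'8 rS /andP[zS zg] /andP[z'S z'g].
have J0 w' : ~~ hsup T' w' -> z (xorw e (pw r w')) = 0.
  by move/(supportedP _ _ z'S)/eqP; rewrite /= acts_J2_eq0 => /eqP.
have/or3P[/hasP[p pT]|/hasP[p pT]|/and3P[/eqP]] // := disjoint_flipT e T8 T'8 rS.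
  move/evp_vanishing => h; move: (allP zg p pT); rewrite h ?eqxx //.
  apply/supportedP => w; rewrite negb_and => /orP[|/J0]; first exact/supportedP.
  by rewrite pw_invp // xorwK.
move/evp_vanishing => h; move: (allP z'g p pT); rewrite h ?eqxx //.
apply/supportedP => w'; rewrite negb_and => /orP[|/(supportedP _ _ zS) z0].
  exact/supportedP.
by apply/eqP; rewrite /= acts_J2_eq0 z0.
Qed.

Definition inv2 (g : mat2 K) : mat2 K := (g.2, - g.1.1.2, - g.1.2, g.1.1.1).

Lemma slm_inv2 i g x : (i < 4)%N -> det2 g = 1 -> slm i (inv2 g) (slm i g x) = x.
Proof.
move=> i4; case: g => [[[a b] c] d]; rewrite /det2 /= => D.
rewrite slm_comp // -[RHS](sl1 i) /slm /=; congr (sl i _ _ _ _ x); rewrite -?D; ring.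
Qed.

Lemma parabolic_inv2 T i g : parabolic T i g -> parabolic T i (inv2 g).
Proof.
case: g => [[[a b] c] d] [D c0]; split; first by rewrite -D /det2 /=; ring.
by case: c0 => [/= ->|]; [left; rewrite /= oppr0|right].
Qed.

Lemma gen_parabolicI T i g x : (T < 8)%N -> (i < 4)%N -> parabolic T i g ->
  gen T (slm i g x) -> gen T x.
Proof.
move=> T8 i4 gp; case: (gp) => D _; rewrite -{2}(slm_inv2 x i4 D).
by move/(gen_parabolic T8 i4 (parabolic_inv2 gp)) => [].
Qed.

Lemma upper_parabolic T i (g : mat2 K) : upper2 g -> parabolic T i g.
Proof. by case=> D c0; split; [|left]. Qed.

Lemma gen_acts T g x : (T < 8)%N -> (forall i, (i < 4)%N -> parabolic T i (g i)) ->
  gen T x -> gen T (acts slots g x).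
Proof.
move=> T8 gp xg; have : all (gtn 4%N) slots by [].
elim: slots => //= i s IH /andP[i4 /IH h].
by have [] := gen_parabolic T8 i4 (gp _ i4) h.
Qed.

(** Upper triangular matrices lie in the parabolic subgroup of every type, also after a slot
    permutation, so the outer Bruhat factor can be stripped off. *)
Lemma gen_acts_pwI T r g x : (T < 8)%N -> r \in S4 -> (forall i, upper2 (g i)) ->
  gen T (acts slots g x \o pw r) -> gen T (x \o pw r).
Proof.
move=> T8 rS gp; have : all (gtn 4%N) slots by [].
elim: slots => //= i s IH /andP[i4 /IH h].
rewrite /slm sl_pw // => /(@gen_parabolicI T _ (g i) _ T8) q; apply/h/q.
  by have [] := pw_slot (true, true, true, true) rS i4.
exact: upper_parabolic.
Qed.

(** Valid over any field, hence also for complex conjugacy. The second conclusion tells apart the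
    families of one type, which differ by slot permutations only. *)
Lemma gen_cj_lam T T' r x y : (T < 8)%N -> (T' < 8)%N -> r \in S4 ->
  cj x y -> gen T x -> gen T' (y \o pw r) ->
  T = T' /\ all (fun i => nth 0 (lam T) (nth 0 r i) == nth 0 (lam T) i)%N slots.
Proof.
move=> T8 T'8 rS /cj_bruhat[b [b' [e [ub ub' ->]]]] xg /(gen_acts_pwI T'8 rS ub).
have x1g : gen T (acts slots b' x).
  by apply: gen_acts => // i _; apply: upper_parabolic.
by move=> yg; have [] := @kempf T T' r (e 0, e 1, e 2, e 3)%N _ T8 T'8 rS x1g yg.
Qed.

End Kempf.

Section KempfSigns.
Variable K : realFieldType.
Implicit Types x y z : weight -> K.

Lemma sgv_acts T g x : (T < 8)%N -> (forall i, (i < 4)%N -> parabolic T i (g i)) ->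
  gen T x -> sgv T (acts slots g x) = sgv T x.
Proof.
move=> T8 gp xg; suff : gen T (acts slots g x) /\ sgv T (acts slots g x) = sgv T x by case.
have : all (gtn 4%N) slots by [].
elim: slots => //= i s IH /andP[i4 /IH [h1 h2]].
rewrite (sgv_parabolic T8 i4 (gp _ i4) h1); split => //.
by have [] := gen_parabolic T8 i4 (gp _ i4) h1.
Qed.

(** By [kempf] the Weyl factor flips only slots where [lam] is zero, so all three Bruhat factors lie
    in the parabolic subgroup and preserve the signs. *)
Lemma gen_cj_sgv T x y : (T < 8)%N -> cj x y -> gen T x -> gen T y -> sgv T y = sgv T x.
Proof.
move=> T8 /cj_bruhat[b [b' [e [ub ub' ->]]]] xg yg.
have bp i : (i < 4)%N -> parabolic T i (b i) by move=> _; apply: upper_parabolic.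
have b'p i : (i < 4)%N -> parabolic T i (b' i) by move=> _; apply: upper_parabolic.
have x1g := gen_acts T8 b'p xg.
have id4 : [:: 0; 1; 2; 3]%N \in S4 by [].
have y1g : gen T (acts slots (fun i => J2 K (e i)) (acts slots b' x)).
  have idE (f : weight -> K) : f = f \o pw [:: 0; 1; 2; 3]%N by rewrite pw_id.
  by move: yg; rewrite (idE (acts slots b _)) => /(gen_acts_pwI T8 id4 ub); rewrite pw_id.
have := @kempf _ T T [:: 0; 1; 2; 3]%N (e 0, e 1, e 2, e 3)%N _ T8 T8 id4 x1g.
rewrite pw_id => /(_ y1g)[_ _ /allP he].
rewrite sgv_acts // sgv_acts //; last first.
  move=> i i4; split; first by rewrite /J2 /det2; case: (e i) => /=; ring.
  have is4 : i \in slots by case: i i4 => [|[|[|[|]]]].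
  move: (he i is4); case: i i4 {is4} => [|[|[|[|//]]]] _ /=;
  by case: (e _) => [/eqP ?|_]; [right|left].
by rewrite sgv_acts.
Qed.

End KempfSigns.

(** * Normal forms *)

Definition mtens (K : pzRingType) (l : seq (K * weight)) (w : weight) : K :=
  foldr (fun t r => (if w == t.2 then t.1 else 0) + r) 0 l.

(** The coordinates that survive once the non-toral part of the parabolic subgroup has been used up.
    In each type these weights are linearly independent, which [torus_weights] exploits. *)
Definition nfw (T : nat) : seq weight := nth [::] [::
  [:: w(+ + + +)];
  [:: w(+ + + +); w(+ + - -)];
  [:: w(+ - + +); w(+ + - +); w(+ + + -)];
  [:: w(+ + + +); w(+ + - -); w(+ - + -); w(+ - - +)];
  [:: w(- + + +); w(+ - + +); w(+ + - +); w(+ + + -)];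
  [:: w(+ + - -); w(- + + +); w(+ - + +)];
  [:: w(- + + +); w(+ - + -); w(+ + - +); w(+ + - -)];
  [:: w(- + + +); w(+ + - -); w(+ - + -); w(+ - - +)]] T.

Arguments evp : simpl never.

Section NormalForm.
Variable K : realFieldType.
Implicit Types x y : weight -> K.

Lemma evp_mono2 x a b : evp x (mono2 a b) = x a * x b.
Proof. by rewrite /evp /evm /= mulr1 mul1r addr0. Qed.

Lemma evp_minor2 x a b c d : evp x (minor2 a b c d) = x a * x d - x b * x c.
Proof. by rewrite /evp /evm /=; ring. Qed.

Lemma evp_polyB x : evp x polyB = x w(+ + + +) * x w(+ + - -) - x w(+ + + -) * x w(+ + - +).
Proof. exact: (evp_minor2 x w(+ + + +) w(+ + + -) w(+ + - +) w(+ + - -)). Qed.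

Lemma supported_mtens ws y : uniq ws -> supported (mem ws) y ->
  y = mtens [seq (y w, w) | w <- ws].
Proof.
move=> us /supportedP ys; apply/funext => w.
case: (boolP (w \in ws)) => [|wn]; last first.
  rewrite ys //; elim: ws us wn {ys} => //= v ws IH /andP[_ us].
  by rewrite inE negb_or => /andP[/negbTE-> /(IH us) <-]; rewrite addr0.
have N ws' : w \notin ws' -> mtens [seq (y w, w) | w <- ws'] w = 0.
  elim: ws' => //= v ws' IH; rewrite inE negb_or => /andP[/negbTE-> /IH ->].
  by rewrite addr0.
elim: ws us {ys} => //= v ws IH /andP[vs us]; rewrite inE => /orP[/eqP E|ws1].
  by rewrite E eqxx -E N ?addr0 // E.
by rewrite -(IH us ws1); case: eqP vs => [<-|_]; rewrite ?ws1 ?add0r.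
Qed.

Definition reduces_to (T : nat) x :=
  exists2 y, cj x y & supported (mem (nfw T)) y && all (fun w => y w != 0) (nfw T).

Ltac check_support :=
  apply/supportedP => -[[[[] []] []] []] //= _; rewrite /sl /restr /=.

Lemma reduceA x : gen 0 x -> reduces_to 0 x.
Proof.
case/andP=> xS /=; rewrite andbT (evp_mono2 _ w(+ + + +) w(+ + + +)) mulf_eq0 orbb => x0.
exists x; first exact: cj_refl.
rewrite /= x0 !andbT; apply/supportedP => v; move/supportedP: xS => xS.
by move=> vn; apply: xS; move: v vn => [[[[] []] []] []].
Qed.

Lemma reduceB x : gen 1 x -> reduces_to 1 x.
Proof.
case/andP=> /supported_restr -> /=; rewrite andbT evp_polyB.
set y := restr _ x; set d := _ - _ => d0.
(* The matrix is diag(1, d) times the inverse of the 2x2 slice, so it has determinant 1 and turns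
   the slice into diag(1, d). *)
exists (sl 2 (y w(+ + - -) / d) (- y w(+ + + -) / d) (- y w(+ + - +)) (y w(+ + + +)) y).
  by apply: cj_sl => //; move: d0; rewrite /d => d0; field.
apply/andP; split.
  by move: d0; rewrite /d /y; clear; move=> d0; check_support; first [by ring|by field].
rewrite /= andbT /sl /=; apply/andP; split.
  by rewrite (_ : _ + _ = 1) ?oner_neq0 //; move: d0; rewrite /d => d0; field.
by move: d0; rewrite /d; congr (_ != 0); ring.
Qed.

Lemma neq0_mul3 (a b c : K) : (a * b != 0) && (a * c != 0) -> [/\ a != 0, b != 0 & c != 0].
Proof. by rewrite !mulf_eq0 !negb_or => /andP[/andP[-> ->] /andP[_ ->]]. Qed.

Lemma reduceC x : gen 2 x -> reduces_to 2 x.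
Proof.
case/andP=> /supported_restr -> /=; set y := restr _ x.
rewrite andbT !evp_mono2 => /neq0_mul3[b2 b3 b4].
exists (sl 1 1 (- y w(+ + + +) / y w(+ - + +)) 0 1 y).
  by apply: cj_sl => //; ring.
apply/andP; split; last first.
  move: b2 b3 b4; rewrite /y; clear; rewrite /= /sl /restr /= => b2 b3 b4.
  by rewrite !(mul0r, mul1r, add0r, mulr0, addr0) b2 b3 b4.
by move: b2; rewrite /y; clear; move=> b2; check_support; first [by ring|by field].
Qed.

Lemma reduceE x : gen 4 x -> reduces_to 4 x.
Proof.
case/andP=> /supported_restr -> /=; set y := restr _ x.
rewrite andbT !evp_mono2 => /andP[h /andP[]].
have [b1 b2 _] : [/\ y w(- + + +) != 0, y w(+ - + +) != 0 & y w(+ - + +) != 0].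
  exact: neq0_mul3 (introT andP (conj h h)).
rewrite !mulf_eq0 !negb_or => /andP[_ b3] /andP[_ b4].
exists (sl 0 1 (- y w(+ + + +) / y w(- + + +)) 0 1 y).
  by apply: cj_sl => //; ring.
apply/andP; split; last first.
  move: b1 b2 b3 b4; rewrite /y; clear; rewrite /= /sl /restr /= => b1 b2 b3 b4.
  by rewrite !(mul0r, mul1r, add0r, mulr0, addr0) b1 b2 b3 b4.
by move: b1; rewrite /y; clear; move=> b1; check_support; first [by ring|by field].
Qed.

Lemma reduceF x : gen 5 x -> reduces_to 5 x.
Proof.
case/andP=> /supported_restr -> /=; set y := restr _ x.
rewrite andbT !evp_mono2 => /neq0_mul3[b1 b2 b3].
pose y1 := sl 2 1 (- y w(+ + + -) / y w(+ + - -)) 0 1 y.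
pose y2 := sl 3 1 (- y w(+ + - +) / y w(+ + - -)) 0 1 y1.
exists (sl 0 1 (- y2 w(+ + + +) / y w(- + + +)) 0 1 y2).
  by do 3![apply: cj_step; rewrite ?mulr0 ?subr0 ?mulr1 //]; apply: cj_refl.
apply/andP; split; last first.
  move: b1 b2 b3; rewrite /y2 /y1 /y; clear; rewrite /= /sl /restr /= => b1 b2 b3.
  by rewrite !(mul0r, mul1r, add0r, mulr0, addr0) b1 b2 b3.
by move: b1 b2 b3; rewrite /y2 /y1 /y; clear; move=> b1 b2 b3; check_support;
  first [by ring|by field; rewrite ?b1 ?b2 ?b3].
Qed.

Lemma reduceH x : gen 7 x -> reduces_to 7 x.
Proof.
case/andP=> /supported_restr -> /=; set y := restr _ x.
rewrite andbT !evp_mono2 !mulf_eq0 !negb_or => /and3P[/andP[b1 b2] /andP[_ b3] /andP[_ b4]].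
(* Steps with parameters s1, s2, s3 in the slots 1, 2, 3 must kill three coordinates. With u1, u2,
   u3 the parameters times the denominators below, the conditions read a2 + u2 + u3 = a3 + u1 + u3 =
   a4 + u1 + u2 = 0. *)
pose a2 := y w(+ - + +) * y w(+ + - -).
pose a3 := y w(+ + - +) * y w(+ - + -).
pose a4 := y w(+ + + -) * y w(+ - - +).
pose y1 := sl 1 1 ((a2 - a3 - a4) / 2 / (y w(+ - + -) * y w(+ - - +))) 0 1 y.
pose y2 := sl 2 1 ((a3 - a2 - a4) / 2 / (y w(+ + - -) * y w(+ - - +))) 0 1 y1.
pose y3 := sl 3 1 ((a4 - a2 - a3) / 2 / (y w(+ + - -) * y w(+ - + -))) 0 1 y2.
exists (sl 0 1 (- y3 w(+ + + +) / y w(- + + +)) 0 1 y3).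
  by do 4![apply: cj_step; rewrite ?mulr0 ?subr0 ?mulr1 //]; apply: cj_refl.
apply/andP; split; last first.
  move: b1 b2 b3 b4; rewrite /y3 /y2 /y1 /y; clear; rewrite /= /sl /restr /= => b1 b2 b3 b4.
  by rewrite !(mul0r, mul1r, add0r, mulr0, addr0) b1 b2 b3 b4.
move: b1 b2 b3 b4; rewrite /y3 /y2 /y1 /a2 /a3 /a4 /y; clear; move=> b1 b2 b3 b4.
by check_support; first [by ring|by field; rewrite ?b1 ?b2 ?b3 ?b4].
Qed.

Lemma reduceG x : gen 6 x -> reduces_to 6 x.
Proof.
case/andP=> /supported_restr -> /=; set y := restr _ x.
rewrite andbT !evp_minor2; set d12 := _ - _; set d13 := _ - _; set d23 := _ - _.
move=> /and3P[b1 b2 b3].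
(* Cramer's rule: the pair [+ + + _] is cleared by a combination of the pairs [- + + _] and
   [+ - + _], which are independent because [d12] is nonzero. *)
pose y1 := sl 0 1 (- (y w(+ + + +) * y w(+ - + -) - y w(+ + + -) * y w(+ - + +)) / d12) 0 1 y.
pose y2 := sl 1 1 (- (y w(- + + +) * y w(+ + + -) - y w(- + + -) * y w(+ + + +)) / d12) 0 1 y1.
(* This matrix sends the pairs [- + + _] and [+ - + _] to (1, 0) and (0, d12). *)
exists (sl 3 (y w(+ - + -) / d12) (- y w(+ - + +) / d12) (- y w(- + + -)) (y w(- + + +)) y2).
  apply: cj_step => //; first by move: b1; rewrite /d12 => b1; field.
  by do 2![apply: cj_step; rewrite ?mulr0 ?subr0 ?mulr1 //]; apply: cj_refl.
apply/andP; split.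
  by move: b1; rewrite /y2 /y1 /d12 /y; clear; move=> b1; check_support;
    first [by ring|by field].
rewrite /= andbT; apply/and4P; split.
- rewrite (_ : sl _ _ _ _ _ _ _ = 1) ?oner_neq0 //.
  by move: b1; rewrite /y2 /y1 /d12 /y; clear; rewrite /sl /restr /= => b1; field.
- rewrite (_ : sl _ _ _ _ _ _ _ = d12) //.
  by move: b1; rewrite /y2 /y1 /d12 /y; clear; rewrite /sl /restr /= => b1; field.
- rewrite (_ : sl _ _ _ _ _ _ _ = - d23 / d12) ?mulf_neq0 ?invr_neq0 ?oppr_eq0 //.
  by move: b1; rewrite /y2 /y1 /d23 /d12 /y; clear; rewrite /sl /restr /= => b1; field.
rewrite (_ : sl _ _ _ _ _ _ _ = d13) //.
by move: b1; rewrite /y2 /y1 /d13 /d12 /y; clear; rewrite /sl /restr /= => b1; field.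
Qed.

End NormalForm.

(** * Type 3: three-slot tensors as pencils of 2x2 matrices *)

Section ThreeQubits.
Variable K : realFieldType.
Implicit Types x y : weight -> K.

(** Coefficients of the form det(s Y+ + t Y-), where Y+ and Y- are the slices of [x w(+ _ _ _)] with
    sign + and - in slot 1; the discriminant is [polyD]. *)
Definition sliceP x := x w(+ + + +) * x w(+ + - -) - x w(+ + + -) * x w(+ + - +).
Definition sliceX x := x w(+ + + +) * x w(+ - - -) + x w(+ - + +) * x w(+ + - -)
  - x w(+ + + -) * x w(+ - - +) - x w(+ - + -) * x w(+ + - +).
Definition sliceM x := x w(+ - + +) * x w(+ - - -) - x w(+ - + -) * x w(+ - - +).

Lemma evp_polyD x : evp x polyD = sliceX x ^+ 2 - 4 * sliceP x * sliceM x.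
Proof. by rewrite /evp /evm /sliceX /sliceP /sliceM /=; ring. Qed.

Definition supD := hsup 3.

Lemma evp_polyD_sl1 a b c d x : a * d - b * c = 1 ->
  evp (sl 1 a b c d x) polyD = evp x polyD.
Proof.
move=> D; transitivity ((a * d - b * c) ^+ 2 * evp x polyD).
  by rewrite /evp /evm /sl /=; ring.
by rewrite D expr1n mul1r.
Qed.

Lemma slD i a b c d x : i != 0%N -> (i < 4)%N ->
  supported supD x -> a * d - b * c = 1 -> supported supD (sl i a b c d x).
Proof.
move=> i0 i4 xS D; apply: (@supported_parabolic _ 3 i (a, b, c, d)) => //.
by right; case: i i0 i4 => [|[|[|[|]]]].
Qed.

(* The binary quadratic form [det (s Y+ + t Y-)] of the two slices is diagonalised
   by the second slot. *)
Lemma diagonalise_slices x : supported supD x ->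
  [|| sliceP x != 0, sliceX x != 0 | sliceM x != 0] ->
  exists y, [/\ cj x y, supported supD y, evp y polyD = evp x polyD, sliceP y != 0 & sliceX y = 0].
Proof.
move=> xS h.
have [y [xy yS yD yP]] : exists y,
    [/\ cj x y, supported supD y, evp y polyD = evp x polyD & sliceP y != 0].
  have [P0|P0] := eqVneq (sliceP x) 0; last first.
    by exists x; split => //; exact: cj_refl.
  have [M0|M0] := eqVneq (sliceM x) 0.
    (* Only the middle coefficient is nonzero here, and adding the second slice to the first makes
       it the leading one. *)
    exists (sl 1 1 1 0 1 x).
    have D : 1 * 1 - 1 * 0 = 1 :> K by ring.
    split; [exact: cj_sl|exact: slD|exact: evp_polyD_sl1|].
    move: h; rewrite P0 M0 eqxx orbF /=; congr (_ != 0).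
    transitivity (sliceP x + sliceX x + sliceM x); first by rewrite P0 M0 add0r addr0.
    by rewrite /sliceP /sliceX /sliceM /sl /=; ring.
  exists (sl 1 0 1 (-1) 0 x).
  have D : 0 * 0 - 1 * -1 = 1 :> K by ring.
  split; [exact: cj_sl|exact: slD|exact: evp_polyD_sl1|].
  by move: M0; congr (_ != 0); rewrite /sliceP /sliceM /sl /=; ring.
have D : 1 * 1 - 0 * (- sliceX y / (2 * sliceP y)) = 1 by ring.
exists (sl 1 1 0 (- sliceX y / (2 * sliceP y)) 1 y); split.
- exact: cj_step.
- exact: slD.
- by rewrite evp_polyD_sl1.
- by move: yP; congr (_ != 0); rewrite /sliceP /sl /=; ring.
transitivity (sliceX y + 2 * (- sliceX y / (2 * sliceP y)) * sliceP y).
  by move: (_ / _) => t; rewrite /sliceX /sliceP /sl /=; ring.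
by field.
Qed.

(** The analogous form for the slices along slot 3. It has the same discriminant, so it is nonzero
    whenever [polyD] is. *)
Definition offL x := x w(+ + + +) * x w(+ - - +) - x w(+ + - +) * x w(+ - + +).
Definition offX x := x w(+ + + +) * x w(+ - - -) + x w(+ + + -) * x w(+ - - +)
  - x w(+ + - +) * x w(+ - + -) - x w(+ + - -) * x w(+ - + +).
Definition offR x := x w(+ + + -) * x w(+ - - -) - x w(+ + - -) * x w(+ - + -).

Lemma evp_polyD_off x : evp x polyD = offX x ^+ 2 - 4 * offL x * offR x.
Proof. by rewrite /evp /evm /offX /offL /offR /=; ring. Qed.

Lemma det_sl3 a b c d x : a * d - b * c = 1 ->
  [/\ sliceP (sl 3 a b c d x) = sliceP x, sliceX (sl 3 a b c d x) = sliceX x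
    & sliceM (sl 3 a b c d x) = sliceM x].
Proof.
move=> D; split; rewrite -[RHS]mul1r -D /sliceP /sliceX /sliceM /sl /=; ring.
Qed.

Lemma offL_neq0 x : supported supD x -> evp x polyD != 0 ->
  exists y, [/\ cj x y, supported supD y, offL y != 0 &
    [/\ sliceP y = sliceP x, sliceX y = sliceX x & sliceM y = sliceM x]].
Proof.
move=> xS xD; have [L0|L0] := eqVneq (offL x) 0; last first.
  by exists x; split => //; exact: cj_refl.
have [R0|R0] := eqVneq (offR x) 0; last first.
  exists (sl 3 0 1 (-1) 0 x).
  have D : 0 * 0 - 1 * -1 = 1 :> K by ring.
  split; [exact: cj_sl|exact: slD| |exact: det_sl3].
  by move: R0; congr (_ != 0); rewrite /offL /offR /sl /=; ring.
have X0 : offX x != 0.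
  by apply: contraNneq xD => X0; rewrite evp_polyD_off X0 L0 expr0n mulr0 mul0r subr0.
exists (sl 3 1 1 0 1 x).
have D : 1 * 1 - 1 * 0 = 1 :> K by ring.
split; [exact: cj_sl|exact: slD| |exact: det_sl3].
move: X0; congr (_ != 0); transitivity (offL x + offX x + offR x).
  by rewrite L0 R0 add0r addr0.
by rewrite /offL /offX /offR /sl /=; ring.
Qed.

Lemma reduceD x : gen 3 x -> reduces_to 3 x.
Proof.
case/andP=> xS /=; rewrite andbT => xD.
have h : [|| sliceP x != 0, sliceX x != 0 | sliceM x != 0].
  apply: contraNT xD; rewrite !negb_or !negbK => /and3P[/eqP P0 /eqP X0 _].
  by rewrite evp_polyD P0 X0 expr0n mulr0 mul0r subr0.
have [y [xy yS yD yP yX]] := diagonalise_slices xS h.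
have yM : sliceM y != 0.
  apply: contraNneq xD => yM.
  by rewrite -yD evp_polyD yX yM expr0n mulr0 subr0.
rewrite -yD in xD; have [z [yz zS zL [zP zX zM]]] := offL_neq0 yS xD.
rewrite -zP in yP; rewrite -zX in yX; rewrite -zM in yM.
(* With Y+ and Y- the slices along slot 1, this [t] kills the upper left entry of adj(Y+) Y-. The
   trace of that product is [sliceX], which is zero, so the lower right entry vanishes too
   ([uF]). *)
pose t := (z w(+ + - -) * z w(+ - + +) - z w(+ + + -) * z w(+ - - +)) / offL z.
have D1 : 1 * 1 - 0 * t = 1 by ring.
pose u := sl 3 1 0 t 1 z.
have [uP uX uM] := det_sl3 z D1; rewrite -/u in uP uX uM.
rewrite -uP in yP; rewrite -uX in yX; rewrite -uM in yM.
have uS : supported supD u by exact: slD.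
have uL : offL u != 0 by move: zL; congr (_ != 0); rewrite /u /offL /sl /=; ring.
have uE : u w(+ + - -) * u w(+ - + +) = u w(+ + + -) * u w(+ - - +).
  by move: zL; rewrite /u /t /offL /sl /= => zL; field.
have uF : u w(+ + + +) * u w(+ - - -) = u w(+ + - +) * u w(+ - + -).
  apply: (addIr (u w(+ + - -) * u w(+ - + +))); apply/eqP; rewrite -subr_eq0 {2}uE.
  by apply/eqP; rewrite -[RHS]yX /sliceX; ring.
have D2 : u w(+ + - -) / sliceP u * u w(+ + + +)
    - (- u w(+ + + -) / sliceP u) * (- u w(+ + - +)) = 1.
  by move: yP; rewrite /sliceP => yP; field.
(* As for type 1, Y+ becomes diag(1, det Y+); by the choice of [t], Y- becomes antidiagonal. *)
pose v := sl 2 (u w(+ + - -) / sliceP u) (- u w(+ + + -) / sliceP u)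
             (- u w(+ + - +)) (u w(+ + + +)) u.
have vS : supported supD v by exact: slD.
have vM : sliceM v = sliceM u by rewrite -[RHS]mul1r -{1}D2 /v /sliceM /sl /=; ring.
have vPM : v w(+ - + +) = 0.
  transitivity ((u w(+ + - -) * u w(+ - + +) - u w(+ + + -) * u w(+ - - +)) / sliceP u).
    by rewrite /v /sl /=; ring.
  by rewrite uE subrr mul0r.
have vMM : v w(+ - - -) = 0.
  transitivity (u w(+ + + +) * u w(+ - - -) - u w(+ + - +) * u w(+ - + -)).
    by rewrite /v /sl /=; ring.
  by rewrite uF subrr.
exists v.
  apply: cj_step => //; apply: cj_step => //.
  exact: cj_trans xy yz.
apply/andP; split.
  apply/supportedP => -[[[[] []] []] []] //= _; try by move/supportedP: vS; apply.
  - by rewrite /v /sl /=; ring.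
  by rewrite /v /sl /=; ring.
have vL : v w(+ - - +) = offL u by rewrite /v /offL /sl /=; ring.
rewrite /= andbT; apply/and4P; split.
- rewrite (_ : v _ = 1) ?oner_neq0 // -D2 /v /sl /=; ring.
- by move: yP; congr (_ != 0); rewrite /v /sliceP /sl /=; ring.
- apply: contraNneq yM => v0; rewrite -vM /sliceM v0 vPM; apply/eqP; ring.
by rewrite vL.
Qed.

End ThreeQubits.

Fixpoint signs (k : nat) : seq (seq int) :=
  if k is k'.+1 then [seq 1 :: s | s <- signs k'] ++ [seq -1 :: s | s <- signs k']
  else [:: [::]].

Lemma mem_signs (s : seq int) : all (fun t => (t == 1) || (t == -1)) s -> s \in signs (size s).
Proof.
elim: s => //= t s IH /andP[t1 /IH h]; rewrite mem_cat; apply/orP.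
by case/orP: t1 => /eqP->; [left|right]; apply: map_f.
Qed.

Definition rtens (K : pzRingType) (l : seq (int * weight)) : weight -> K :=
  mtens [seq (t.1%:~R, t.2) | t <- l].

Definition nforms (T : nat) := [seq zip s (nfw T) | s <- signs (size (nfw T))].

Section Torus.
Variable R : realType.
Implicit Types x y : weight -> R.

Definition pairing (t : nat -> R) (w : weight) : R :=
  (if bt 0 w then t 0 else - t 0) + (if bt 1 w then t 1 else - t 1) +
  (if bt 2 w then t 2 else - t 2) + (if bt 3 w then t 3 else - t 3).

Definition diag2 (r : R) : mat2 R := (expR r, 0, 0, expR (- r)).

Lemma det_diag2 r : det2 (diag2 r) = 1.
Proof. by rewrite /det2 /= mulr0 subr0 expRxMexpNx_1. Qed.

Lemma acts_diag2 t x w :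
  acts slots (fun i => diag2 (t i)) x w = expR (pairing t w) * x w.
Proof.
rewrite /acts /= /slm /sl /= /pairing !expRD.
case: w => [[[[] []] []] []] /=; ring.
Qed.

(** The weights of the normal form are independent, so their pairings can be prescribed; the
    witnesses solve the linear systems. No denominator exceeds 4, which is why eighth roots of unity
    suffice over the complex numbers. *)
Lemma torus_weights T (f : weight -> R) : (T < 8)%N ->
  exists t, all (fun w => pairing t w == f w) (nfw T).
Proof.
have solve4 (a b c d : R) (ws : seq weight) :
    all (fun w => pairing (nth 0 [:: a; b; c; d]) w == f w) ws ->
    exists t, all (fun w => pairing t w == f w) ws by move=> h; eexists; exact: h.
pose g i := f (nth (true, true, true, true) (nfw T) i).
case: T @g => [|[|[|[|[|[|[|[|//]]]]]]]] g _.
- by apply: (solve4 (g 0%N) 0 0 0); rewrite /= /pairing /= /g /= !addr0 eqxx.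
- apply: (solve4 ((g 0%N + g 1%N) / 2) 0 ((g 0%N - g 1%N) / 2) 0).
  by rewrite /= /pairing /= /g /=; apply/and3P; split => //; apply/eqP; lra.
- pose S := g 0%N + g 1%N + g 2%N.
  apply: (solve4 0 ((S - g 0%N) / 2) ((S - g 1%N) / 2) ((S - g 2%N) / 2)).
  by rewrite /= /pairing /= /S /g /=; apply/and4P; split => //; apply/eqP; lra.
- apply: (solve4 ((g 0%N + g 1%N + g 2%N + g 3%N) / 4) ((g 0%N + g 1%N - g 2%N - g 3%N) / 4)
    ((g 0%N - g 1%N + g 2%N - g 3%N) / 4) ((g 0%N - g 1%N - g 2%N + g 3%N) / 4)).
  by rewrite /= /pairing /= /g /=; apply/and5P; split => //; apply/eqP; lra.
- pose S := (g 0%N + g 1%N + g 2%N + g 3%N) / 2.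
  apply: (solve4 ((S - g 0%N) / 2) ((S - g 1%N) / 2) ((S - g 2%N) / 2) ((S - g 3%N) / 2)).
  by rewrite /= /pairing /= /S /g /=; apply/and5P; split => //; apply/eqP; lra.
- apply: (solve4 ((g 0%N + g 2%N) / 2) ((g 0%N + g 1%N) / 2)
                 ((g 1%N + g 2%N) / 4) ((g 1%N + g 2%N) / 4)).
  by rewrite /= /pairing /= /g /=; apply/and4P; split => //; apply/eqP; lra.
- pose t3 := (g 2%N - g 3%N) / 2; pose A := (g 2%N + g 3%N) / 2.
  pose B := g 0%N - t3; pose C := g 1%N + t3.
  apply: (solve4 ((A + C) / 2) ((A + B) / 2) ((B + C) / 2) t3).
  by rewrite /= /pairing /= /B /C /A /t3 /g /=; apply/and5P; split => //;
    apply/eqP; lra.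
apply: (solve4 ((g 0%N + g 1%N + g 2%N + g 3%N) / 2) ((g 0%N + g 1%N) / 2)
               ((g 0%N + g 2%N) / 2) ((g 0%N + g 3%N) / 2)).
by rewrite /= /pairing /= /g /=; apply/and5P; split => //; apply/eqP; lra.
Qed.

Lemma nfw_uniq T : uniq (nfw T).
Proof. by case: T => [|[|[|[|[|[|[|[|T]]]]]]]] //; rewrite /nfw nth_default. Qed.

Lemma gen_nform T x : (T < 8)%N -> gen T x ->
  exists2 l, l \in nforms T & cj x (rtens R l).
Proof.
move=> T8 xg; have [y xy /andP[yS /allP y0]] : reduces_to T x.
  case: T T8 xg => [|[|[|[|[|[|[|[|//]]]]]]]] _;
  [exact: reduceA|exact: reduceB|exact: reduceC|exact: reduceD|exact: reduceE|
   exact: reduceF|exact: reduceG|exact: reduceH].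
have [t /allP ht] := torus_weights (fun w => - ln `|y w|) T8.
pose sy w : int := if 0 < y w then 1 else -1.
exists (zip [seq sy w | w <- nfw T] (nfw T)).
  apply: map_f; rewrite -(size_map sy); apply: mem_signs.
  by rewrite all_map; apply/allP => w _ /=; rewrite /sy; case: ifP.
apply: cj_trans xy _.
suff <- : acts slots (fun i => diag2 (t i)) y = rtens R (zip [seq sy w | w <- nfw T] (nfw T)).
  by apply: cj_acts => // i; exact: det_diag2.
have -> : rtens R (zip [seq sy w | w <- nfw T] (nfw T)) =
    mtens [seq ((sy w)%:~R, w) | w <- nfw T].
  by rewrite /rtens; congr mtens; elim: (nfw T) => //= w s ->.
set z := acts _ _ _.
have zE w : z w = expR (pairing t w) * y w by exact: acts_diag2.
rewrite (@supported_mtens _ (nfw T) z (nfw_uniq T)); last first.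
  by apply/supportedP => w wn; rewrite zE; move/supportedP: yS => ->; rewrite ?mulr0.
congr mtens; apply/eq_in_map => w wT; congr (_, _).
have yw0 := y0 w wT; rewrite zE (eqP (ht w wT)) expRN lnK ?posrE ?normr_gt0 // /sy.
by case: ltrgt0P yw0 => // h _; rewrite ?mulVf ?gt_eqF // invrN mulNr mulVf ?lt_eqF.
Qed.

End Torus.

Section IntegralTensors.
Variable K : numDomainType.
Implicit Types x : weight -> int.

(** Normal forms and representatives have integer coordinates: the finite checks are evaluated over
    [int] and carried to [K] by this embedding. *)
Definition intt x : weight -> K := fun w => (x w)%:~R.

Lemma evp_intt x p : evp (intt x) p = (evp x p)%:~R.
Proof.
rewrite /evp; elim: p => //= t p ->; rewrite rmorphD rmorphM /= intz; congr (_ * _ + _).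
by rewrite /evm; elim: t.2 => //= w m ->; rewrite rmorphM.
Qed.

Lemma gen_intt T x : gen T (intt x) = gen T x.
Proof.
congr (_ && _); first by apply: eq_all => w; rewrite /intt intr_eq0.
by apply: eq_all => p; rewrite evp_intt intr_eq0.
Qed.

Lemma rtens_intt l : rtens K l = intt (rtens int l).
Proof.
apply/funext => w; rewrite /rtens /intt; elim: l => //= t l ->.
by rewrite rmorphD /= intz; case: ifP.
Qed.

End IntegralTensors.

Lemma sgv_intt (K : realDomainType) T x : sgv T (intt K x) = map (intr : int -> K) (sgv T x).
Proof.
rewrite /sgv map_cat -!map_comp; congr (_ ++ _).
  by apply: eq_map => p /=; rewrite evp_intt intr_sg.
rewrite evp_intt ltrz0; case: ifP => //= _.
by rewrite !evp_intt !intr_sg.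
Qed.

Lemma nforms_gen T l : (T < 8)%N -> l \in nforms T -> gen T (rtens int l).
Proof.
have H : all (fun T => all (fun l => gen T (rtens int l)) (nforms T)) (iota 0 8).
  by vm_compute.
by move=> T8; apply: (allP (allP H T _)); rewrite mem_iota.
Qed.

(** The parity of the number of slots in which [J2] contributes its entry -1. *)
Definition flip_neg (e w : weight) : bool :=
  (bt 0 e && ~~ bt 0 w) (+) (bt 1 e && ~~ bt 1 w) (+)
    (bt 2 e && ~~ bt 2 w) (+) (bt 3 e && ~~ bt 3 w).

Lemma acts_J2E (K : comPzRingType) e (x : weight -> K) w :
  acts slots (fun i => J2 K (bt i e)) x w =
  if flip_neg e w then - x (xorw e w) else x (xorw e w).
Proof.
have slJ i b y v : slm i (J2 K b) y v =
    if b then (if bt i v then y (fl i v) else - y (fl i v)) else y v.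
  rewrite /slm /sl; case: b; case: (bt i v) => /=;
  by rewrite ?mul0r ?mul1r ?mulN1r ?addr0 ?add0r.
rewrite /acts /= !slJ; move: e w => [[[e0 e1] e2] e3] [[[[] []] []] []] /=;
by case: e0; case: e1; case: e2; case: e3; rewrite /= ?opprK.
Qed.

(** The extra sign [s] is the scalar -1, realised by minus the identity in slot 0. *)
Lemma cj_flip (K : comPzRingType) (s : bool) e (x y : weight -> K) :
  (forall w, y w = if s (+) flip_neg e w then - x (xorw e w) else x (xorw e w)) -> cj x y.
Proof.
move=> yE; pose x1 := acts slots (fun i => J2 K (bt i e)) x.
have xx1 : cj x x1.
  by apply: cj_acts => // i; rewrite /det2; case: (bt i e) => /=; ring.
case: s yE => yE; last first.
  by suff -> : y = x1 by []; apply/funext => w; rewrite yE /x1 acts_J2E.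
have -> : y = sl 0 (-1) 0 0 (-1) x1.
  apply/funext => w; rewrite yE /sl /x1 !acts_J2E; case: (flip_neg e w) => /=;
  by case: (bt 0 w); rewrite ?mul0r ?add0r ?addr0 mulN1r ?opprK.
by apply: cj_step => //; ring.
Qed.

Definition flip_equal (e : weight) (s : bool) (x y : weight -> int) :=
  all (fun w => y w == if s (+) flip_neg e w then - x (xorw e w) else x (xorw e w)) weights.

Lemma cj_flip_intt (K : numDomainType) e s x y : flip_equal e s x y ->
  cj (intt K x) (intt K y).
Proof.
move=> /forall_weightP h; apply: (@cj_flip _ s e) => w.
by rewrite /intt (eqP (h w)) (fun_if intr) rmorphN.
Qed.

Lemma nforms_cj (K : numDomainType) T l l' : (T < 8)%N -> l \in nforms T -> l' \in nforms T ->
  sgv T (rtens int l) = sgv T (rtens int l') -> cj (rtens K l) (rtens K l').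
Proof.
have H : all (fun T => let L := [seq (l, sgv T (rtens int l)) | l <- nforms T] in
    all (fun x => all (fun y => (x.2 == y.2) ==> has (fun e =>
      has (fun s => flip_equal e s (rtens int x.1) (rtens int y.1)) [:: true; false]) weights)
      L) L) (iota 0 8) by vm_compute.
move=> T8 lT l'T E; have Ti : T \in iota 0 8 by rewrite mem_iota.
have := allP (allP (allP H T Ti) _ (map_f _ lT)) _ (map_f _ l'T).
by rewrite E eqxx => /hasP[e _ /hasP[s _ /(cj_flip_intt K)]]; rewrite -!rtens_intt.
Qed.

Lemma gen_sgv_cj (R : realType) T (x y : weight -> R) : (T < 8)%N ->
  gen T x -> gen T y -> sgv T x = sgv T y -> cj x y.
Proof.
move=> T8 xg yg E; have [l lT xl] := gen_nform T8 xg; have [l' l'T yl] := gen_nform T8 yg.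
have ng k : k \in nforms T -> gen T (rtens R k).
  by move=> kT; rewrite rtens_intt gen_intt; exact: nforms_gen.
apply: (cj_trans xl); apply: cj_trans (cj_sym yl).
apply: (@nforms_cj _ T) => //.
apply: (inj_map (@intr_inj R)); rewrite -!sgv_intt -!rtens_intt.
by rewrite (gen_cj_sgv T8 xl xg (ng _ lT)) (gen_cj_sgv T8 yl yg (ng _ l'T)).
Qed.

(** * The representatives *)

(** Representatives as data on which the checks can run; [pm_spm] and [five_sfive] identify them
    with the tensors of the statement. *)
Definition srep := seq (int * weight).

Fixpoint spm (x : srep) (ts : seq weight) : seq srep :=
  if ts is t :: ts' then spm (rcons x (1, t)) ts' ++ spm (rcons x (-1, t)) ts' else [:: x].

Definition sfive (a b c d : weight) : seq srep :=
  [:: [:: (1, a); (1, b); (1, c); (1, d)]; [:: (-1, a); (1, b); (1, c); (1, d)];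
      [:: (1, a); (-1, b); (1, c); (1, d)]; [:: (1, a); (1, b); (-1, c); (1, d)];
      [:: (1, a); (1, b); (1, c); (-1, d)]].

Definition sfam (k : nat) : seq srep := nth [::] [::
  spm [:: (1, w(+ + - -))] [::];
  spm [:: (1, w(+ + - -))] [:: w(- - - -)];
  spm [:: (1, w(+ + - -))] [:: w(+ - - +)];
  spm [:: (1, w(+ + - -))] [:: w(+ - + -)];
  spm [:: (1, w(+ + - +))] [:: w(- + - -)];
  spm [:: (1, w(+ + + -))] [:: w(- + - -)];
  spm [:: (1, w(+ + + -))] [:: w(+ + - +)];
  spm [:: (1, w(+ + - +))] [:: w(- + - -); w(+ - - -)];
  spm [:: (1, w(+ + + -))] [:: w(- + - -); w(+ - - -)];
  spm [:: (1, w(+ + + -))] [:: w(+ + - +); w(+ - - -)];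
  spm [:: (1, w(+ + + -))] [:: w(+ + - +); w(- + - -)];
  sfive w(- + - +) w(+ + - -) w(+ - - +) w(- - - -);
  sfive w(- + + -) w(+ + - -) w(+ - + -) w(- - - -);
  sfive w(+ + + +) w(+ + - -) w(+ - - +) w(+ - + -);
  sfive w(- + + +) w(+ + + -) w(+ + - +) w(- + - -);
  spm [:: (1, w(+ + + -))] [:: w(+ + - +); w(- + - -); w(+ - - -)];
  spm [:: (1, w(+ + + -))] [:: w(+ + - +); w(- - - -)];
  spm [:: (1, w(+ + + -))] [:: w(- + - -); w(+ - - +)];
  spm [:: (1, w(+ + - +))] [:: w(- + - -); w(+ - + -)];
  spm [:: (1, w(- + - +))] [:: w(+ + + -); w(+ - - -)];
  spm [:: (1, w(- + + -))] [:: w(+ + - +); w(+ - - -)];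
  spm [:: (1, w(+ + + +))] [:: w(- + - -); w(+ - - -)];
  spm [:: (1, w(+ + + -))] [:: w(- + - -); w(- - - -); w(+ - - +)];
  spm [:: (1, w(- + + -))] [:: w(+ + - +); w(+ - - -); w(- - - -)];
  spm [:: (1, w(+ + + +))] [:: w(- + - -); w(+ - - -); w(+ - - +)];
  spm [:: (1, w(+ + + +))] [:: w(- + - -); w(+ - - -); w(+ - + -)];
  spm [:: (1, w(- + - +))] [:: w(+ + + -); w(- - - -); w(+ - - +)];
  spm [:: (1, w(- + + -))] [:: w(+ + - +); w(- - - -); w(+ - + -)];
  spm [:: (1, w(+ + + +))] [:: w(- + - -); w(+ - - +); w(+ - + -)];
  spm [:: (1, w(+ + + +))] [:: w(- + + -); w(- + - +); w(+ - - -)]] k.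

(* Family [k] is, after flipping the slots marked [+] in the last component and permuting
   the slots by the second one, of the standard type given by the first component. *)
Definition keys : seq (nat * seq nat * weight) := [::
  (0, [:: 0; 1; 2; 3], w(- - + +)); (1, [:: 2; 3; 0; 1], w(+ + + +));
  (1, [:: 0; 2; 1; 3], w(- + + +)); (1, [:: 0; 2; 3; 1], w(- + + +));
  (1, [:: 2; 0; 1; 3], w(+ - + +)); (1, [:: 2; 0; 3; 1], w(+ - + +));
  (1, [:: 0; 1; 2; 3], w(- - + +)); (2, [:: 1; 2; 0; 3], w(- - + +));
  (2, [:: 1; 2; 3; 0], w(- - + +)); (2, [:: 0; 1; 2; 3], w(- - + +));
  (2, [:: 1; 0; 2; 3], w(- - + +)); (3, [:: 1; 2; 0; 3], w(+ + + +));
  (3, [:: 1; 2; 3; 0], w(+ + + +)); (3, [:: 0; 1; 2; 3], w(- + + +));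
  (3, [:: 1; 0; 2; 3], w(+ - + +)); (4, [:: 0; 1; 2; 3], w(- - + +));
  (5, [:: 2; 3; 0; 1], w(- - + +)); (5, [:: 0; 2; 1; 3], w(- - + +));
  (5, [:: 0; 2; 3; 1], w(- - + +)); (5, [:: 2; 0; 1; 3], w(- - + +));
  (5, [:: 2; 0; 3; 1], w(- - + +)); (5, [:: 0; 1; 2; 3], w(- - + +));
  (6, [:: 0; 3; 1; 2], w(- + + +)); (6, [:: 3; 0; 1; 2], w(+ - + +));
  (6, [:: 0; 1; 2; 3], w(- - + +)); (6, [:: 0; 1; 3; 2], w(- - + +));
  (7, [:: 1; 2; 0; 3], w(- - + +)); (7, [:: 1; 2; 3; 0], w(- - + +));
  (7, [:: 0; 1; 2; 3], w(- - + +)); (7, [:: 1; 0; 2; 3], w(- - + +))]%N.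

Definition key_type k := (nth (0, [::], w(- - - -)) keys k).1.1.
Definition key_perm k := (nth (0, [::], w(- - - -)) keys k).1.2.
Definition key_flip k := (nth (0, [::], w(- - - -)) keys k).2.

Definition flipt (K : zmodType) (e : weight) (x : weight -> K) (w : weight) :=
  if flip_neg e w then - x (xorw e w) else x (xorw e w).

Lemma cj_flipt (K : comPzRingType) e (x : weight -> K) : cj x (flipt e x).
Proof. exact: (@cj_flip _ false e). Qed.

Definition srep_std k (r : srep) : weight -> int :=
  flipt (key_flip k) (rtens int r) \o pw (key_perm k).

Lemma key_typeP k : (k < 30)%N -> (key_type k < 8)%N /\ key_perm k \in S4.
Proof.
have H : all (fun k => (key_type k < 8)%N && (key_perm k \in S4)) (iota 0 30) by vm_compute.
by move=> k30; apply/andP; apply: (allP H); rewrite mem_iota.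
Qed.

Lemma srep_std_gen k r : (k < 30)%N -> r \in sfam k -> gen (key_type k) (srep_std k r).
Proof.
have H : all (fun k => all (fun r => gen (key_type k) (srep_std k r)) (sfam k)) (iota 0 30).
  by vm_compute.
by move=> k30; apply: (allP (allP H k _)); rewrite mem_iota.
Qed.

Lemma uniq_map_inj (T1 T2 : eqType) (f : T1 -> T2) s :
  uniq (map f s) -> {in s &, injective f}.
Proof.
elim: s => //= a s IH /andP[fa /IH h] x y; rewrite !inE.
move=> /orP[/eqP xa|xs] /orP[/eqP ya|ys] E; last exact: h.
- by rewrite xa ya.
- by move: fa; rewrite -xa E (map_f f ys).
- by move: fa; rewrite -ya -E (map_f f xs).
Qed.

Lemma srep_std_inj k r r' : (k < 30)%N -> r \in sfam k -> r' \in sfam k ->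
  sgv (key_type k) (srep_std k r) = sgv (key_type k) (srep_std k r') -> r = r'.
Proof.
have H : all (fun k =>
    uniq [seq sgv (key_type k) (srep_std k r) | r <- sfam k]) (iota 0 30) by vm_compute.
move=> k30; have ki : k \in iota 0 30 by rewrite mem_iota.
move=> rk r'k E; exact: (uniq_map_inj (allP H k ki) rk r'k E).
Qed.

(** The permutations chosen for the families of one type lie in distinct cosets of the stabiliser of
    [lam]. *)
Lemma keys_inj k l : (k < 30)%N -> (l < 30)%N -> key_type k = key_type l ->
  all (fun i => nth 0 (lam (key_type k)) (nth 0 (permq (key_perm k) (key_perm l)) i) ==
                nth 0 (lam (key_type k)) i)%N slots -> k = l.
Proof.
have H : all (fun k => all (fun l => (key_type k == key_type l) &&
   all (fun i => nth 0 (lam (key_type k)) (nth 0 (permq (key_perm k) (key_perm l)) i) ==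
                nth 0 (lam (key_type k)) i)%N slots ==> (k == l)) (iota 0 30)) (iota 0 30).
  by vm_compute.
move=> k30 l30 E h; have ki : k \in iota 0 30 by rewrite mem_iota.
have li : l \in iota 0 30 by rewrite mem_iota.
have /implyP hh := allP (allP H k ki) l li.
by apply/eqP/hh/andP; split; [exact/eqP|exact: h].
Qed.

(* Written with [if] instead of [&&] because the virtual machine evaluates both
   arguments of [andb]. *)
Definition covered T p (N : seq (seq int)) k :=
  if key_type k == T then
    if all (fun i => nth 0 (lam T) (nth 0 (permq p (key_perm k)) i) == nth 0 (lam T) i)%N slots
    then let X := [seq flipt (key_flip k) (rtens int r) \o pw p | r <- sfam k] in
      let S := map (sgv T) X in all (gen T) X && all (fun n => n \in S) N
    else false
  else false.

(** Conversely, every coset of the stabiliser of [lam] is met by a family, and that family realises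
    every sign vector of a normal form. *)
Lemma coveredT T p l : (T < 8)%N -> p \in S4 -> l \in nforms T ->
  exists k r, [/\ (k < 30)%N, r \in sfam k, gen T (flipt (key_flip k) (rtens int r) \o pw p) &
    sgv T (flipt (key_flip k) (rtens int r) \o pw p) = sgv T (rtens int l)].
Proof.
have H : all (fun T => let N := [seq sgv T (rtens int l) | l <- nforms T] in
    all (fun p => has (covered T p N) (iota 0 30)) S4) (iota 0 8).
  by vm_compute.
move=> T8 pS lT; have Ti : T \in iota 0 8 by rewrite mem_iota.
have /hasP[k ki] := allP (allP H T Ti) p pS.
have k30 : (k < 30)%N by move: ki; rewrite mem_iota => /andP[].
rewrite /covered; case: (key_type k == T); last by [].
case: (all _ slots); last by [].
case/andP=> /allP g /allP h.
have /mapP[x /mapP[r rk xE] E] := h _ (map_f (fun l => sgv T (rtens int l)) lT).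
exists k, r; split; [exact: k30|exact: rk| |by rewrite E xE].
by rewrite -xE; apply: g; rewrite xE;
  apply: (map_f (fun r => flipt (key_flip k) (rtens int r) \o pw p) rk).
Qed.

Lemma cj_rtens_std (K : numDomainType) k r p : p \in S4 ->
  cj (rtens K r \o pw p) (intt K (flipt (key_flip k) (rtens int r) \o pw p)).
Proof.
move=> pS; have -> : intt K (flipt (key_flip k) (rtens int r) \o pw p) =
    flipt (key_flip k) (rtens K r) \o pw p.
  apply/funext => w; rewrite /intt /= /flipt rtens_intt.
  by case: ifP => _; rewrite ?rmorphN.
exact/cj_pw/cj_flipt.
Qed.

Lemma rep_complete (R : realType) T p (x : weight -> R) : (T < 8)%N -> p \in S4 ->
  gen T (x \o pw p) -> exists k r, [/\ (k < 30)%N, r \in sfam k & cj x (rtens R r)].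
Proof.
move=> T8 pS xg; have [l lT xl] := gen_nform T8 xg.
have [k [r [k30 rk rg rs]]] := coveredT T8 pS lT.
exists k, r; split => //; apply: (cj_pwI pS).
apply: cj_trans (cj_sym (cj_rtens_std R k r pS)).
have yg : gen T (intt R (flipt (key_flip k) (rtens int r) \o pw p)).
  by rewrite gen_intt.
apply: (gen_sgv_cj T8 xg yg).
rewrite sgv_intt rs -sgv_intt -rtens_intt; apply/esym.
have lg : gen T (rtens R l) by rewrite rtens_intt gen_intt; exact: nforms_gen.
exact: (gen_cj_sgv T8 xl xg lg).
Qed.

Lemma rep_family (K : numFieldType) k l r r' : (k < 30)%N -> (l < 30)%N ->
  r \in sfam k -> r' \in sfam l -> cj (rtens K r) (rtens K r') -> k = l.
Proof.
move=> k30 l30 rk r'l rr'.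
have [Tk pk] := key_typeP k30; have [Tl pl] := key_typeP l30.
have [dS dE] := permqP pk pl.
have c1 := cj_rtens_std K k r pk; have c2 := cj_rtens_std K l r' pk.
have := cj_trans (cj_sym c1) (cj_trans (cj_pw pk rr') c2).
move/(gen_cj_lam Tk Tl dS); rewrite gen_intt => /(_ (srep_std_gen k30 rk)).
have -> : intt K (flipt (key_flip l) (rtens int r') \o pw (key_perm k)) \o
    pw (permq (key_perm k) (key_perm l)) = intt K (srep_std l r').
  by rewrite /srep_std -dE.
by rewrite gen_intt => /(_ (srep_std_gen l30 r'l))[]; exact: keys_inj.
Qed.

Lemma rep_inj (R : realFieldType) k r r' : (k < 30)%N ->
  r \in sfam k -> r' \in sfam k -> cj (rtens R r) (rtens R r') -> r = r'.
Proof.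
move=> k30 rk r'k rr'; have [Tk pk] := key_typeP k30.
have c1 := cj_rtens_std R k r pk; have c2 := cj_rtens_std R k r' pk.
have c := cj_trans (cj_sym c1) (cj_trans (cj_pw pk rr') c2).
apply: (srep_std_inj k30 rk r'k); apply: (inj_map (@intr_inj R)).
rewrite -!sgv_intt; apply/esym; apply: (gen_cj_sgv Tk c); rewrite gen_intt;
exact: srep_std_gen.
Qed.

(** * Complex conjugacy *)

(** The exponent of [zeta8] by which the diagonal matrices with exponents [n] act at [w]; the
    inverse of [zeta8 ^+ i] is written [zeta8 ^+ (8 - i)] to stay among natural numbers. *)
Definition shift8 (n : nat * nat * nat * nat) (w : weight) : nat :=
  ((if bt 0 w then n.1.1.1 else 8 - n.1.1.1) + (if bt 1 w then n.1.1.2 else 8 - n.1.1.2) +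
   (if bt 2 w then n.1.2 else 8 - n.1.2) + (if bt 3 w then n.2 else 8 - n.2))%N.

Definition octants : seq (nat * nat * nat * nat) :=
  [seq (p.1, p.2, q.1, q.2) | p <- [seq (i, j) | i <- iota 0 8, j <- iota 0 8],
                              q <- [seq (i, j) | i <- iota 0 8, j <- iota 0 8]].

Definition shifts_to n (t : (int * weight) * (int * weight)) : bool :=
  if t.1.2 == t.2.2 then
    if t.2.1 == t.1.1 then (shift8 n t.1.2 %% 8 == 0)%N else
    if t.2.1 == - t.1.1 then (shift8 n t.1.2 %% 8 == 4)%N else false
  else false.

(** Stops at the first success even in the virtual machine, which matters for the 4096 elements of
    [octants]. *)
Fixpoint search T (a : T -> bool) s : bool :=
  if s is x :: s' then if a x then true else search a s' else false.

Lemma searchP (T : eqType) (a : T -> bool) s : search a s -> exists2 x, x \in s & a x.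
Proof.
elim: s => //= x s IH; case: ifP => [ax _|_ /IH[y ys ay]]; first by exists x; rewrite ?mem_head.
by exists y; rewrite // inE ys orbT.
Qed.

Definition shifts_all r r' n := (size r == size r') && all (shifts_to n) (zip r r').

Lemma sfam_shift k r : (k < 30)%N -> r \in sfam k ->
  exists2 n, n \in octants & shifts_all (head [::] (sfam k)) r n.
Proof.
have H : all (fun k => all (fun r => search (shifts_all (head [::] (sfam k)) r) octants)
   (sfam k)) (iota 0 30) by vm_compute.
move=> k30 rk; apply: searchP; have ki : k \in iota 0 30 by rewrite mem_iota.
exact: (allP (allP H k ki) r rk).
Qed.

Section Octants.
Variable K : numClosedFieldType.

Definition zeta8 : K := 4.-root (-1).

Lemma zeta8_4 : zeta8 ^+ 4 = -1. Proof. exact: rootCK. Qed.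

Lemma zeta8_8 : zeta8 ^+ 8 = 1.
Proof. by rewrite (_ : 8 = 4 * 2)%N // exprM zeta8_4 sqrrN expr1n. Qed.

Definition diag8 (n : nat) : mat2 K := (zeta8 ^+ n, 0, 0, zeta8 ^+ (8 - n)).

Lemma det_diag8 n : (n <= 8)%N -> det2 (diag8 n) = 1.
Proof.
by move=> n8; rewrite /det2 /= mulr0 subr0 -exprD subnKC // zeta8_8.
Qed.

Definition octn (n : nat * nat * nat * nat) (i : nat) : nat :=
  nth 0%N [:: n.1.1.1; n.1.1.2; n.1.2; n.2] i.

Lemma acts_diag8 n (x : weight -> K) w :
  acts slots (fun i => diag8 (octn n i)) x w = zeta8 ^+ (shift8 n w) * x w.
Proof.
rewrite /acts /= /slm /sl /= /shift8 !exprD.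
case: w => [[[[] []] []] []] /=; ring.
Qed.

Lemma zeta8_mod m : zeta8 ^+ m = zeta8 ^+ (m %% 8).
Proof.
by rewrite {1}(divn_eq m 8) exprD mulnC exprM zeta8_8 expr1n mul1r.
Qed.

Lemma shifts_cj n r r' : all (leq^~ 8)%N [:: n.1.1.1; n.1.1.2; n.1.2; n.2] ->
  shifts_all r r' n -> cj (rtens K r) (rtens K r').
Proof.
move=> n8 /andP[/eqP szr h].
suff <- : acts slots (fun i => diag8 (octn n i)) (rtens K r) = rtens K r'.
  apply: cj_trans (cj_refl _); rewrite /acts /=; move: n8 => /= /and5P[n0 n1 n2 n3 _].
  by do 4![apply: cj_step; [by []|exact: det_diag8|]]; apply: cj_refl.
apply/funext => w; rewrite acts_diag8; elim: r r' szr h => [|[c v] r IH] [|[c' v'] r'] //=.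
  by rewrite mulr0.
move=> [] szr /andP[hv /(IH r' szr)]; rewrite /rtens /= mulrDr => ->; congr (_ + _).
move: hv; rewrite /shifts_to /=; case: eqP => // <-.
case: eqP => [->|_]; [|case: eqP => [->|//]] => /eqP s0; case: eqP => [->|_];
  rewrite ?mulr0 // zeta8_mod s0.
  by rewrite mul1r.
by rewrite zeta8_4 mulN1r rmorphN.
Qed.

Lemma rep_complex k r r' : (k < 30)%N -> r \in sfam k -> r' \in sfam k ->
  cj (rtens K r) (rtens K r').
Proof.
have O n : n \in octants -> all (leq^~ 8)%N [:: n.1.1.1; n.1.1.2; n.1.2; n.2].
  have H : all (fun n => all (leq^~ 8)%N [:: n.1.1.1; n.1.1.2; n.1.2; n.2]) octants.
    by vm_compute.
  exact: (allP H).
move=> k30 rk r'k; have [n /O n8 nr] := sfam_shift k30 rk.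
have [n' /O n'8 n'r'] := sfam_shift k30 r'k.
exact: cj_trans (cj_sym (shifts_cj n8 nr)) (shifts_cj n'8 n'r').
Qed.

End Octants.

(** * Descent through the half spaces *)

Lemma S4_inv p : p \in S4 -> exists2 r, r \in S4 & pw r \o pw p = id.
Proof.
have H : all (fun p => (invp p \in S4) &&
    all (fun w => pw (invp p) (pw p w) == w) weights) S4 by vm_compute.
move=> pS; have /andP[rS /forall_weightP h] := allP H p pS.
by exists (invp p); [exact: rS|apply/funext => w; apply/eqP; exact: h].
Qed.

Definition nonzero (K : nmodType) (x : weight -> K) := exists w, x w != 0.

Section Stratification.
Variable K : realFieldType.
Implicit Types x y : weight -> K.

Definition good x := exists T p y, [/\ (T < 8)%N, p \in S4, cj x y & gen T (y \o pw p)].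

Lemma good_cj x y : cj x y -> good y -> good x.
Proof.
move=> xy [T [p [z [T8 pS yz zg]]]]; exists T, p, z; split => //.
exact: cj_trans xy yz.
Qed.

Lemma good_pw p x : p \in S4 -> good (x \o pw p) -> good x.
Proof.
move=> pS [T [q [y [T8 qS xy yg]]]]; have [r rS rp] := S4_inv pS.
have [sS sE] := permqP rS qS.
exists T, (permq r q), (y \o pw r); split => //; last by rewrite -compA sE.
have yE : (y \o pw r) \o pw p = y by rewrite -compA rp.
by apply: (cj_pwI pS); rewrite yE.
Qed.

Lemma nonzero_cj x y : cj x y -> nonzero x -> nonzero y.
Proof.
move/cj_sym=> yx [w]; case: (pselect (nonzero y)) => // ny.
have y0 v : y v = 0 by apply/eqP/negPn/negP => yv; apply: ny; exists v.
suff -> : x w = 0 by rewrite eqxx.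
elim: yx w => // {}x i a b c d _ _ _ IH w.
by rewrite /sl !IH !mulr0 addr0 if_same.
Qed.

Lemma nonzero_pw p x : p \in S4 -> nonzero x -> nonzero (x \o pw p).
Proof.
move=> pS [w xw]; exists (pw (invp p) w); by rewrite /= pw_invp.
Qed.

Lemma good_gen T x : (T < 8)%N -> gen T x -> good x.
Proof.
move=> T8 xg; exists T, [:: 0; 1; 2; 3]%N, x; split => //; first exact: cj_refl.
by rewrite pw_id.
Qed.

Definition stratum_good T := forall x, supported (hsup T) x -> nonzero x -> good x.

Lemma stratum_pw T p x : stratum_good T -> p \in S4 -> nonzero x ->
  supported (hsup T) (x \o pw p) -> good x.
Proof.
by move=> TG pS x0 xS; apply: (good_pw pS); apply: TG => //; exact: nonzero_pw.
Qed.

Lemma kill i u x : (i < 4)%N -> bt i u -> exists g y,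
  [/\ det2 g = 1, y = slm i g x, y (fl i u) = 0 & x u != 0 \/ x (fl i u) != 0 -> y u != 0].
Proof.
move=> i4 iu; have ifu : bt i (fl i u) = false by rewrite bt_fl // iu.
have [p0|p0] := eqVneq (x u) 0.
  exists (0, 1, -1, 0), (slm i (0, 1, -1, 0) x); rewrite /slm /sl iu ifu fl_inv /= p0.
  split; [by rewrite /det2 /=; ring|by []|by rewrite mulr0 mul0r addr0|].
  by rewrite mulr0 add0r mul1r => -[/eqP|].
exists (1, 0, - x (fl i u) / x u, 1), (slm i (1, 0, - x (fl i u) / x u, 1) x).
rewrite /slm /sl iu ifu fl_inv /=.
by split; [rewrite /det2 /=; ring|by []|field|rewrite mul0r addr0 mul1r].
Qed.

(** The two pairs of coordinates along slot [i] are proportional, so a matrix that kills the second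
    entry of a nonzero one kills that of the other. *)
Lemma kill_pair i u v x : (i < 4)%N -> bt i u -> bt i v ->
  x u * x (fl i v) = x v * x (fl i u) ->
  exists g y, [/\ det2 g = 1, y = slm i g x, y (fl i u) = 0 & y (fl i v) = 0].
Proof.
move=> i4 iu iv uv; case: (pselect (x u != 0 \/ x (fl i u) != 0)) => [nz|z]; last first.
  have [z1 z2] : x u = 0 /\ x (fl i u) = 0.
    by split; apply/eqP/negPn/negP => h; apply: z; [left|right].
  have [g [y [Dg yE y1 y2]]] := @kill i v x i4 iv.
  exists g, y; split => //; rewrite yE /slm /sl bt_fl // iu /= fl_inv z1 z2.
  by rewrite !mulr0 addr0.
have [g [y [Dg yE y1 y2]]] := @kill i u x i4 iu.
exists g, y; split => //; apply: (mulfI (y2 nz)); rewrite mulr0.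
transitivity (y u * y (fl i v) - y v * y (fl i u)); first by rewrite y1 mulr0 subr0.
transitivity (det2 g * (x u * x (fl i v) - x v * x (fl i u))).
  by rewrite yE /slm /sl !bt_fl // iu iv /= !fl_inv /det2; ring.
by rewrite uv subrr mulr0.
Qed.

Lemma cj_slm i g x : (i < 4)%N -> det2 g = 1 -> cj x (slm i g x).
Proof. by move=> i4 D; exact: cj_sl. Qed.

Ltac support_pw xS :=
  apply/supportedP => -[[[[] []] []] []] //= _; first
  [by []|by move/supportedP: xS; apply].

Lemma stratumA : stratum_good 0.
Proof.
move=> x xS x0; apply: (@good_gen 0) => //; rewrite /gen xS /= andbT.
rewrite (evp_mono2 _ w(+ + + +) w(+ + + +)) mulf_eq0 orbb.
by case: x0 => w; apply: contraNneq => p0; apply/eqP; case: w => [[[[] []] []] []] //;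
  move/supportedP: xS; apply.
Qed.

(** If the determinant vanishes, the slice has rank at most one and can be concentrated in a single
    entry. *)
Lemma stratumB : stratum_good 1.
Proof.
move=> x xS x0; have [D0|D0] := eqVneq (evp x polyB) 0; last first.
  by apply: (@good_gen 1) => //; rewrite /gen xS /= D0.
have supp i g y : (1 < i < 4)%N -> det2 g = 1 -> supported (hsup 1) y ->
    supported (hsup 1) (slm i g y).
  move=> i4 D; apply: supported_parabolic => //; first by case/andP: i4.
  by right; case: i i4 => [|[|[|[|]]]].
have [|g [y [Dg yE y1 y2]]] := @kill_pair 2 w(+ + + +) w(+ + + -) x isT isT isT.
  by apply/eqP; rewrite -subr_eq0 -evp_polyB D0.
rewrite /= in y1 y2.
have [h [z [Dh zE z1 _]]] := @kill 3 w(+ + + +) y isT isT.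
have xz : cj x z.
  by rewrite zE yE; apply: cj_trans (cj_slm _ _ Dh) => //; exact: cj_slm.
apply: (good_cj xz); apply: stratumA; last exact: nonzero_cj xz x0.
have yS : supported (hsup 1) y by rewrite yE; exact: supp.
have zS : supported (hsup 1) z by rewrite zE; exact: supp.
apply/supportedP => -[[[[] []] []] []] //= _; try by move/supportedP: zS; apply.
- by rewrite zE /slm /sl /= y1 y2 !mulr0 addr0.
by rewrite zE /slm /sl /= y1 y2 !mulr0 addr0.
Qed.

Lemma stratumC : stratum_good 2.
Proof.
move=> x xS x0.
have [b2|b2] := eqVneq (x w(+ - + +)) 0.
  by apply: (stratum_pw stratumB (_ : [:: 0; 1; 2; 3]%N \in S4)) => //; support_pw xS.
have [b3|b3] := eqVneq (x w(+ + - +)) 0.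
  by apply: (stratum_pw stratumB (_ : [:: 0; 2; 1; 3]%N \in S4)) => //; support_pw xS.
have [b4|b4] := eqVneq (x w(+ + + -)) 0.
  by apply: (stratum_pw stratumB (_ : [:: 0; 2; 3; 1]%N \in S4)) => //; support_pw xS.
by apply: (@good_gen 2) => //; rewrite /gen xS /= !evp_mono2 !mulf_neq0.
Qed.

Lemma stratumE : stratum_good 4.
Proof.
move=> x xS x0.
have [b1|b1] := eqVneq (x w(- + + +)) 0.
  by apply: (stratum_pw stratumC (_ : [:: 0; 1; 2; 3]%N \in S4)) => //; support_pw xS.
have [b2|b2] := eqVneq (x w(+ - + +)) 0.
  by apply: (stratum_pw stratumC (_ : [:: 1; 0; 2; 3]%N \in S4)) => //; support_pw xS.
have [b3|b3] := eqVneq (x w(+ + - +)) 0.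
  by apply: (stratum_pw stratumC (_ : [:: 1; 2; 0; 3]%N \in S4)) => //; support_pw xS.
have [b4|b4] := eqVneq (x w(+ + + -)) 0.
  by apply: (stratum_pw stratumC (_ : [:: 1; 2; 3; 0]%N \in S4)) => //; support_pw xS.
by apply: (@good_gen 4) => //; rewrite /gen xS /= !evp_mono2 !mulf_neq0.
Qed.

Lemma det_sl2 g x : det2 g = 1 ->
  sliceX (slm 2 g x) = sliceX x /\ sliceM (slm 2 g x) = sliceM x.
Proof.
case: g => [[[a b] c] d]; rewrite /det2 /= => D.
by split; rewrite -[RHS]mul1r -D /sliceX /sliceM /slm /sl /=; ring.
Qed.

(** If the hyperdeterminant vanishes, the form of the pencil is zero or has a double root, and the
    second slice can be made singular with [sliceX] still zero. Concentrated in the entry [+ - + +],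
    it then satisfies [x w(+ - + +) * x w(+ + - -) = 0]; the two factors lead to types 1 and 2. *)
Lemma stratumD : stratum_good 3.
Proof.
move=> x xS x0; have [D0|D0] := eqVneq (evp x polyD) 0; last first.
  by apply: (@good_gen 3) => //; rewrite /gen xS /= D0.
have [y [xy yS yX yM]] : exists y, [/\ cj x y, supported (hsup 3) y, sliceX y = 0 & sliceM y = 0].
  have [|] := boolP [|| sliceP x != 0, sliceX x != 0 | sliceM x != 0].
    move=> h; have [y [xy yS yD yP yX]] := diagonalise_slices xS h.
    exists y; split => //; apply: (mulfI yP); rewrite mulr0; apply/eqP.
    move: yD; rewrite D0 evp_polyD yX expr0n sub0r => /eqP.
    by rewrite oppr_eq0 -mulrA mulf_eq0 pnatr_eq0.
  rewrite !negb_or !negbK => /and3P[_ /eqP X0 /eqP M0].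
  by exists x; split => //; exact: cj_refl.
have [|g [z [Dg zE z1 z2]]] := @kill_pair 2 w(+ - + +) w(+ - + -) y isT isT isT.
  by apply/eqP; rewrite -subr_eq0 -[X in _ == X]yM; apply/eqP; rewrite /sliceM /=; ring.
have [h [v [Dh vE v1 _]]] := @kill 3 w(+ - + +) z isT isT.
rewrite /= in z1 z2 v1.
have supp i k u : (1 < i < 4)%N -> det2 k = 1 -> supported (hsup 3) u ->
    supported (hsup 3) (slm i k u).
  move=> i4 D; apply: supported_parabolic => //; first by case/andP: i4.
  by right; case: i i4 => [|[|[|[|]]]].
have zS : supported (hsup 3) z by rewrite zE; exact: supp.
have vS : supported (hsup 3) v by rewrite vE; exact: supp.
have xv : cj x v.
  apply: (cj_trans xy); rewrite vE zE; apply: cj_trans (cj_slm _ _ Dh) => //.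
  exact: cj_slm.
apply: (good_cj xv); have v0 := nonzero_cj xv x0.
have v2 : v w(+ - - -) = 0 by rewrite vE /slm /sl /= z1 z2 !mulr0 addr0.
have v3 : v w(+ - - +) = 0 by rewrite vE /slm /sl /= z1 z2 !mulr0 addr0.
have : v w(+ - + +) * v w(+ + - -) = 0.
  have [zX _] := det_sl2 y Dg; rewrite -zE yX in zX.
  case: h Dh vE => [[[a b] c] d] Dh vE.
  have [_ vX _] := det_sl3 z Dh; rewrite -[RHS]zX -vX -[sl _ _ _ _ _ _]vE /sliceX.
  by rewrite v1 v2 v3; ring.
move/eqP; rewrite mulf_eq0 => /orP[]/eqP v4.
  by apply: (stratum_pw stratumB (_ : [:: 0; 1; 2; 3]%N \in S4)) => //; support_pw vS.
by apply: (stratum_pw stratumC (_ : [:: 0; 1; 2; 3]%N \in S4)) => //; support_pw vS.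
Qed.

Lemma stratumF : stratum_good 5.
Proof.
move=> x xS x0.
have [b1|b1] := eqVneq (x w(+ + - -)) 0.
  by apply: (stratum_pw stratumE (_ : [:: 0; 1; 2; 3]%N \in S4)) => //; support_pw xS.
have [b2|b2] := eqVneq (x w(- + + +)) 0.
  by apply: (stratum_pw stratumD (_ : [:: 0; 1; 2; 3]%N \in S4)) => //; support_pw xS.
have [b3|b3] := eqVneq (x w(+ - + +)) 0.
  by apply: (stratum_pw stratumD (_ : [:: 1; 0; 2; 3]%N \in S4)) => //; support_pw xS.
by apply: (@good_gen 5) => //; rewrite /gen xS /= !evp_mono2 !mulf_neq0.
Qed.

Lemma stratumG : stratum_good 6.
Proof.
move=> x xS x0.
have supp k u : det2 k = 1 -> supported (hsup 6) u -> supported (hsup 6) (slm 3 k u).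
  by move=> D; apply: supported_parabolic => //; right.
have [d12|d12] := eqVneq (x w(- + + +) * x w(+ - + -)) (x w(+ - + +) * x w(- + + -)).
  have [g [y [Dg yE /= y1 y2]]] := @kill_pair 3 w(- + + +) w(+ - + +) x isT isT isT d12.
  have xy : cj x y by rewrite yE; exact: cj_slm.
  apply: (good_cj xy); have yS : supported (hsup 6) y by rewrite yE; exact: supp.
  apply: (stratum_pw stratumF (_ : [:: 0; 1; 2; 3]%N \in S4)) => //;
    [exact: nonzero_cj xy x0|support_pw yS].
have [d13|d13] := eqVneq (x w(- + + +) * x w(+ + - -)) (x w(+ + - +) * x w(- + + -)).
  have [g [y [Dg yE /= y1 y2]]] := @kill_pair 3 w(- + + +) w(+ + - +) x isT isT isT d13.
  have xy : cj x y by rewrite yE; exact: cj_slm.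
  apply: (good_cj xy); have yS : supported (hsup 6) y by rewrite yE; exact: supp.
  apply: (stratum_pw stratumF (_ : [:: 0; 2; 1; 3]%N \in S4)) => //;
    [exact: nonzero_cj xy x0|support_pw yS].
have [d23|d23] := eqVneq (x w(+ - + +) * x w(+ + - -)) (x w(+ + - +) * x w(+ - + -)).
  have [g [y [Dg yE /= y1 y2]]] := @kill_pair 3 w(+ - + +) w(+ + - +) x isT isT isT d23.
  have xy : cj x y by rewrite yE; exact: cj_slm.
  apply: (good_cj xy); have yS : supported (hsup 6) y by rewrite yE; exact: supp.
  apply: (stratum_pw stratumF (_ : [:: 2; 0; 1; 3]%N \in S4)) => //;
    [exact: nonzero_cj xy x0|support_pw yS].
apply: (@good_gen 6) => //; rewrite /gen xS /= !evp_minor2 !subr_eq0.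
by rewrite [x w(- + + -) * _]mulrC d12 [x w(- + + -) * _]mulrC d13 [x w(+ - + -) * _]mulrC d23.
Qed.

Lemma stratumH : stratum_good 7.
Proof.
move=> x xS x0.
have [b1|b1] := eqVneq (x w(- + + +)) 0.
  by apply: (stratum_pw stratumD (_ : [:: 0; 1; 2; 3]%N \in S4)) => //; support_pw xS.
have [b2|b2] := eqVneq (x w(+ + - -)) 0.
  by apply: (stratum_pw stratumG (_ : [:: 0; 3; 1; 2]%N \in S4)) => //; support_pw xS.
have [b3|b3] := eqVneq (x w(+ - + -)) 0.
  by apply: (stratum_pw stratumG (_ : [:: 0; 1; 3; 2]%N \in S4)) => //; support_pw xS.
have [b4|b4] := eqVneq (x w(+ - - +)) 0.
  by apply: (stratum_pw stratumG (_ : [:: 0; 1; 2; 3]%N \in S4)) => //; support_pw xS.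
by apply: (@good_gen 7) => //; rewrite /gen xS /= !evp_mono2 !mulf_neq0.
Qed.

End Stratification.

(** * The null cone *)

Section CartanDecomposition.
Variable R : realType.
Implicit Types x y : weight -> R.

Definition rot2 (t : R) : mat2 R := (cos t, sin t, - sin t, cos t).

Lemma det_rot2 t : det2 (rot2 t) = 1.
Proof. by rewrite /det2 /= mulrN opprK -!expr2 cos2Dsin2. Qed.

(** Once the columns of [h] are orthogonal, determinant 1 makes [h] a rotation times diag(r, 1/r),
    with r the norm of the first column; r at most 1 gives [0 <= s]. *)
Lemma kak_at (g : mat2 R) t : det2 g = 1 ->
  let h := mul2 g (rot2 (- t)) in
  h.1.1.1 * h.1.1.2 + h.1.2 * h.2 = 0 -> h.1.1.1 ^+ 2 + h.1.2 ^+ 2 <= 1 ->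
  exists2 s : R, 0 <= s & exists p q, p ^+ 2 + q ^+ 2 = 1 /\
    g = mul2 (p, - q, q, p) (mul2 (diag2 (- s)) (rot2 t)).
Proof.
move=> Dg h; have Dh : det2 h = 1 by rewrite det2M Dg det_rot2 mulr1.
have gE : g = mul2 h (rot2 t).
  rewrite /h; case: g Dg {h Dh} => [[[a b] c] d] _; rewrite /rot2 /= cosN sinN.
  have cs : cos t * cos t + sin t * sin t = 1 by rewrite -!expr2 cos2Dsin2.
  by congr (_, _, _, _); rewrite -[LHS]mulr1 -cs; ring.
move: h gE Dh => [[[h0 h1] h2] h3] -> {Dg}; rewrite /det2 /=; set n := _ + h2 ^+ 2.
move=> Dh dot n1.
have nE : n = h0 ^+ 2 + h2 ^+ 2 by [].
have n0 : 0 < n.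
  rewrite lt0r addr_ge0 ?sqr_ge0 // andbT; apply: contraTneq (oner_neq0 R) => n0.
  have := paddr_eq0 (sqr_ge0 h0) (sqr_ge0 h2); rewrite -nE n0 eqxx => /esym/andP[].
  by rewrite !sqrf_eq0 => /eqP h00 /eqP h20; rewrite -Dh h00 h20 mul0r mulr0 subr0 eqxx.
have nN0 : n != 0 by rewrite gt_eqF.
pose s := - ln (Num.sqrt n); exists s.
  rewrite /s oppr_ge0 -ln1 ler_ln ?posrE ?sqrtr_gt0 //.
  by rewrite -sqrtr1 ler_sqrt.
have es : expR (- s) = Num.sqrt n by rewrite /s opprK lnK // posrE sqrtr_gt0.
set r := Num.sqrt n in es; have r2 : r * r = n by rewrite -expr2 sqr_sqrtr // ltW.
have r0 : r != 0 by rewrite sqrtr_eq0 -ltNge.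
have es' : expR s = r^-1 by rewrite -es expRN invrK.
clearbody s.
have h1E : h1 = - h2 / n.
  apply: (mulIf nN0); rewrite divfK //.
  transitivity (h0 * (h0 * h1 + h2 * h3) - h2 * (h0 * h3 - h1 * h2)).
    by rewrite nE; ring.
  by rewrite dot Dh; ring.
have h3E : h3 = h0 / n.
  apply: (mulIf nN0); rewrite divfK //.
  transitivity (h2 * (h0 * h1 + h2 * h3) + h0 * (h0 * h3 - h1 * h2)).
    by rewrite nE; ring.
  by rewrite dot Dh; ring.
exists (h0 / r), (h2 / r); split.
  by rewrite !exprMn !exprVn -mulrDl -nE expr2 r2 mulfV.
rewrite h1E h3E -r2 /diag2 /rot2 opprK es es' /=.
by congr (_, _, _, _); field.
Qed.

Lemma kak2 (g : mat2 R) : det2 g = 1 -> exists t, t \in `[0, pi] /\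
  exists2 s : R, 0 <= s & exists p q, p ^+ 2 + q ^+ 2 = 1 /\
    g = mul2 (p, - q, q, p) (mul2 (diag2 (- s)) (rot2 t)).
Proof.
case: g => [[[a b] c] d] D.
(* The inner product of the columns of [g] times [rot2 (- t)]. It changes sign over a quarter turn,
   so the intermediate value theorem gives a zero. *)
pose f t := (a * cos t + b * sin t) * (b * cos t - a * sin t) +
            (c * cos t + d * sin t) * (d * cos t - c * sin t) : R.
have fc : continuous f.
  move=> t; apply: cvgD; apply: cvgM; (apply: cvgD; last first); rewrite ?/f;
    try (apply: cvgN); apply: cvgM;
    solve [exact: cvg_cst|exact: continuous_cos|exact: continuous_sin].
have hp : 0 <= pi / 2 :> R by rewrite divr_ge0 ?pi_ge0.
have f0 : f 0 = a * b + c * d by rewrite /f cos0 sin0; ring.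
have f1 : f (pi / 2) = - (a * b + c * d) by rewrite /f cos_pihalf sin_pihalf; ring.
have [|t] := @IVT R f 0 (pi / 2) 0 hp (continuous_subspaceT fc).
  rewrite f0 f1; set v := a * b + c * d.
  rewrite ge_min le_max oppr_ge0 oppr_le0.
  by have /orP[] := le_total 0 v => ->; rewrite ?orbT.
rewrite in_itv /= => /andP[t0 t1] ft.
have [le1|gt1] := leP ((a * cos t + b * sin t) ^+ 2 + (c * cos t + d * sin t) ^+ 2) 1.
  exists t; split; first by rewrite in_itv /= t0 (le_trans t1) // ler_piMr ?pi_ge0 //; lra.
  apply: kak_at => //=; rewrite cosN sinN !opprK //.
  by rewrite -[RHS]ft /f; ring.
(* If the first column is the long one, another quarter turn exchanges the two columns up to
   sign. *)
exists (t + pi / 2); split.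
  by rewrite in_itv /= addr_ge0 //= [leRHS]splitr lerD2r.
have E : (a * cos t + b * sin t) * (d * cos t - c * sin t) -
         (b * cos t - a * sin t) * (c * cos t + d * sin t) = 1.
  have := cos2Dsin2 t; rewrite !expr2 => cs.
  transitivity ((a * d - b * c) * (cos t * cos t + sin t * sin t)); first by ring.
  by rewrite cs mulr1; exact: D.
apply: kak_at => //=; rewrite cosN sinN !opprK cosDpihalf sinDpihalf.
  by rewrite -[RHS]oppr0 -[in RHS]ft /f; ring.
set n := _ + _ in gt1; set m := _ + _.
(* Lagrange's identity: the product of the squared column norms is the squared determinant plus the
   squared inner product. *)
have nm : n * m = 1.
  transitivity (((a * cos t + b * sin t) * (d * cos t - c * sin t) -
     (b * cos t - a * sin t) * (c * cos t + d * sin t)) ^+ 2 + f t ^+ 2).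
    by rewrite /n /m /f; ring.
  by rewrite E ft expr0n addr0 expr1n.
have n0 : 0 < n by apply: lt_trans gt1.
by rewrite -(ler_pM2l n0) nm mulr1 ltW.
Qed.

End CartanDecomposition.

Lemma cvg_sl (R : realType) (T : Type) (F : set_system T) {FF : Filter F} i
    (a b c d : T -> R) (X : T -> weight -> R) (a0 b0 c0 d0 : R) (X0 : weight -> R) :
  a @ F --> a0 -> b @ F --> b0 -> c @ F --> c0 -> d @ F --> d0 ->
  (forall w, (fun t => X t w) @ F --> X0 w) ->
  forall w, (fun t => sl i (a t) (b t) (c t) (d t) (X t) w) @ F --> sl i a0 b0 c0 d0 X0 w.
Proof.
move=> ha hb hc hd hX w; rewrite /sl; case: (bt i w);
by apply: cvgD; apply: cvgM.
Qed.

Lemma acts_mul (K : comPzRingType) (g h : nat -> mat2 K) x :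
  acts slots (fun i => mul2 (g i) (h i)) x = acts slots g (acts slots h x).
Proof.
suff : forall s, uniq s -> all (gtn 4%N) s ->
    acts s (fun i => mul2 (g i) (h i)) x = acts s g (acts s h x) by exact.
elim=> //= i s IH /andP[si us] /andP[i4 s4].
by rewrite (IH us s4) -(slm_comp _ _ _ i4) !(slm_acts _ _ _ i4 s4 si).
Qed.

Definition half_spaces : seq (nat * seq nat) := [::
  (3, [:: 0; 1; 2; 3]); (3, [:: 1; 0; 2; 3]); (3, [:: 1; 2; 0; 3]); (3, [:: 1; 2; 3; 0]);
  (7, [:: 0; 1; 2; 3]); (7, [:: 1; 0; 2; 3]); (7, [:: 1; 2; 0; 3]); (7, [:: 1; 2; 3; 0]);
  (6, [:: 3; 0; 1; 2]); (6, [:: 0; 3; 1; 2]); (6, [:: 0; 1; 3; 2]); (6, [:: 0; 1; 2; 3])]%N.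

Section NullCone.
Variable R : realType.
Implicit Types x y : weight -> R.

Lemma half_space_test T (f : weight -> R) :
  List.Forall (fun w => f w <= 0) [seq w <- weights | ~~ hsup T w] ->
  forall w, ~~ hsup T w -> f w <= 0.
Proof.
move/List.Forall_forall => h w wT; apply: h; apply/in_ListP.
by rewrite mem_filter wT mem_weights.
Qed.

Ltac compute_half_space := apply: half_space_test;
  match goal with |- List.Forall _ ?l =>
    let v := eval vm_compute in l in replace l with v by (vm_compute; reflexivity) end;
  repeat constructor; rewrite /=.

(** If one [t i] is at least the sum of the others, type 3 serves. Otherwise all weights with at
    most one plus pair nonpositively, and so does one of each of the three opposite pairs of weights
    with two pluses; the eight choices are the permuted half spaces of types 7 and 6. *)
Lemma half_space_exists (t : nat -> R) : (forall i, 0 <= t i) ->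
  exists2 h, h \in half_spaces & forall w, ~~ hsup h.1 w -> pairing t (pw h.2 w) <= 0.
Proof.
move=> t0; move: (t0 0%N) (t0 1%N) (t0 2%N) (t0 3%N).
rewrite /pairing; move: (t 0%N) (t 1%N) (t 2%N) (t 3%N) => a b c d a0 b0 c0 d0.
have Ds : [|| b + c + d <= a, a + c + d <= b, a + b + d <= c | a + b + c <= d] ->
    exists2 h, h \in half_spaces & forall w, ~~ hsup h.1 w ->
    (if bt 0 (pw h.2 w) then a else - a) + (if bt 1 (pw h.2 w) then b else - b) +
    (if bt 2 (pw h.2 w) then c else - c) + (if bt 3 (pw h.2 w) then d else - d) <= 0.
  case/or4P=> h;
  [exists (nth (0%N, [::]) half_spaces 0)|exists (nth (0%N, [::]) half_spaces 1)|
   exists (nth (0%N, [::]) half_spaces 2)|exists (nth (0%N, [::]) half_spaces 3)] => //;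
  by compute_half_space; lra.
have [/Ds //|] := boolP [|| b + c + d <= a, a + c + d <= b, a + b + d <= c | a + b + c <= d].
rewrite !negb_or -!ltNge => /and4P[h1 h2 h3 h4].
have f0 : - a - b - c - d <= 0 by lra.
have f1 : a - b - c - d <= 0 by lra.
have f2 : - a + b - c - d <= 0 by lra.
have f3 : - a - b + c - d <= 0 by lra.
have f4 : - a - b - c + d <= 0 by lra.
have A : - a - b + c + d <= 0 \/ a + b - c - d <= 0.
  by case: (leP (c + d) (a + b)) => ?; [left|right]; lra.
have B : - a + b - c + d <= 0 \/ a - b + c - d <= 0.
  by case: (leP (b + d) (a + c)) => ?; [left|right]; lra.
have C : - a + b + c - d <= 0 \/ a - b - c + d <= 0.
  by case: (leP (b + c) (a + d)) => ?; [left|right]; lra.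
case: A => A; case: B => B; case: C => C;
[exists (nth (0%N, [::]) half_spaces 4)|exists (nth (0%N, [::]) half_spaces 11)|
 exists (nth (0%N, [::]) half_spaces 10)|exists (nth (0%N, [::]) half_spaces 5)|
 exists (nth (0%N, [::]) half_spaces 9)|exists (nth (0%N, [::]) half_spaces 6)|
 exists (nth (0%N, [::]) half_spaces 7)|exists (nth (0%N, [::]) half_spaces 8)] => //;
by compute_half_space.
Qed.

Definition sqnorm y := \sum_(w <- weights) y w ^+ 2.

Lemma sqnorm_rot (g : nat -> mat2 R) y :
  (forall i, exists p q, p ^+ 2 + q ^+ 2 = 1 /\ g i = (p, - q, q, p)) ->
  sqnorm (acts slots g y) = sqnorm y.
Proof.
move=> gP; have step i z : (i < 4)%N -> sqnorm (slm i (g i) z) = sqnorm z.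
  have [p [q [pq ->]]] := gP i.
  move=> i4; rewrite -[RHS]mul1r -pq /sqnorm /weights /= !big_cons !big_nil /slm /=.
  by case: i i4 => [|[|[|[|//]]]] _; rewrite /sl /=; ring.
by rewrite /acts /= !step.
Qed.

Lemma ler_sqnorm y w : y w ^+ 2 <= sqnorm y.
Proof.
rewrite /sqnorm (bigD1_seq w) ?mem_weights //= ?lerDl ?sumr_ge0 // => v _.
exact: sqr_ge0.
Qed.

Definition null x := forall e : R, 0 < e -> exists2 y, cj x y & forall w, `|y w| < e.

Definition rotate (t : 'rV[R]_4) x := acts slots (fun i => rot2 (t ord0 (inord i))) x.

Definition angles : set 'rV[R]_4 := [set t | forall i, `[0, pi]%classic (t ord0 i)].

(** The left rotations preserve the norm, and the diagonal part does not shrink coordinates outside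
    the chosen half space, so those were already small in the rotated tensor. *)
Lemma null_rotate x e : null x -> 0 < e ->
  exists2 t, angles t & exists2 h, h \in half_spaces &
    forall w, ~~ hsup h.1 w -> rotate t x (pw h.2 w) ^+ 2 < e.
Proof.
(* Sixteen coordinates of absolute value at most [d] have squared norm at most [e / 2]. *)
move=> nx e0; pose d := Num.sqrt (e / 32).
have d0 : 0 < d by rewrite sqrtr_gt0 divr_gt0.
have [_ /cj_actsP[g Dg ->] small] := nx d d0.
have /(_ _)/cid-/all_sig[t ht] := fun i => kak2 (Dg i).
have h1 i : exists s, 0 <= s /\ exists p q, p ^+ 2 + q ^+ 2 = 1 /\
    g i = mul2 (p, - q, q, p) (mul2 (diag2 (- s)) (rot2 (t i))).
  by have [_ [s s0 H]] := ht i; exists s.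
have /(_ _)/cid-/all_sig[s hs] := h1.
have /(_ _)/cid-/all_sig[p hp] := fun i => (hs i).2.
have /(_ _)/cid-/all_sig[q hq] := hp.
pose T : 'rV[R]_4 := \row_j t j.
have Tt i : (i < 4)%N -> T ord0 (inord i) = t i by move=> i4; rewrite mxE inordK.
exists T; first by move=> i; rewrite mxE /=; have [] := ht i.
have [h hh hw] := half_space_exists (fun i => (hs i).1); exists h => // w /hw pw0.
have rE : rotate T x = acts slots (fun i => rot2 (t i)) x.
  by rewrite /rotate /acts /= !Tt.
have gE : acts slots g x = acts slots (fun i => (p i, - q i, q i, p i))
    (acts slots (fun i => diag2 (- s i)) (rotate T x)).
  by rewrite rE -(acts_mul _ (fun i => rot2 (t i)) x) -acts_mul;
    congr (acts _ _ _); apply/funext => i; exact: (hq i).2.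
have lt_e : sqnorm (acts slots (fun i => diag2 (- s i)) (rotate T x)) < e.
  rewrite -(@sqnorm_rot (fun i => (p i, - q i, q i, p i))); last first.
    by move=> i; exists (p i), (q i); split => //; exact: (hq i).1.
  rewrite -gE.
  apply: (@le_lt_trans _ _ (\sum_(w <- weights) e / 32)); last first.
    by rewrite /weights /= !big_cons big_nil; lra.
  apply: ler_sum => v _.
  have : `|acts slots g x v| ^+ 2 <= d ^+ 2.
    by rewrite lerXn2r ?nnegrE ?normr_ge0 ?sqrtr_ge0 // ltW //; exact: small.
  by rewrite real_normK ?num_real // /d sqr_sqrtr // divr_ge0 // ltW.
apply: le_lt_trans lt_e; apply: le_trans (ler_sqnorm _ (pw h.2 w)).
rewrite acts_diag2 exprMn ler_peMl ?sqr_ge0 // exprn_ege1 //.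
rewrite -expR0 ler_expR.
have -> : pairing (fun i => - s i) (pw h.2 w) = - pairing s (pw h.2 w).
  by rewrite /pairing; do !case: ifP => _; ring.
by rewrite oppr_ge0.
Qed.

End NullCone.

Lemma cvg_sumr (R : realType) (T I : Type) (F : set_system T) {FF : Filter F} (r : seq I)
    (P : pred I) (f : I -> T -> R) (l : I -> R) :
  (forall i, f i @ F --> l i) ->
  (fun t => \sum_(i <- r | P i) f i t) @ F --> \sum_(i <- r | P i) l i.
Proof.
move=> fl; elim: r => [|i r IH].
  by rewrite big_nil; under eq_fun do rewrite big_nil; exact: cvg_cst.
rewrite big_cons; under eq_fun do rewrite big_cons.
by case: (P i) => //; apply: cvgD.
Qed.

Section NullConeCompactness.
Variable R : realType.
Implicit Types x y : weight -> R.

Definition defect (h : nat * seq nat) x : R :=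
  \sum_(w <- weights | ~~ hsup h.1 w) x (pw h.2 w) ^+ 2.

Lemma defect_ge0 h x : 0 <= defect h x.
Proof. by apply: sumr_ge0 => w _; exact: sqr_ge0. Qed.

Lemma defect_eq0 h x : defect h x = 0 -> supported (hsup h.1) (x \o pw h.2).
Proof.
move/eqP; rewrite psumr_eq0 => [|w _]; last exact: sqr_ge0.
move/allP => h0; apply/supportedP => w wn; apply/eqP.
by have := h0 w (mem_weights w); rewrite wn /= sqrf_eq0.
Qed.

Lemma rotate_continuous x w : continuous (fun t : 'rV[R]_4 => rotate t x w).
Proof.
move=> t; rewrite /rotate /acts /=.
have cs i : (fun s : 'rV[R]_4 => cos (s ord0 i)) @ t --> cos (t ord0 i).
  by apply: (@continuous_comp _ _ _ (fun s : 'rV[R]_4 => s ord0 i) cos);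
    [exact: coord_continuous|exact: continuous_cos].
have sn i : (fun s : 'rV[R]_4 => sin (s ord0 i)) @ t --> sin (t ord0 i).
  by apply: (@continuous_comp _ _ _ (fun s : 'rV[R]_4 => s ord0 i) sin);
    [exact: coord_continuous|exact: continuous_sin].
have sN i : (fun s : 'rV[R]_4 => - sin (s ord0 i)) @ t --> - sin (t ord0 i).
  exact: (cvgN (sn i)).
move: w; do 4!apply: (cvg_sl (cs _) (sn _) (sN _) (cs _)).
by move=> w; exact: cvg_cst.
Qed.

Lemma defect_continuous h x : continuous (fun t : 'rV[R]_4 => defect h (rotate t x)).
Proof.
move=> t; rewrite /defect; apply: (@cvg_sumr R _ _ (nbhs t) _) => w.
by rewrite /GRing.exp /=; apply: cvgM; exact: rotate_continuous.
Qed.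

Lemma compact_angles : compact (@angles R).
Proof. by apply: (@rV_compact R 4 (fun=> `[0, pi]%classic)) => i; exact: segment_compact. Qed.

(** Otherwise each of the twelve defects has a positive minimum on the compact set of angles, and
    [null_rotate] goes below the least of these. *)
Lemma null_half_space x : null x -> exists t, exists2 h, h \in half_spaces &
  supported (hsup h.1) (rotate t x \o pw h.2).
Proof.
move=> nx; apply: contrapT => no.
have A0 : @angles R !=set0.
  by exists 0 => i; rewrite /= mxE in_itv /= lexx pi_ge0.
have pos h : h \in half_spaces ->
    exists2 m, 0 < m & forall t, angles t -> m <= defect h (rotate t x).
  move=> hh; have [t _ tmin] := EVT_min_rV A0 compact_angles
    (continuous_subspaceT (@defect_continuous h x)).
  exists (defect h (rotate t x)); last by move=> s sA; apply: tmin; rewrite inE.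
  rewrite lt_neqAle defect_ge0 andbT eq_sym; apply/eqP => d0.
  by apply: no; exists t, h => //; exact: defect_eq0.
have [m m0 mP] : exists2 m, 0 < m & forall h t, h \in half_spaces -> angles t ->
    m <= defect h (rotate t x).
  elim: half_spaces pos => [|h s IH] pos; first by exists 1.
  have [m m0 mP] := pos h (mem_head _ _).
  have [|n n0 nP] := IH; first by move=> k ks; apply: pos; rewrite inE ks orbT.
  exists (Num.min m n); first by rewrite lt_min m0.
  move=> k t; rewrite inE ge_min => /orP[/eqP->|ks] tA; first by rewrite mP.
  by rewrite nP ?orbT.
(* At most sixteen summands, each at most [m / 17], stay strictly below [m]. *)
have [|t tA [h hh small]] := @null_rotate R x (m / 17) nx; first by rewrite divr_gt0.
have := mP h t hh tA; apply/negP; rewrite -ltNge /defect.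
apply: (@le_lt_trans _ _ (\sum_(w <- weights | ~~ hsup h.1 w) m / 17)).
  by apply: ler_sum => w /small/ltW.
apply: (@le_lt_trans _ _ (\sum_(w <- weights) m / 17)).
  rewrite big_mkcond /=; apply: ler_sum => w _; case: ifP => // _.
  by rewrite divr_ge0 // ltW.
by rewrite /weights /= !big_cons big_nil; lra.
Qed.

Lemma cj_rotate t x : cj x (rotate t x).
Proof. by apply: cj_acts => // i; exact: det_rot2. Qed.

Lemma null_good x : null x -> nonzero x -> good x.
Proof.
move=> nx x0; have [t [h hh hS]] := null_half_space nx.
have xt := cj_rotate t x; apply: (good_cj xt); have t0 := nonzero_cj xt x0.
have pS : h.2 \in S4 by apply: (allP (_ : all (fun h => h.2 \in S4) half_spaces) h hh); vm_compute.
have : [|| h.1 == 3, h.1 == 7 | h.1 == 6].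
  by apply: (allP (_ : all (fun h => [|| h.1 == 3, h.1 == 7 | h.1 == 6]) half_spaces) h hh);
    vm_compute.
case/or3P=> /eqP hT; move: hS; rewrite hT => hS.
- exact: stratum_pw (@stratumD R) pS t0 hS.
- exact: stratum_pw (@stratumH R) pS t0 hS.
exact: stratum_pw (@stratumG R) pS t0 hS.
Qed.

(** On the half space the pairing with [lam] is a positive integer, hence at least 1. *)
Lemma hsup_pairing T (r : R) w : (T < 8)%N -> 0 <= r -> hsup T w ->
  r <= pairing (fun i => (nth 0%N (lam T) i)%:R * r) w.
Proof.
have H : all (fun T => all (fun w => hsup T w ==>
   (sumn [seq nth 0 (lam T) i * ~~ bt i w | i <- slots] <
    sumn [seq nth 0 (lam T) i * bt i w | i <- slots])%N) weights) (iota 0 8).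
  by vm_compute.
move=> T8 r0 wT; have Ti : T \in iota 0 8 by rewrite mem_iota.
have := implyP (allP (allP H T Ti) w (mem_weights w)) wT.
rewrite -(ler_nat R) -natr1 /pairing /= !addn0 !natrD.
set l := fun i => (nth 0%N (lam T) i)%:R : R.
move=> h; rewrite -[leLHS]mul1r.
apply: (@le_trans _ _ (((if bt 0 w then l 0%N else - l 0%N) +
  (if bt 1 w then l 1%N else - l 1%N) + (if bt 2 w then l 2%N else - l 2%N) +
  (if bt 3 w then l 3%N else - l 3%N)) * r)).
  apply: ler_wpM2r => //; move: h; rewrite /l.
  by do 4!case: (bt _ w); rewrite /= ?muln0 ?muln1; lra.
by rewrite le_eqVlt; apply/orP; left; apply/eqP; do 4!case: (bt _ w); rewrite /l; ring.
Qed.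

Lemma supported_null T x : (T < 8)%N -> supported (hsup T) x -> null x.
Proof.
move=> T8 /supportedP xS e e0; pose M := 1 + \sum_(w <- weights) `|x w|.
have M1 : 1 <= M by rewrite lerDl; apply: sumr_ge0.
have xM w : `|x w| < M.
  rewrite /M (bigD1_seq w) ?mem_weights //= addrCA ltrDl ltr_pwDl //.
  exact: sumr_ge0.
have M0 : 0 < M by apply: lt_le_trans M1.
(* Chosen so that [expR (- r)] is at most [e / M], while [M] exceeds every coordinate of [x] in
   absolute value. *)
pose r := Num.max 0 (- ln (e / M)).
exists (acts slots (fun i => diag2 (- ((nth 0%N (lam T) i)%:R * r))) x).
  by apply: cj_acts => // i; exact: det_diag2.
move=> w; rewrite acts_diag2 normrM (ger0_norm (expR_ge0 _)).
case: (boolP (hsup T w)) => [wT|/xS ->]; last by rewrite normr0 mulr0.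
have -> : pairing (fun i => - ((nth 0%N (lam T) i)%:R * r)) w =
    - pairing (fun i => (nth 0%N (lam T) i)%:R * r) w.
  by rewrite /pairing; do 4!case: (bt _ w); ring.
have r0 : 0 <= r by rewrite le_max lexx.
have := hsup_pairing T8 r0 wT; move: (pairing _ _) => t rt.
apply: (@le_lt_trans _ _ (e / M * `|x w|)).
  apply: ler_wpM2r => //; rewrite -[leRHS]lnK ?posrE ?divr_gt0 // ler_expR lerNl.
  by apply: le_trans rt; rewrite le_max lexx orbT.
by rewrite -mulrA -[ltRHS]mulr1 ltr_pM2l // mulrC ltr_pdivrMr ?mul1r.
Qed.

Lemma null_pw p x : p \in S4 -> null (x \o pw p) -> null x.
Proof.
move=> pS nx e e0; have [y xy ys] := nx e e0; have [r rS rp] := S4_inv pS.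
exists (y \o pw r); last by move=> w; exact: ys.
have yE : (y \o pw r) \o pw p = y by rewrite -compA rp.
by apply: (cj_pwI pS); rewrite yE.
Qed.

Lemma null_cj x y : cj x y -> null y -> null x.
Proof. by move=> xy ny e /ny[z yz zs]; exists z => //; exact: cj_trans xy yz. Qed.

Lemma rtens_null k r : (k < 30)%N -> r \in sfam k -> null (rtens R r) /\ nonzero (rtens R r).
Proof.
move=> k30 rk; have [Tk pk] := key_typeP k30.
have c := cj_rtens_std R k r pk.
have g : gen (key_type k) (intt R (srep_std k r)) by rewrite gen_intt; exact: srep_std_gen.
have nz : nonzero (intt R (srep_std k r)).
  move: g; case/andP=> _; case: (pselect (nonzero (intt R (srep_std k r)))) => // n0.
  have -> : intt R (srep_std k r) = (fun=> 0).
    by apply/funext => w; apply/eqP/negPn/negP => h; apply: n0; exists w.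
  by case: (key_type k) Tk => [|[|[|[|[|[|[|[|//]]]]]]]] _;
    rewrite /invs /= /evp /evm /= !(mul0r, mulr0, addr0) ?eqxx.
split.
  apply: (null_pw pk); apply: (null_cj c); apply: supported_null Tk _.
  by case/andP: g.
have [w wn] := nonzero_cj (cj_sym c) nz.
by exists (pw (key_perm k) w).
Qed.

End NullConeCompactness.

(** * Tensors as columns *)

Definition bit_ord (b : bool) : 'I_2 := if b then 0 else 1.
Definition ord_bit (i : 'I_2) : bool := i == 0.

Lemma bit_ordK : cancel bit_ord ord_bit. Proof. by case. Qed.
Lemma ord_bitK : cancel ord_bit bit_ord.
Proof. by case=> [[|[|//]]] i; apply/val_inj. Qed.

Definition widx (w : weight) : 'I_(2 * 2 * 2 * 2) :=
  mxtens_index (mxtens_index (mxtens_index (bit_ord (bt 0 w), bit_ord (bt 1 w)),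
    bit_ord (bt 2 w)), bit_ord (bt 3 w)).

Definition unwidx (k : 'I_(2 * 2 * 2 * 2)) : weight :=
  let: (k3, d) := mxtens_unindex k in let: (k2, c) := mxtens_unindex k3 in
  let: (a, b) := mxtens_unindex k2 in (ord_bit a, ord_bit b, ord_bit c, ord_bit d).

Lemma widxK : cancel widx unwidx.
Proof.
by case=> [[[a b] c] d]; rewrite /unwidx /widx !mxtens_indexK /= !bit_ordK.
Qed.

Lemma unwidxK : cancel unwidx widx.
Proof.
move=> k; case: (mxtens_indexP k) => k3 d; case: (mxtens_indexP k3) => k2 c.
case: (mxtens_indexP k2) => a b.
by rewrite /unwidx !mxtens_indexK /widx /= !ord_bitK.
Qed.

Lemma sum_mxtens (V : nmodType) m n (F : 'I_(m * n) -> V) :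
  \sum_k F k = \sum_i \sum_j F (mxtens_index (i, j)).
Proof.
rewrite pair_bigA /= (reindex (@mxtens_index m n)) /=.
  by apply: eq_bigr => -[i j] _.
by exists (@mxtens_unindex m n) => k _; rewrite ?mxtens_indexK ?mxtens_unindexK.
Qed.

Section Coordinates.
Variable K : fieldType.
Implicit Types x y : tensor4 K.

Definition co x (w : weight) : K := x (widx w) 0.
Definition ten (f : weight -> K) : tensor4 K := \col_k f (unwidx k).

Lemma tenK f : co (ten f) = f.
Proof. by apply/funext => w; rewrite /co mxE widxK. Qed.

Lemma coK x : ten (co x) = x.
Proof. by apply/colP => k; rewrite mxE /co unwidxK. Qed.

Definition entries (g : 'M[K]_2) : mat2 K := (g 0 0, g 0 1, g 1 0, g 1 1).
Definition unentries (g : mat2 K) : 'M[K]_2 :=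
  \matrix_(i, j) (if i == 0 then if j == 0 then g.1.1.1 else g.1.1.2
                  else if j == 0 then g.1.2 else g.2).

Lemma unentriesK g : entries (unentries g) = g.
Proof. by case: g => [[[a b] c] d]; rewrite /entries !mxE. Qed.

Lemma det_entries g : \det g = det2 (entries g).
Proof.
rewrite (expand_det_row _ 0) !big_ord_recl big_ord0 /cofactor !det_mx11 !mxE.
rewrite /det2 /= addr0 expr0 expr1 mul1r mulN1r mulrN.
by congr (g _ _ * g _ _ - g _ _ * g _ _); apply/val_inj.
Qed.

Lemma co_act4 g1 g2 g3 g4 x : co (act4 g1 g2 g3 g4 x) =
  slm 0 (entries g1) (slm 1 (entries g2) (slm 2 (entries g3) (slm 3 (entries g4) (co x)))).
Proof.
have E1 : lift 0 0 = 1 :> 'I_2 by apply/val_inj.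
apply/funext => w; rewrite /co /act4 mxE !sum_mxtens !big_ord_recl !big_ord0 E1 !addr0.
rewrite /widx !tensmxE /slm /sl /=.
by case: w => [[[[] []] []] []] /=; ring.
Qed.

Lemma SL2_conjP x y : SL2_conj x y <-> cj (co x) (co y).
Proof.
split=> [[g1 [g2 [g3 [g4 [D1 D2 D3 D4 ->]]]]]|/cj_actsP[g Dg E]].
  rewrite !det_entries in D1 D2 D3 D4; rewrite co_act4.
  by do 4![apply: cj_step; [by []|by []|]]; apply: cj_refl.
exists (unentries (g 0%N)), (unentries (g 1%N)), (unentries (g 2%N)), (unentries (g 3%N)).
split; rewrite ?det_entries ?unentriesK //.
by rewrite -[LHS]coK -[RHS]coK co_act4 !unentriesK E.
Qed.

Lemma co_basis4 a b c d w : co (basis4 K a b c d) w = (w == (a, b, c, d))%:R.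
Proof.
rewrite /co /basis4 /widx /sign_vec !mxE !mxtens_indexK /= !ord1 !eqxx !andbT.
by case: w => [[[[] []] []] []]; case: a; case: b; case: c; case: d;
  rewrite /= !(mul0r, mulr0, mul1r).
Qed.

Definition trep (r : srep) : tensor4 K := ten (rtens K r).
Definition wbasis (w : weight) : tensor4 K :=
  let: (a, b, c, d) := w in basis4 K a b c d.

Lemma wbasisE w v : co (wbasis w) v = (v == w)%:R.
Proof. by case: w => [[[a b] c] d]; exact: co_basis4. Qed.

Lemma co_inj : injective co.
Proof. by move=> x y E; rewrite -[x]coK -[y]coK E. Qed.

Lemma coD x y : co (x + y) = co x \+ co y.
Proof. by apply/funext => w; rewrite /co mxE. Qed.

Lemma coN x : co (- x) = \- co x.
Proof. by apply/funext => w; rewrite /co mxE. Qed.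

Lemma rtens_rcons r c w v : rtens K (rcons r (c, w)) v = rtens K r v + c%:~R * (v == w)%:R.
Proof.
rewrite /rtens; elim: r => [|t r IH] /=; last by rewrite IH addrA.
by rewrite addr0 add0r; case: eqP; rewrite ?mulr1 ?mulr0.
Qed.

Lemma pm_spm r ts : pm (trep r) (map wbasis ts) = map trep (spm r ts).
Proof.
elim: ts r => //= t ts IH r; rewrite map_cat -!IH; congr (pm _ _ ++ pm _ _);
  apply: co_inj; apply/funext => v; rewrite ?coD ?coN /= !tenK wbasisE rtens_rcons.
  by rewrite mul1r.
by rewrite mulN1r.
Qed.

Lemma trep1 w : wbasis w = trep [:: (1, w)].
Proof.
apply: co_inj; apply/funext => v; rewrite tenK wbasisE /rtens /= addr0.
by case: eqP.
Qed.

Lemma five_sfive a b c d :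
  five (wbasis a) (wbasis b) (wbasis c) (wbasis d) = map trep (sfive a b c d).
Proof.
by congr [:: _; _; _; _; _]; apply: co_inj; apply/funext => v;
  do 4!rewrite ?(coD, coN) /=; rewrite tenK !wbasisE /rtens /=;
  do 4!case: (v == _) => /=; ring.
Qed.

End Coordinates.

Definition fdims : seq nat :=
  [:: 5; 6; 6; 6; 6; 6; 6; 8; 8; 8; 8; 9; 9; 9; 9; 9; 10; 10; 10; 10; 10; 10;
      11; 11; 11; 11; 12; 12; 12; 12]%N.

Lemma nilp_familiesE (K : fieldType) :
  nilp_families K = [seq (nth 0%N fdims k, map (trep K) (sfam k)) | k <- iota 0 30].
Proof.
rewrite /nilp_families /iota; cbn [map].
do 30![congr (_ :: _); first by congr (_, _); rewrite /sfam; cbn [nth];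
  rewrite -?pm_spm -?five_sfive -?trep1].
Qed.

Lemma co_nonzero (K : fieldType) (x : tensor4 K) : x <> 0 <-> nonzero (co x).
Proof.
split=> [x0|[w xw] x0]; last by move: xw; rewrite x0 /co mxE eqxx.
apply: contrapT => nx; apply: x0; apply: co_inj; apply/funext => w.
by rewrite [in RHS]/co mxE; apply/eqP/negPn/negP => h; apply: nx; exists w.
Qed.

Section Nilpotent.
Variable R : realType.

Lemma nilpotent4P (x : tensor4 R) : nilpotent4 x <-> null (co x).
Proof.
split=> [nx e e0|nx B].
  have [y [/SL2_conjP xy By]] := nx (ball 0 e) (nbhsx_ballx _ _ e0).
  exists (co y) => // w; have [_ /(_ (widx w) 0)] := By.
  by rewrite /ball /= mxE sub0r normrN.
move/nbhs_ballP => [e e0 eB]; have [y xy ys] := nx e e0.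
exists (ten y); split; first by apply/SL2_conjP; rewrite tenK.
apply: eB; split => // i j; rewrite /ball /= !mxE sub0r normrN.
exact: ys.
Qed.

End Nilpotent.

(** * Charts of the orbits *)

Section Charts.
Variable R : realType.

Lemma cvg_mx (T : Type) (F : set_system T) {FF : Filter F} m n (f : T -> 'M[R]_(m, n))
    (l : 'M[R]_(m, n)) :
  (forall i j, (fun t => f t i j) @ F --> l i j) -> f @ F --> l.
Proof.
move=> fl; apply/cvg_ballP => e e0.
have H : \forall t \near F, forall i j, ball (l i j) e (f t i j).
  by apply: filter_forall => i; apply: filter_forall => j; move/cvg_ballP: (fl i j) => /(_ e e0).
by apply: filterS H => t ht; split.
Qed.

(** Continuity is required in the ambient spaces at all points of [U] and [W], which is stronger
    than continuity within the subspace and makes transport by homeomorphisms direct. *)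
Definition has_chart (T : topologicalType) (S : set T) (d : nat) (p : T) : Prop :=
  exists (U : set T) (W : set 'rV[R]_d) (f : T -> 'rV[R]_d) (g : 'rV[R]_d -> T),
    [/\ open U, U p & open W] /\
    [/\ set_fun (S `&` U) W f, set_fun W (S `&` U) g,
        (forall q, (S `&` U) q -> g (f q) = q)
      & (forall w, W w -> f (g w) = w)] /\
    (forall q, U q -> {for q, continuous f}) /\ (forall w, W w -> {for w, continuous g}).

Lemma has_chart_manifold (T : topologicalType) (S : set T) d :
  (forall p, S p -> has_chart S d p) -> manifold_of_dim R S d.
Proof.
move=> h p /h[U [W [f [g [H1 [H2 [fc gc]]]]]]]; exists U, W, f, g; split=> //; split=> //.
split; apply/subspace_continuousP => q qA; apply: cvg_within_filter.
  by apply: fc; case: qA.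
exact: gc.
Qed.

Lemma has_chart_transport (T : topologicalType) (S S' : set T) d (F G : T -> T) p :
  continuous F -> continuous G -> cancel F G -> cancel G F ->
  (forall q, S' q <-> S (G q)) -> has_chart S d p -> has_chart S' d (F p).
Proof.
move=> Fc Gc FK GK SS' [U [W [f [g [[oU Up oW] [[fW gS gf fg] [fc gc]]]]]]].
exists (G @^-1` U), W, (f \o G), (F \o g); split; first split => //.
- by apply: open_comp => // q _; exact: Gc.
- by rewrite /preimage /= FK.
split; first split => /=.
- by move=> q [/SS' Sq Uq]; apply: fW.
- move=> w /gS[Sq Uq]; split; last by rewrite /preimage /= FK.
  by apply/SS'; rewrite FK.
- by move=> q [/SS' Sq Uq]; rewrite gf ?GK.
- by move=> w Ww; rewrite FK fg.
split=> [q Uq|w Ww].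
  by apply: continuous_comp; [exact: Gc|exact: fc].
by apply: continuous_comp; [exact: gc|exact: Fc].
Qed.

Lemma co_continuous w : continuous (fun x : tensor4 R => co x w).
Proof. by move=> x; exact: coord_continuous. Qed.

Lemma cvg_ten (T : Type) (F : set_system T) {FF : Filter F} (f : T -> weight -> R)
    (l : weight -> R) :
  (forall w, (fun t => f t w) @ F --> l w) -> (fun t => ten (f t) : tensor4 R) @ F --> ten l.
Proof.
by move=> fl; apply: cvg_mx => i j; rewrite mxE; under eq_fun do rewrite mxE; exact: fl.
Qed.

Lemma cvg_acts (T : Type) (F : set_system T) {FF : Filter F} (s : T -> nat -> mat2 R)
    (s0 : nat -> mat2 R) (X : T -> weight -> R) (X0 : weight -> R) :
  (forall i, [/\ (fun t => (s t i).1.1.1) @ F --> (s0 i).1.1.1,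
    (fun t => (s t i).1.1.2) @ F --> (s0 i).1.1.2, (fun t => (s t i).1.2) @ F --> (s0 i).1.2 &
    (fun t => (s t i).2) @ F --> (s0 i).2]) ->
  (forall w, (fun t => X t w) @ F --> X0 w) ->
  forall w, (fun t => acts slots (s t) (X t) w) @ F --> acts slots s0 X0 w.
Proof.
move=> hs hX; rewrite /acts /=.
have [a0 b0 c0 d0] := hs 0%N; have [a1 b1 c1 d1] := hs 1%N.
have [a2 b2 c2 d2] := hs 2%N; have [a3 b3 c3 d3] := hs 3%N.
apply: (cvg_sl a0 b0 c0 d0); apply: (cvg_sl a1 b1 c1 d1).
by apply: (cvg_sl a2 b2 c2 d2); apply: (cvg_sl a3 b3 c3 d3).
Qed.

Lemma cvg_evp (T : Type) (F : set_system T) {FF : Filter F} (X : T -> weight -> R)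
    (X0 : weight -> R) p :
  (forall w, (fun t => X t w) @ F --> X0 w) -> (fun t => evp (X t) p) @ F --> evp X0 p.
Proof.
move=> hX; rewrite /evp; elim: p => [|t p IH] /=; first exact: cvg_cst.
apply: cvgD => //; apply: cvgM; first exact: cvg_cst.
rewrite /evm; elim: t.2 => [|w m IHm] /=; first exact: cvg_cst.
exact: cvgM.
Qed.

Lemma acts_inv2 (g : nat -> mat2 R) z : (forall i, det2 (g i) = 1) ->
  acts slots (fun i => inv2 (g i)) (acts slots g z) = z.
Proof.
move=> Dg; rewrite -acts_mul (_ : (fun i => _) = fun=> (1, 0, 0, 1)).
  by rewrite /acts /= /slm /= !sl1.
apply/funext => i; have := Dg i; rewrite /inv2; case: (g i) => [[[a b] c] e] /=.
by rewrite /det2 /= => D; congr (_, _, _, _); rewrite -?D; ring.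
Qed.

Lemma acts_inv2r (g : nat -> mat2 R) z : (forall i, det2 (g i) = 1) ->
  acts slots g (acts slots (fun i => inv2 (g i)) z) = z.
Proof.
move=> Dg; have {1}-> : g = fun i => inv2 (inv2 (g i)).
  by apply/funext => i; case: (g i) => [[[a b] c] e]; rewrite /inv2 /= !opprK.
apply: acts_inv2 => i; rewrite -(Dg i) /inv2 /det2.
by case: (g i) => [[[a b] c] e] /=; ring.
Qed.

(** Orbits are homogeneous, so a chart at a single point suffices. *)
Lemma act4_transport (d : nat) (S : set (tensor4 R)) (x y : tensor4 R) :
  (forall a b, SL2_conj a b -> S a -> S b) -> SL2_conj x y -> has_chart S d x ->
  has_chart S d y.
Proof.
move=> Sc /SL2_conjP/cj_actsP[g Dg yE] hx.
have yE' : y = ten (acts slots g (co x)) by rewrite -yE coK.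
have gK z : acts slots (fun i => inv2 (g i)) (acts slots g z) = z by exact: acts_inv2.
have Kg z : acts slots g (acts slots (fun i => inv2 (g i)) z) = z by exact: acts_inv2r.
have cont (h : nat -> mat2 R) :
    continuous (fun z : tensor4 R => ten (acts slots h (co z)) : tensor4 R).
  move=> z.
  apply: (@cvg_ten _ (nbhs z) _ (fun t => acts slots h (co t)) (acts slots h (co z))).
  apply: (@cvg_acts _ (nbhs z) _ (fun=> h) h (fun t => co t)) => [i|w]; last exact: co_continuous.
  by split; exact: cvg_cst.
pose F (z : tensor4 R) : tensor4 R := ten (acts slots g (co z)).
pose G (z : tensor4 R) : tensor4 R := ten (acts slots (fun i => inv2 (g i)) (co z)).
have FK : cancel F G by move=> z; rewrite /F /G tenK gK coK.
have GK : cancel G F by move=> z; rewrite /F /G tenK Kg coK.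
have SG z : S z <-> S (G z).
  have zz : cj (co z) (co (G z)).
    rewrite tenK; apply: cj_acts => // i; rewrite -(Dg i) /inv2.
    by case: (g i) => [[[a b] c] e]; rewrite /det2 /=; ring.
  by split; apply: Sc; apply/SL2_conjP => //; exact: cj_sym.
rewrite yE'; exact: (has_chart_transport (cont g) (cont _) FK GK SG hx).
Qed.

End Charts.

Definition active (T i : nat) : bool := nth 0%N (lam T) i != 0%N.
Definition aslots (T : nat) : seq nat := [seq i <- slots | active T i].
Definition sweights (T : nat) : seq weight := [seq w <- weights | hsup T w].
(** The dimension of the flag variety of the parabolic subgroup, a projective line for each active
    slot, plus that of the half space. *)
Definition cdim (T : nat) : nat := (size (aslots T) + size (sweights T))%N.

Lemma mem_aslots T i : (T < 8)%N -> (i \in aslots T) = active T i.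
Proof.
move=> T8; rewrite mem_filter; case: (boolP (active T i)) => //= ai.
have : (i < 4)%N.
  rewrite ltnNge; apply: contra ai => i4; rewrite /active nth_default ?eqxx //.
  by case: T T8 => [|[|[|[|[|[|[|[|]]]]]]]].
by case: i {ai} => [|[|[|[|]]]].
Qed.

Lemma mem_sweights T w : (w \in sweights T) = hsup T w.
Proof. by rewrite mem_filter mem_weights andbT. Qed.

Section RowCoordinates.
Variables (R : realType) (T : nat).
Hypothesis T8 : (T < 8)%N.

Definition rc d (r : 'rV[R]_d) (k : nat) : R := if insub k is Some i then r 0 i else 0.

Lemma rcE d (r : 'rV[R]_d) (i : 'I_d) : rc r i = r 0 i.
Proof. by rewrite /rc valK. Qed.

Lemma rc_continuous d k : continuous (fun r : 'rV[R]_d => rc r k).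
Proof.
rewrite /rc; case: insubP => [i _ _|_]; first exact: coord_continuous.
exact: cst_continuous.
Qed.

Definition rslot (r : 'rV[R]_(cdim T)) (i : nat) : R :=
  if active T i then rc r (index i (aslots T)) else 0.

Definition rvec (r : 'rV[R]_(cdim T)) (w : weight) : R :=
  if hsup T w then rc r (size (aslots T) + index w (sweights T)) else 0.

Definition pack (s : nat -> R) (v : weight -> R) : 'rV[R]_(cdim T) :=
  \row_j (if (j < size (aslots T))%N then s (nth 0%N (aslots T) j)
          else v (nth (true, true, true, true) (sweights T) (j - size (aslots T)))).

Lemma rslot_pack s v i : active T i -> rslot (pack s v) i = s i.
Proof.
move=> ai; rewrite /rslot ai; have ia : i \in aslots T by rewrite mem_aslots.
have il : (index i (aslots T) < size (aslots T))%N by rewrite index_mem.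
have ic : (index i (aslots T) < cdim T)%N by apply: leq_trans il (leq_addr _ _).
by rewrite -[index i _]/(val (Ordinal ic)) rcE mxE /= il nth_index.
Qed.

Lemma rvec_pack s v w : hsup T w -> rvec (pack s v) w = v w.
Proof.
move=> hw; rewrite /rvec hw; have wS : w \in sweights T by rewrite mem_sweights.
have ic : (size (aslots T) + index w (sweights T) < cdim T)%N.
  by rewrite ltn_add2l index_mem.
rewrite -[(_ + _)%N]/(val (Ordinal ic)) rcE mxE /=.
by rewrite ltnNge leq_addr /= addKn nth_index.
Qed.

Lemma packK r : pack (rslot r) (rvec r) = r.
Proof.
apply/rowP => j; rewrite mxE; case: ltnP => js.
  have jm := mem_nth 0%N js; rewrite /rslot -mem_aslots // jm index_uniq ?rcE //.
  by rewrite filter_uniq.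
have jS : (j - size (aslots T) < size (sweights T))%N.
  by rewrite ltn_subLR //; exact: ltn_ord.
have jm := mem_nth (true, true, true, true) jS.
rewrite /rvec -mem_sweights jm index_uniq ?subnKC ?rcE //.
by rewrite filter_uniq.
Qed.

Lemma rvec_supported r : supported (hsup T) (rvec r).
Proof. by apply/supportedP => w /negbTE wn; rewrite /rvec wn. Qed.

Lemma rslot_continuous i : continuous (fun r => rslot r i).
Proof. by rewrite /rslot; case: (active T i); [exact: rc_continuous|exact: cst_continuous]. Qed.

Lemma rvec_continuous w : continuous (fun r => rvec r w).
Proof. by rewrite /rvec; case: (hsup T w); [exact: rc_continuous|exact: cst_continuous]. Qed.

End RowCoordinates.

Section SameSigns.
Variable R : realType.
Implicit Types v : weight -> R.

Definition sign_polys T v : seq poly4 :=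
  invs T ++ (if (T == 3) && (evp v polyD < 0) then [:: q2; q3; q4] else [::]).

(** Equality of signs in the form of strict inequalities, visibly an open condition on [v]. *)
Definition same_signs T v0 v : bool :=
  all (fun p => 0 < evp v0 p * evp v p) (sign_polys T v0).

Lemma sgr_eq_pmul (a b : R) : 0 < a * b -> Num.sg a = Num.sg b.
Proof.
have [a0|a0|->] := ltrgt0P a; last by rewrite mul0r ltxx.
  by rewrite pmulr_rgt0 // => b0; rewrite !gtr0_sg.
by rewrite nmulr_rgt0 // => b0; rewrite !ltr0_sg.
Qed.

Lemma same_signs_gen T v0 v : supported (hsup T) v -> same_signs T v0 v ->
  gen T v /\ sgv T v = sgv T v0.
Proof.
rewrite /same_signs /sign_polys all_cat => vS /andP[/allP h1 h2].
have sg1 p : p \in invs T -> Num.sg (evp v0 p) = Num.sg (evp v p).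
  by move=> /h1 /sgr_eq_pmul.
split.
  rewrite /gen vS; apply/allP => p /h1; apply: contraTneq => ->.
  by rewrite mulr0 ltxx.
rewrite /sgv; congr (_ ++ _); first by apply/eq_in_map => p /sg1.
case: (eqVneq T 3) h1 h2 sg1 => [->|//] h1 h2 sg1.
have D : polyD \in invs 3 by rewrite inE.
rewrite -(sgr_lt0 (evp v _)) -(sg1 _ D) sgr_lt0.
move: h2; case: ifP => //= _ /and4P[/sgr_eq_pmul-> /sgr_eq_pmul-> /sgr_eq_pmul-> _] //.
Qed.

(** [polyD] is the discriminant of a form with leading coefficient [q]; were [q] zero, it would be a
    square and not negative. *)
Lemma q_neq0 v q : evp v polyD < 0 -> q \in [:: q2; q3; q4] -> evp v q != 0.
Proof.
move=> D qq.
suff [B [C E]] : exists B C, evp v polyD = B ^+ 2 - 4 * evp v q * C.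
  by apply: contraTneq D => q0; rewrite E q0 mulr0 mul0r subr0 -leNgt sqr_ge0.
move: qq; rewrite !inE => /or3P[]/eqP->; rewrite evp_minor2.
- by exists (sliceX v), (sliceM v); exact: evp_polyD.
- exists (v w(+ + + +) * v w(+ - - -) + v w(+ + - +) * v w(+ - + -)
    - v w(+ + + -) * v w(+ - - +) - v w(+ + - -) * v w(+ - + +)).
  exists (v w(+ + - +) * v w(+ - - -) - v w(+ + - -) * v w(+ - - +)).
  by rewrite /evp /evm /=; ring.
exists (v w(+ + + +) * v w(+ - - -) + v w(+ + + -) * v w(+ - - +)
    - v w(+ + - +) * v w(+ - + -) - v w(+ + - -) * v w(+ - + +)).
exists (v w(+ + + -) * v w(+ - - -) - v w(+ + - -) * v w(+ - + -)).
by rewrite /evp /evm /=; ring.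
Qed.

Lemma sgr_eq_pmulI (a b : R) : Num.sg b = Num.sg a -> a != 0 -> 0 < a * b.
Proof.
move=> E a0; have b0 : b != 0 by rewrite -sgr_eq0 E sgr_eq0.
rewrite lt_neqAle eq_sym mulf_neq0 //= -sgr_ge0 sgrM E.
by rewrite -expr2 sqr_ge0.
Qed.

Lemma gen_same_signs T v0 v : gen T v0 -> gen T v -> sgv T v = sgv T v0 -> same_signs T v0 v.
Proof.
move=> /andP[_ /allP g0] _; rewrite /sgv => E.
have [] : [seq Num.sg (evp v p) | p <- invs T] = [seq Num.sg (evp v0 p) | p <- invs T] /\
  (if (T == 3) && (evp v polyD < 0) then [seq Num.sg (evp v q) | q <- [:: q2; q3; q4]]
   else [::]) =
  (if (T == 3) && (evp v0 polyD < 0) then [seq Num.sg (evp v0 q) | q <- [:: q2; q3; q4]]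
   else [::]).
  have := congr1 (take (size (invs T))) E; have := congr1 (drop (size (invs T))) E.
  by rewrite !drop_size_cat ?size_map // !take_size_cat ?size_map.
move=> /eq_in_map e1 e2; apply/allP => p; rewrite mem_cat => /orP[pT|].
  by apply: sgr_eq_pmulI; [exact: e1|exact: g0].
case: (eqVneq T 3) e1 e2 => //= -> e1 e2; case: ifP => // D0 pq.
have D : polyD \in invs 3 by rewrite inE.
move: e2; rewrite D0 -(sgr_lt0 (evp v _)) (e1 _ D) sgr_lt0 D0 => e2.
apply: sgr_eq_pmulI; last exact: q_neq0.
by move: e2 pq => -[h2 h3 h4]; rewrite !inE => /or3P[]/eqP->.
Qed.

End SameSigns.

(** * The chart at a generic tensor, from abstract covariants *)

Section OrbitChart.
Variables (R : realType) (T : nat) (v0 : weight -> R).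
Variables (phi : nat -> (weight -> R) -> R) (kk : nat -> nat -> nat).
Hypotheses (T8 : (T < 8)%N) (v0g : gen T v0).
Hypothesis phic : forall i (A : Type) (F : set_system A) (FF : Filter F)
  (X : A -> weight -> R) (X0 : weight -> R),
  (forall w, (fun t => X t w) @ F --> X0 w) -> (fun t => phi i (X t)) @ F --> phi i X0.
(** The behaviour of the leading coefficient of a covariant whose value at [v] is a pure power: only
    the top left entries of the matrices enter. *)
Hypothesis phiE : forall i v g, active T i -> gen T v -> (forall j, det2 (g j) = 1) ->
  phi i (acts slots g v) = phi i v * ((g 0%N).1.1.1 ^+ kk i 0 * (g 1%N).1.1.1 ^+ kk i 1 *
    (g 2%N).1.1.1 ^+ kk i 2 * (g 3%N).1.1.1 ^+ kk i 3).
Hypothesis phi0 : forall i v, active T i -> gen T v -> phi i v != 0.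
Hypothesis kk1 : forall i, active T i -> (0 < kk i i <= 4)%N.

Definition low2 (s : R) : mat2 R := (1, 0, s, 1).

Lemma det_low2 s : det2 (low2 s) = 1.
Proof. by rewrite /det2 /= mul0r mulr1 subr0. Qed.

(* For a polynomial [t |-> phi i (sl i 1 t 0 1 y)] of degree at most 4, this is the
   five-point formula for the coefficient of [t]. *)
Definition numer i (y : weight -> R) : R :=
  (8 * (phi i (sl i 1 1 0 1 y) - phi i (sl i 1 (-1) 0 1 y)) -
   (phi i (sl i 1 2 0 1 y) - phi i (sl i 1 (-2) 0 1 y))) / 12.

Definition sigma (y : weight -> R) i : R :=
  if active T i then numer i y / ((kk i i)%:R * phi i y) else 0.

Lemma active_lt4 i : active T i -> (i < 4)%N.
Proof. by rewrite -mem_aslots // mem_filter => /andP[_]; case: i => [|[|[|[|]]]]. Qed.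

(** If a, c is the first column of [g i], a unipotent step [t] in slot [i] changes the leading
    coefficient to a constant times (a + t c)^k. Its coefficient of [t], divided by k times its
    value at 0, is c / a. *)
Lemma sigma_acts i v g : active T i -> gen T v -> (forall j, det2 (g j) = 1) ->
  phi i (acts slots g v) != 0 ->
  (g i).1.1.1 != 0 /\ sigma (acts slots g v) i = (g i).1.2 / (g i).1.1.1.
Proof.
move=> ai vg Dg pn; have i4 := active_lt4 ai; have /andP[k0 k4] := kk1 ai.
pose C := phi i v * \prod_(j <- slots | j != i) (g j).1.1.1 ^+ kk i j.
have fE t : phi i (sl i 1 t 0 1 (acts slots g v)) =
    C * ((g i).1.1.1 + t * (g i).1.2) ^+ kk i i.
  rewrite -[sl _ _ _ _ _ _]/(slm i (1, t, 0, 1) _) slm_slots // phiE //; last first.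
    by move=> j; case: eqP => // _; rewrite det2M Dg /det2 /=; ring.
  rewrite /C -[RHS]mulrA; congr (_ * _); rewrite /slots !big_cons big_nil.
  have mE j : (mul2 (1, t, 0, 1) (g j)).1.1.1 = (g j).1.1.1 + t * (g j).1.2.
    by case: (g j) => [[[a b] c] d] /=; rewrite mul1r.
  case: i i4 {ai pn k0 k4 C} => [|[|[|[|//]]]] _ /=; rewrite mE; ring.
have f0 : phi i (acts slots g v) = C * (g i).1.1.1 ^+ kk i i.
  by have := fE 0; rewrite sl1 mul0r addr0.
move: pn; rewrite f0 mulf_eq0 negb_or expf_eq0 k0 /= => /andP[C0 a0]; split=> //.
rewrite /sigma ai /numer !fE f0; clear fE f0; clearbody C.
move: (kk i i) k0 k4 (g i).1.1.1 (g i).1.2 a0 C0 => k k0 k4 a c a0 C0.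
case: k k0 k4 => [//|[|[|[|[|//]]]]] _ _; by field; rewrite ?a0 ?C0.
Qed.

Definition unlow (s : nat -> R) := acts slots (fun i => low2 (- s i)).
Definition dolow (s : nat -> R) := acts slots (fun i => low2 (s i)).

Lemma unlowK s y : unlow s (dolow s y) = y.
Proof.
rewrite /unlow /dolow -acts_mul (_ : (fun i => _) = fun=> (1, 0, 0, 1)).
  by rewrite /acts /= /slm /= !sl1.
by apply/funext => i; rewrite /low2 /=; congr (_, _, _, _); ring.
Qed.

Lemma dolowK s y : dolow s (unlow s y) = y.
Proof.
rewrite /unlow /dolow -acts_mul (_ : (fun i => _) = fun=> (1, 0, 0, 1)).
  by rewrite /acts /= /slm /= !sl1.
by apply/funext => i; rewrite /low2 /=; congr (_, _, _, _); ring.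
Qed.

Definition chart_dom : set (tensor4 R) := [set q | forall i, active T i -> phi i (co q) != 0].
Definition chart_cod : set 'rV[R]_(cdim T) := [set r | same_signs T v0 (rvec r)].
Definition chart_fun (q : tensor4 R) : 'rV[R]_(cdim T) :=
  pack T (sigma (co q)) (unlow (sigma (co q)) (co q)).
Definition chart_inv (r : 'rV[R]_(cdim T)) : tensor4 R := ten (dolow (rslot r) (rvec r)).

(** Removing the lower unipotent matrices with parameters [sigma] makes every active slot of [g]
    upper triangular, so the remaining matrices lie in the parabolic subgroup. *)
Lemma orbit_dom q : orbit4 (ten v0) q -> chart_dom q ->
  let u := unlow (sigma (co q)) (co q) in gen T u /\ sgv T u = sgv T v0.
Proof.
move=> /SL2_conjP; rewrite tenK => /cj_actsP[g Dg qE] qd /=.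
have gs i : active T i -> (g i).1.1.1 != 0 /\ sigma (co q) i = (g i).1.2 / (g i).1.1.1.
  by move=> ai; rewrite qE; apply: sigma_acts => //; rewrite -qE; exact: qd.
set s := sigma _ in gs *; rewrite qE /unlow -acts_mul.
have par i : (i < 4)%N -> parabolic T i (mul2 (low2 (- s i)) (g i)).
  move=> i4; split; first by rewrite det2M det_low2 Dg mulr1.
  case: (boolP (active T i)) => ai; last by right; apply/eqP; rewrite -[_ == _]negbK.
  left; have [a0 ->] := gs i ai; case: (g i) a0 => [[[a b] c] d] /= a0.
  by field.
by split; [exact: gen_acts|exact: sgv_acts].
Qed.

Lemma codP r : chart_cod r -> gen T (rvec r) /\ sgv T (rvec r) = sgv T v0.
Proof. by apply: same_signs_gen; exact: rvec_supported. Qed.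

Lemma phi_inv_neq0 r i : active T i -> chart_cod r ->
  phi i (dolow (rslot r) (rvec r)) != 0.
Proof.
move=> ai /codP[rg _]; rewrite phiE //; last by move=> j; exact: det_low2.
by rewrite /= !expr1n !mulr1 phi0.
Qed.

Lemma sigma_inv r : chart_cod r -> sigma (dolow (rslot r) (rvec r)) = rslot r.
Proof.
move=> rc; apply/funext => i; case: (boolP (active T i)) => ai; last first.
  by rewrite /sigma /rslot (negbTE ai).
have Dl j : det2 (low2 (rslot r j)) = 1 by exact: det_low2.
have [_ ->] := sigma_acts ai (codP rc).1 Dl (phi_inv_neq0 ai rc).
by rewrite /= divr1.
Qed.

Lemma open_dom : open chart_dom.
Proof.
pose D i := [set q : tensor4 R | active T i -> phi i (co q) != 0].
have H i : open (D i).
  rewrite /D.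
  case: (boolP (active T i)) => ai; last first.
    by rewrite (_ : mkset _ = setT); [exact: openT|apply/seteqP; split].
  rewrite (_ : mkset _ = (fun q : tensor4 R => phi i (co q)) @^-1` [set x | x != 0]).
    apply: open_comp; last exact: open_neq.
    move=> q _; apply: (@phic i _ (nbhs q) (nbhs_filter q) (fun q' => co q') (co q)) => w.
    exact: co_continuous.
  by apply/seteqP; split=> q /=; [apply|move=> ? _].
rewrite (_ : chart_dom = (D 0%N `&` D 1%N) `&` (D 2%N `&` D 3%N)).
  by apply: openI; apply: openI; exact: H.
apply/seteqP; split=> q /=; first by move=> h; do !split; exact: h.
move=> [[h0 h1] [h2 h3]] i ai; have i4 := active_lt4 ai; move: i4 ai.
by case: i => [|[|[|[|//]]]].
Qed.

Lemma open_cod : open chart_cod.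
Proof.
rewrite /chart_cod /same_signs; elim: (sign_polys T v0) => [|p s IH] /=.
  by rewrite (_ : mkset _ = setT); [exact: openT|apply/seteqP; split].
rewrite (_ : mkset _ = ((fun r => evp v0 p * evp (rvec r) p) @^-1` [set x | 0 < x]) `&`
    [set r | all (fun p => 0 < evp v0 p * evp (rvec r) p) s]).
  apply: openI => //; apply: open_comp; last exact: open_gt.
  move=> r _; have h : evp (rvec r') p @[r' --> r] --> evp (rvec r) p.
    by apply: (@cvg_evp R _ (nbhs r) (nbhs_filter r)) => w; exact: rvec_continuous.
  exact: (cvgM (cvg_cst _) h).
by apply/seteqP; split=> r /=; [case/andP|case=> -> ->].
Qed.

Lemma cvg_sigma q i : chart_dom q -> sigma (co q') i @[q' --> q] --> sigma (co q) i.
Proof.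
move=> Uq; have cst (c : R) : c @[q' --> q] --> c.
  by apply: cst_continuous.
rewrite /sigma; case: (boolP (active T i)) => ai; last exact: cst.
have cc w : co q' w @[q' --> q] --> co q w by exact: co_continuous.
have ce t : phi i (sl i 1 t 0 1 (co q')) @[q' --> q] --> phi i (sl i 1 t 0 1 (co q)).
  apply: (@phic i _ (nbhs q) (nbhs_filter q) (fun q' => sl i 1 t 0 1 (co q'))
    (sl i 1 t 0 1 (co q))) => w.
  exact: (@cvg_sl R _ (nbhs q) (nbhs_filter q) i (fun=> 1) (fun=> t) (fun=> 0) (fun=> 1)
    (fun q' => co q') _ _ _ _ _ (cst _) (cst _) (cst _) (cst _) cc).
have k0 : (kk i i)%:R * phi i (co q) != 0.
  by have /andP[k0 _] := kk1 ai; rewrite mulf_neq0 ?Uq // pnatr_eq0 -lt0n.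
have cphi := @phic i _ (nbhs q) (nbhs_filter q) (fun q' => co q') (co q) cc.
apply: (cvgM _ (cvgV k0 (cvgM (cst _) cphi))).
apply: (cvgM _ (cst _)); apply: (cvgB (cvgM (cst _) (cvgB (ce _) (ce _))) (cvgB (ce _) (ce _))).
Qed.

Lemma base_chart : has_chart R (orbit4 (ten v0)) (cdim T) (ten v0).
Proof.
exists chart_dom, chart_cod, chart_fun, chart_inv.
split; [split|split; [split|split]].
- exact: open_dom.
- by move=> i ai; rewrite tenK phi0.
- exact: open_cod.
- move=> q [Sq Uq]; have [ug us] := orbit_dom Sq Uq.
  rewrite /chart_cod /= /chart_fun (_ : rvec _ = unlow (sigma (co q)) (co q)).
    exact: gen_same_signs.
  apply/funext => w; case: (boolP (hsup T w)) => hw; first by rewrite rvec_pack.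
  have /andP[uS _] := ug.
  by rewrite (supportedP _ _ uS) // /rvec (negbTE hw).
- move=> r rc; have [rg rs] := codP rc; split; last first.
    by move=> i ai; rewrite /chart_inv tenK phi_inv_neq0.
  (* The chart stays in the orbit because generic tensors with equal signs are conjugate. *)
  apply/SL2_conjP; rewrite /chart_inv !tenK.
  apply: (cj_trans (gen_sgv_cj T8 v0g rg (esym rs))).
  by apply: cj_acts => // i; exact: det_low2.
- move=> q [Sq Uq]; have [ug us] := orbit_dom Sq Uq.
  rewrite /chart_inv /chart_fun.
  have -> : rvec (pack T (sigma (co q)) (unlow (sigma (co q)) (co q))) =
      unlow (sigma (co q)) (co q).
    apply/funext => w; case: (boolP (hsup T w)) => hw; first by rewrite rvec_pack.
    have /andP[uS _] := ug.
    by rewrite (supportedP _ _ uS) // /rvec (negbTE hw).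
  have -> : rslot (pack T (sigma (co q)) (unlow (sigma (co q)) (co q))) = sigma (co q).
    apply/funext => i; case: (boolP (active T i)) => ai; first by rewrite rslot_pack.
    by rewrite /rslot /sigma (negbTE ai).
  by rewrite dolowK coK.
- move=> r rc; rewrite /chart_fun /chart_inv tenK sigma_inv // unlowK.
  exact: packK.
- move=> q Uq; apply: (@cvg_mx R _ (nbhs q)) => i j; rewrite mxE.
  rewrite /chart_fun; under eq_fun do rewrite mxE.
  case: ifP => _; first exact: cvg_sigma.
  apply: (@cvg_acts R _ (nbhs q) _ (fun q' => (fun i => low2 (- sigma (co q') i)))
    (fun i => low2 (- sigma (co q) i)) (fun q' => co q')) => [k|w]; last exact: co_continuous.
  by split; try exact: cvg_cst; apply: cvgN; exact: cvg_sigma.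
move=> r rc; apply: (@cvg_ten R _ (nbhs r) _ (fun r' => dolow (rslot r') (rvec r'))
  (dolow (rslot r) (rvec r))).
apply: (@cvg_acts R _ (nbhs r) _ (fun r' => (fun i => low2 (rslot r' i)))
  (fun i => low2 (rslot r i)) (fun r' => rvec r')) => [k|w]; last exact: rvec_continuous.
by split; try exact: cvg_cst; exact: rslot_continuous.
Qed.

End OrbitChart.

(** * Covariants *)

Section PermutedActs.
Variable K : comPzRingType.
Implicit Types (g : nat -> mat2 K) (x : weight -> K).

Lemma acts_cat s t g x : acts (s ++ t) g x = acts s g (acts t g x).
Proof. exact: foldr_cat. Qed.

Lemma acts_perm s t g x : uniq s -> all (gtn 4%N) s -> perm_eq s t -> acts s g x = acts t g x.
Proof.
elim: s t => [|i s IH] t /=; first by move=> _ _; rewrite perm_sym => /perm_nilP ->.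
move=> /andP[si us] /andP[i4 s4] st.
have it : i \in t by rewrite -(perm_mem st) mem_head.
case/splitPr: it st => t1 t2 st.
have st' : perm_eq s (t1 ++ t2).
  by rewrite -(perm_cons i) (perm_trans st) // perm_sym -cat1s perm_catCA.
have i12 : i \notin t1 ++ t2 by rewrite -(perm_mem st').
have all4 : all (gtn 4%N) (t1 ++ t2) by rewrite -(perm_all _ st').
rewrite (IH _ us s4 st') !acts_cat /=.
move: i12 all4; rewrite mem_cat all_cat negb_or => /andP[i1 _] /andP[a1 _].
by rewrite slm_acts.
Qed.

Lemma acts_pw p g x : p \in S4 ->
  acts slots g x \o pw p = acts slots (fun j => g (index j p)) (x \o pw p).
Proof.
move=> pS.
have H : all (fun p => [&& uniq p, all (gtn 4%N) p, perm_eq p slots &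
   [:: nth 0 p 0; nth 0 p 1; nth 0 p 2; nth 0 p 3] == p]%N) S4 by vm_compute.
have /and4P[up p4 pp /eqP pE] := allP H p pS.
have ix i : (i < 4)%N -> index (nth 0%N p i) p = i.
  by move=> i4; rewrite index_uniq // (perm_size pp).
transitivity (acts [:: nth 0 p 0; nth 0 p 1; nth 0 p 2; nth 0 p 3]%N
  (fun j => g (index j p)) (x \o pw p)).
  by rewrite [in RHS]/acts [in RHS]/foldr !ix // /acts /= /slm !sl_pw.
by rewrite pE; exact: acts_perm.
Qed.

End PermutedActs.

Section Covariants.
Variable R : realType.
Implicit Types v y z : weight -> R.

Definition polyL : poly4 := [:: (1%Z, [:: w(+ + + +)])].

Definition basep (b : nat) : poly4 := nth [::] [:: polyL; polyB; polyD] b.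
Definition basek (b : nat) : seq nat :=
  nth [::] [:: [:: 1; 1; 1; 1]; [:: 2; 2; 0; 0]; [:: 4; 0; 0; 0]]%N b.

(* The covariant attached to the slot [i] of the standard type [T] is the leading
   coefficient of: the tensor itself (0), the determinant of the contraction of two slots
   (1), or the hyperdeterminant of three slots (2), after a slot permutation. For type 7
   and slot 0 the Hessian of the quartic of kind (2) is used instead (3). *)
Definition covd (T i : nat) : nat * seq nat := nth (0%N, [::]) (nth [::] [::
  [:: (0, [:: 0; 1; 2; 3]); (0, [:: 0; 1; 2; 3]); (0, [:: 0; 1; 2; 3]); (0, [:: 0; 1; 2; 3])];
  [:: (1, [:: 0; 1; 2; 3]); (1, [:: 0; 1; 2; 3])];
  [:: (1, [:: 0; 1; 2; 3]); (1, [:: 0; 1; 2; 3]); (1, [:: 0; 2; 1; 3]); (1, [:: 0; 2; 3; 1])];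
  [:: (2, [:: 0; 1; 2; 3])];
  [:: (1, [:: 0; 1; 2; 3]); (1, [:: 0; 1; 2; 3]); (1, [:: 2; 3; 0; 1]); (1, [:: 2; 3; 0; 1])];
  [:: (2, [:: 0; 1; 2; 3]); (2, [:: 1; 0; 2; 3]); (1, [:: 2; 3; 0; 1]); (1, [:: 2; 3; 0; 1])];
  [:: (2, [:: 0; 1; 2; 3]); (2, [:: 1; 0; 2; 3]); (2, [:: 1; 2; 0; 3])];
  [:: (3, [:: 0; 1; 2; 3]); (2, [:: 1; 0; 2; 3]); (2, [:: 1; 2; 0; 3]); (2, [:: 1; 2; 3; 0])]
  ]%N T) i.

Definition quartic y (t : R) : R := evp (sl 0 1 t 0 1 y) polyD.

(** This and [quartic2] are the coefficients of [t] and [t ^+ 2] in [quartic y t], by five-point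
    formulas exact in degree 4. *)
Definition quartic1 y : R :=
  (8 * (quartic y 1 - quartic y (-1)) - (quartic y 2 - quartic y (-2))) / 12.

Definition quartic2 y : R := (16 * (quartic y 1 + quartic y (-1)) -
  (quartic y 2 + quartic y (-2)) - 30 * quartic y 0) / 24.

(** A third of the leading coefficient of the Hessian determinant of the binary quartic a x^4 + b
    x^3 y + c x^2 y^2 + ..., namely 8 a c - 3 b^2. *)
Definition hessian y : R :=
  8 * quartic y 0 * quartic2 y - 3 * (quartic1 y * quartic1 y).

Definition cov (T i : nat) y : R :=
  if (covd T i).1 == 3%N then hessian y
  else evp (y \o pw (covd T i).2) (basep (covd T i).1).

Definition cove (T i j : nat) : nat :=
  if (covd T i).1 == 3%N then nth 0%N [:: 4; 0; 0; 0]%N j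
  else nth 0%N (basek (covd T i).1) (nth 0%N (covd T i).2 j).

Lemma cov_cvg T i (A : Type) (F : set_system A) (FF : Filter F)
    (X : A -> weight -> R) (X0 : weight -> R) :
  (forall w, (fun t => X t w) @ F --> X0 w) -> (fun t => cov T i (X t)) @ F --> cov T i X0.
Proof.
move=> hX; rewrite /cov; case: eqP => _; last by apply: cvg_evp => w; exact: hX.
have hq t : (fun a => quartic (X a) t) @ F --> quartic X0 t.
  by apply: cvg_evp => w; apply: cvg_sl => //; exact: cvg_cst.
have c (r : R) : (fun=> r) @ F --> r by exact: cvg_cst.
have d1 : (fun a => quartic1 (X a)) @ F --> quartic1 X0.
  exact: (cvgM (cvgB (cvgM (c 8) (cvgB (hq 1) (hq (-1)))) (cvgB (hq 2) (hq (-2)))) (c 12^-1)).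
have d2 : (fun a => quartic2 (X a)) @ F --> quartic2 X0.
  exact: (cvgM (cvgB (cvgB (cvgM (c 16) (cvgD (hq 1) (hq (-1)))) (cvgD (hq 2) (hq (-2))))
    (cvgM (c 30) (hq 0))) (c 24^-1)).
exact: (cvgB (cvgM (cvgM (c 8) (hq 0)) d2) (cvgM (c 3) (cvgM d1 d1))).
Qed.

Lemma polyB_inv j (g : mat2 R) z : j \in [:: 2; 3]%N -> det2 g = 1 ->
  evp (slm j g z) polyB = evp z polyB.
Proof.
case: g => [[[a b] c] d]; rewrite /det2 /= !inE => h D.
rewrite !evp_polyB -[RHS]mul1r -D /slm /sl.
by case/orP: h => /eqP-> /=; ring.
Qed.

Lemma polyD_inv j (g : mat2 R) z : j \in [:: 1; 2; 3]%N -> det2 g = 1 ->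
  evp (slm j g z) polyD = evp z polyD.
Proof.
case: g => [[[a b] c] d]; rewrite /det2 /= !inE => h D.
rewrite -[RHS]mul1r -(expr1n _ 2) -D /evp /evm /slm /sl.
by case/or3P: h => /eqP-> /=; ring.
Qed.

Lemma polyB_acts (g : nat -> mat2 R) z : (forall j, det2 (g j) = 1) ->
  evp (acts slots g z) polyB = evp (slm 0 (g 0%N) (slm 1 (g 1%N) z)) polyB.
Proof.
move=> Dg; rewrite (@acts_perm _ slots [:: 2; 3; 0; 1]%N) //.
by rewrite /= polyB_inv // polyB_inv.
Qed.

Lemma polyD_acts (g : nat -> mat2 R) z : (forall j, det2 (g j) = 1) ->
  evp (acts slots g z) polyD = evp (slm 0 (g 0%N) z) polyD.
Proof.
move=> Dg; rewrite (@acts_perm _ slots [:: 1; 2; 3; 0]%N) //.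
by rewrite /= polyD_inv // polyD_inv // polyD_inv.
Qed.

Lemma polyB_cov p x (g : nat -> mat2 R) : p \in S4 -> (forall j, det2 (g j) = 1) ->
  (forall h k, evp (slm 0 h (slm 1 k (x \o pw p))) polyB =
     (h.1.1.1 * k.1.1.1) ^+ 2 * evp (x \o pw p) polyB) ->
  evp (acts slots g x \o pw p) polyB =
  ((g (index 0%N p)).1.1.1 * (g (index 1%N p)).1.1.1) ^+ 2 * evp (x \o pw p) polyB.
Proof. by move=> pS Dg h; rewrite acts_pw // polyB_acts ?h. Qed.

Lemma polyD_cov p x (g : nat -> mat2 R) : p \in S4 -> (forall j, det2 (g j) = 1) ->
  (forall h, evp (slm 0 h (x \o pw p)) polyD = h.1.1.1 ^+ 4 * evp (x \o pw p) polyD) ->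
  evp (acts slots g x \o pw p) polyD =
  (g (index 0%N p)).1.1.1 ^+ 4 * evp (x \o pw p) polyD.
Proof. by move=> pS Dg h; rewrite acts_pw // polyD_acts ?h. Qed.

(** On the half space of type 7 the quartic is x^3 (Q x + L y). Its leading coefficient Q vanishes
    at the normal forms, but the Hessian is proportional to L^2 x^4, and L is nonzero for generic
    tensors. *)
Lemma hessian_acts v (g : nat -> mat2 R) : (forall j, det2 (g j) = 1) ->
  supported (hsup 7) v -> hessian (acts slots g v) = hessian v * (g 0%N).1.1.1 ^+ 4 /\
  hessian v = - 48 * (v w(- + + +) * v w(+ + - -) * v w(+ - + -) * v w(+ - - +)) ^+ 2.
Proof.
move=> Dg /supported_restr vE.
pose L := 4 * (v w(- + + +) * v w(+ + - -) * v w(+ - + -) * v w(+ - - +)).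
pose Q := evp v polyD.
have E a b c d : evp (slm 0 (a, b, c, d) v) polyD = a ^+ 4 * Q + a ^+ 3 * b * L.
  by rewrite /L /Q vE /evp /evm /slm /sl /restr /=; ring.
have qE t : quartic (acts slots g v) t =
    ((g 0%N).1.1.1 + t * (g 0%N).1.2) ^+ 4 * Q +
    ((g 0%N).1.1.1 + t * (g 0%N).1.2) ^+ 3 * ((g 0%N).1.1.2 + t * (g 0%N).2) * L.
  rewrite -(E _ _ (g 0%N).1.2 (g 0%N).2) /quartic -[sl _ _ _ _ _ _]/(slm 0 (1, t, 0, 1) _).
  rewrite slm_slots // polyD_acts.
    rewrite /=; congr (evp (slm 0 _ v) polyD).
    by case: (g 0%N) => [[[a b] c] d] /=; congr (_, _, _, _); ring.
  by move=> j; case: eqP => // _; rewrite det2M Dg /det2 /=; ring.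
have q0 t : quartic v t = Q + t * L.
  rewrite /quartic -[sl _ _ _ _ _ _]/(slm 0 (1, t, 0, 1) _) E; ring.
have HL : hessian v = - 3 * L ^+ 2.
  by rewrite /hessian /quartic2 /quartic1 !q0; field.
split; last by rewrite HL /L; ring.
rewrite HL /hessian /quartic2 /quartic1 !qE; have := Dg 0%N.
case: (g 0%N) => [[[a b] c] d]; rewrite /det2 /= => D.
transitivity (- 3 * L ^+ 2 * a ^+ 4 * (a * d - b * c) ^+ 2); first by field.
by rewrite D expr1n mulr1.
Qed.

Lemma cov_acts T i v g : (T < 8)%N -> active T i -> gen T v -> (forall j, det2 (g j) = 1) ->
  cov T i (acts slots g v) = cov T i v * ((g 0%N).1.1.1 ^+ cove T i 0 *
    (g 1%N).1.1.1 ^+ cove T i 1 * (g 2%N).1.1.1 ^+ cove T i 2 * (g 3%N).1.1.1 ^+ cove T i 3).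
Proof.
move=> T8 ai /andP[vS _] Dg; have i4 := active_lt4 T8 ai; move: vS.
case: T T8 i ai i4 => [|[|[|[|[|[|[|[|//]]]]]]]] _ [|[|[|[|//]]]] // _ _ vS;
  rewrite /cov /cove /= -/(acts slots g v) /basep /=.
all: match goal with
  | |- context [hessian] => rewrite (hessian_acts Dg vS).1; ring
  | |- context [polyB] => rewrite (supported_restr vS) polyB_cov //; [by rewrite /=; ring|];
      by move=> [[[? ?] ?] ?] [[[? ?] ?] ?]; rewrite !evp_polyB /slm /sl /restr /=; ring
  | |- context [polyD] => rewrite (supported_restr vS) polyD_cov //; [by rewrite /=; ring|];
      by move=> [[[? ?] ?] ?]; rewrite /evp /evm /slm /sl /restr /=; ring
  | |- _ => idtac
  end.
all: by rewrite (supported_restr vS) /acts /= pw_id /evp /evm /slm /sl /restr /=; ring.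
Qed.

End Covariants.

Section CovariantsNonzero.
Variable R : realType.
Implicit Types v : weight -> R.

(** On the half space each covariant collapses to factors that genericity makes nonzero; for type 6
    it is the square of the 2x2 minor that avoids the slot. *)
Lemma cov_neq0 T i v : (T < 8)%N -> active T i -> gen T v -> cov T i v != 0.
Proof.
move=> T8 ai /andP[vS]; have i4 := active_lt4 T8 ai.
have neg (r s : R) : r = - s -> s != 0 -> r != 0 by move=> ->; rewrite oppr_eq0.
have sqr (r s : R) : r = s ^+ 2 -> s != 0 -> r != 0 by move=> -> s0; rewrite expf_neq0.
have eqn (r s : R) : r = s -> s != 0 -> r != 0 by move=> ->.
case: T T8 vS ai => [|[|[|[|[|[|[|[|//]]]]]]]] _ vS ai; rewrite {1}/invs; cbn [nth all];
  rewrite andbT.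
- rewrite (evp_mono2 _ w(+ + + +) w(+ + + +)) mulf_eq0 orbb => c0.
  case: i i4 {ai} => [|[|[|[|//]]]] _; rewrite /cov /= pw_id /basep /=;
  by apply: (eqn _ (v w(+ + + +))) => //; rewrite /evp /evm /=; ring.
- by case: i i4 ai => [|[|[|[|//]]]] _ // _; rewrite /cov /= pw_id.
- rewrite !evp_mono2 => /neq0_mul3[b2 b3 b4].
  case: i i4 {ai} => [|[|[|[|//]]]] _; rewrite /cov /= /basep /= evp_polyB (supported_restr vS)
    /restr /=.
  + by apply: (neg _ (v w(+ + - +) * v w(+ + + -))); [ring|rewrite mulf_neq0].
  + by apply: (neg _ (v w(+ + - +) * v w(+ + + -))); [ring|rewrite mulf_neq0].
  + by apply: (neg _ (v w(+ - + +) * v w(+ + + -))); [ring|rewrite mulf_neq0].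
  by apply: (neg _ (v w(+ - + +) * v w(+ + - +))); [ring|rewrite mulf_neq0].
- by case: i i4 ai => [|[|[|[|//]]]] _ // _; rewrite /cov /= pw_id.
- rewrite !evp_mono2 !mulf_eq0 !negb_or => /and3P[/andP[b1 b2] /andP[_ b3] /andP[_ b4]].
  case: i i4 {ai} => [|[|[|[|//]]]] _; rewrite /cov /= /basep /= evp_polyB (supported_restr vS)
    /restr /=.
  + by apply: (neg _ (v w(+ + - +) * v w(+ + + -))); [ring|rewrite mulf_neq0].
  + by apply: (neg _ (v w(+ + - +) * v w(+ + + -))); [ring|rewrite mulf_neq0].
  + by apply: (neg _ (v w(- + + +) * v w(+ - + +))); [ring|rewrite mulf_neq0].
  by apply: (neg _ (v w(- + + +) * v w(+ - + +))); [ring|rewrite mulf_neq0].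
- rewrite !evp_mono2 => /neq0_mul3[b1 b2 b3].
  case: i i4 {ai} => [|[|[|[|//]]]] _; rewrite /cov /= /basep /= (supported_restr vS).
  + apply: (sqr _ (v w(+ - + +) * v w(+ + - -))); last by rewrite mulf_neq0.
    by rewrite /evp /evm /restr /=; ring.
  + apply: (sqr _ (v w(- + + +) * v w(+ + - -))); last by rewrite mulf_neq0.
    by rewrite /evp /evm /restr /=; ring.
  + rewrite evp_polyB /restr /=.
    by apply: (neg _ (v w(- + + +) * v w(+ - + +))); [ring|rewrite mulf_neq0].
  rewrite evp_polyB /restr /=.
  by apply: (neg _ (v w(- + + +) * v w(+ - + +))); [ring|rewrite mulf_neq0].
- rewrite !evp_minor2 => /and3P[d12 d13 d23].
  case: i i4 ai => [|[|[|[|//]]]] _ // _; rewrite /cov /= /basep /= (supported_restr vS).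
  + by apply: sqr d23; rewrite /evp /evm /restr /=; ring.
  + by apply: sqr d13; rewrite /evp /evm /restr /=; ring.
  by apply: sqr d12; rewrite /evp /evm /restr /=; ring.
rewrite !evp_mono2 !mulf_eq0 !negb_or => /and3P[/andP[b1 b2] /andP[_ b3] /andP[_ b4]].
case: i i4 {ai} => [|[|[|[|//]]]] _; rewrite /cov /= /basep /=.
- have I (j : nat) : det2 ((fun _ : nat => (1, 0, 0, 1) : mat2 R) j) = 1.
    by rewrite /det2 /=; ring.
  rewrite (hessian_acts I vS).2.
  by rewrite mulf_neq0 ?oppr_eq0 ?pnatr_eq0 // expf_neq0 // !mulf_neq0.
- apply: (sqr _ (v w(- + + +) * v w(+ + - -))); last by rewrite mulf_neq0.
  by rewrite (supported_restr vS) /evp /evm /restr /=; ring.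
- apply: (sqr _ (v w(- + + +) * v w(+ - + -))); last by rewrite mulf_neq0.
  by rewrite (supported_restr vS) /evp /evm /restr /=; ring.
apply: (sqr _ (v w(- + + +) * v w(+ - - +))); last by rewrite mulf_neq0.
by rewrite (supported_restr vS) /evp /evm /restr /=; ring.
Qed.

Lemma cove_bound T i : (T < 8)%N -> active T i -> (0 < cove T i i <= 4)%N.
Proof.
have H : all (fun T => all (fun i => active T i ==> (0 < cove T i i <= 4)%N) slots) (iota 0 8).
  by vm_compute.
move=> T8 ai; have Ti : T \in iota 0 8 by rewrite mem_iota.
have i4 := active_lt4 T8 ai.
have is4 : i \in slots by case: i i4 {ai} => [|[|[|[|]]]].
exact: (implyP (allP (allP H T Ti) i is4)).
Qed.

Lemma orbit_chart T v : (T < 8)%N -> gen T v ->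
  has_chart R (orbit4 (ten v)) (cdim T) (ten v).
Proof.
move=> T8 vg; apply: (@base_chart R T v (cov T) (cove T)) => //.
- by move=> i A F FF X X0; exact: cov_cvg.
- by move=> i z g ai zg Dg; exact: cov_acts.
- by move=> i z ai zg; exact: cov_neq0.
by move=> i; exact: cove_bound.
Qed.

Lemma SL2_conj_sym (x y : tensor4 R) : SL2_conj x y -> SL2_conj y x.
Proof. by move/SL2_conjP => h; apply/SL2_conjP; exact: cj_sym. Qed.

Lemma SL2_conj_trans (x y z : tensor4 R) : SL2_conj x y -> SL2_conj y z -> SL2_conj x z.
Proof. by move=> /SL2_conjP h /SL2_conjP k; apply/SL2_conjP; exact: cj_trans h k. Qed.

(** The representative is conjugate to a standard generic tensor only up to a slot permutation, but
    such a permutation is a linear homeomorphism that carries orbits to orbits. *)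
Lemma fam_manifold k r : (k < 30)%N -> r \in sfam k ->
  manifold_of_dim R (orbit4 (trep R r)) (cdim (key_type k)).
Proof.
move=> k30 rk; have [Tk pk] := key_typeP k30; set T := key_type k in Tk *.
set p := key_perm k in pk *.
have c := cj_rtens_std R k r pk; rewrite -/p in c.
have g : gen T (intt R (srep_std k r)) by rewrite gen_intt; exact: srep_std_gen.
have [q qS qp] := S4_inv pk; have [q' q'S q'p] := S4_inv qS.
(* [pw q] is a left inverse of [pw p] and has a left inverse itself, so it is a two-sided
   inverse. *)
have pq : pw p \o pw q = id.
  rewrite -[LHS]/(id \o (pw p \o pw q)) -q'p.
  by rewrite -compA (compA (pw q)) qp /= q'p.
pose F (x : tensor4 R) : tensor4 R := ten (co x \o pw q).
pose G (x : tensor4 R) : tensor4 R := ten (co x \o pw p).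
have FK : cancel F G by move=> x; rewrite /F /G tenK -compA qp coK.
have GK : cancel G F by move=> x; rewrite /F /G tenK -compA pq coK.
have Fc : continuous F.
  move=> x; apply: (@cvg_ten R _ (nbhs x) _ (fun y => co y \o pw q) (co x \o pw q)) => w.
  exact: co_continuous.
have Gc : continuous G.
  move=> x; apply: (@cvg_ten R _ (nbhs x) _ (fun y => co y \o pw p) (co x \o pw p)) => w.
  exact: co_continuous.
set z := intt R (srep_std k r) in g *.
have rz : SL2_conj (trep R r) (F (ten z)).
  apply/SL2_conjP; rewrite /F /trep !tenK; apply: (cj_pwI pk).
  by rewrite -compA qp; exact: c.
have SS x : orbit4 (trep R r) x <-> orbit4 (ten z) (G x).
  split=> [/SL2_conjP h|/SL2_conjP h]; apply/SL2_conjP; move: h; rewrite /G /trep !tenK => h.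
    exact: cj_trans (cj_sym c) (cj_pw pk h).
  by apply: (cj_pwI pk); exact: cj_trans c h.
have ch := has_chart_transport Fc Gc FK GK SS (orbit_chart Tk g).
apply: has_chart_manifold => y ry; apply: act4_transport ch.
  by move=> a b ab ra; exact: SL2_conj_trans ra ab.
exact: SL2_conj_trans (SL2_conj_sym rz) ry.
Qed.

Lemma cdim_fdims k : (k < 30)%N -> cdim (key_type k) = nth 0%N fdims k.
Proof.
have H : all (fun k => cdim (key_type k) == nth 0%N fdims k) (iota 0 30) by vm_compute.
by move=> k30; apply/eqP; apply: (allP H); rewrite mem_iota.
Qed.

End CovariantsNonzero.

(** * Classification *)

Definition allreps : seq srep := flatten [seq sfam k | k <- iota 0 30].

Lemma mem_allreps r : r \in allreps -> exists2 k, (k < 30)%N & r \in sfam k.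
Proof.
by case/flatten_mapP => k; rewrite mem_iota => /andP[_ k30] rk; exists k.
Qed.

Lemma sfam_allreps k r : (k < 30)%N -> r \in sfam k -> r \in allreps.
Proof. by move=> k30 rk; apply/flatten_mapP; exists k; rewrite ?mem_iota. Qed.

Lemma nilp_repsE (K : fieldType) : nilp_reps K = map (trep K) allreps.
Proof.
rewrite /nilp_reps nilp_familiesE -map_comp /allreps map_flatten -map_comp.
by congr flatten; apply: eq_map.
Qed.

Lemma nth_familiesE (K : fieldType) k : (k < 30)%N ->
  nth (0%N, [::]) (nilp_families K) k = (nth 0%N fdims k, map (trep K) (sfam k)).
Proof.
by move=> k30; rewrite nilp_familiesE (nth_map 0%N) ?size_iota // nth_iota.
Qed.

Lemma famE (K : fieldType) k : (k < 30)%N -> fam K k = map (trep K) (sfam k).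
Proof. by move=> k30; rewrite /fam nth_familiesE. Qed.

Lemma fam_dimE (K : fieldType) k : (k < 30)%N -> fam_dim K k = nth 0%N fdims k.
Proof. by move=> k30; rewrite /fam_dim nth_familiesE. Qed.

Lemma size_allreps : size allreps = 145%N. Proof. by vm_compute. Qed.

Lemma uniq_allreps : uniq allreps. Proof. by vm_compute. Qed.

Section Main.
Variable R : realType.

Lemma trep_conjP (K : fieldType) r r' :
  SL2_conj (trep K r) (trep K r') <-> cj (rtens K r) (rtens K r').
Proof. by rewrite SL2_conjP /trep !tenK. Qed.

Lemma complexify_trep r : complexify4 (trep R r) = trep R[i] r.
Proof.
have E (x : tensor4 R) w : co (complexify4 x) w = real_complex R (co x w).
  by rewrite /co /complexify4 mxE.
apply: co_inj; apply/funext => w; rewrite E /trep [in LHS]tenK [in RHS]tenK.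
by rewrite (rtens_intt R) (rtens_intt R[i]) /intt; exact: rmorph_int.
Qed.

Lemma trep_nilpotent r : r \in allreps -> trep R r <> 0 /\ nilpotent4 (trep R r).
Proof.
move=> /mem_allreps[k k30 rk]; have [rn r0] := rtens_null R k30 rk.
by split; [apply/co_nonzero|apply/nilpotent4P]; rewrite tenK.
Qed.

Lemma trep_complete (x : tensor4 R) : x <> 0 -> nilpotent4 x ->
  exists2 r, r \in allreps & SL2_conj x (trep R r).
Proof.
move=> /co_nonzero x0 /nilpotent4P /null_good/(_ x0)[T [p [y [T8 pS xy yg]]]].
have [k [r [k30 rk yr]]] := rep_complete T8 pS yg.
exists r; first exact: sfam_allreps rk.
by apply/SL2_conjP; rewrite tenK; exact: cj_trans xy yr.
Qed.

Lemma trep_conj_inj r r' : r \in allreps -> r' \in allreps ->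
  SL2_conj (trep R r) (trep R r') -> r = r'.
Proof.
move=> /mem_allreps[k k30 rk] /mem_allreps[l l30 r'l] /trep_conjP rr'.
have kl := rep_family k30 l30 rk r'l rr'; rewrite -kl in r'l.
exact: rep_inj k30 rk r'l rr'.
Qed.

Lemma nilp_orbitsE : nilp_orbits R =
  [set orbit4 (nth 0 (nilp_reps R) i) | i in `I_145].
Proof.
apply/seteqP; split=> [A [x [x0 xn ->]]|A [i i145 <-]].
  have [r rA xr] := trep_complete x0 xn.
  have ri : (index r allreps < size allreps)%N by rewrite index_mem.
  exists (index r allreps); first by rewrite size_allreps in ri.
  rewrite nilp_repsE (nth_map [::]) // nth_index //.
  apply/seteqP; split=> y.
    by move=> ry; exact: SL2_conj_trans xr ry.
  by move=> xy; exact: SL2_conj_trans (SL2_conj_sym xr) xy.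
exists (nth 0 (nilp_reps R) i).
have [|y0 yn] := @trep_nilpotent (nth [::] allreps i).
  by rewrite mem_nth ?size_allreps.
by rewrite nilp_repsE (nth_map [::]) ?size_allreps.
Qed.

Lemma reps_conj_inj i j : (i < 145)%N -> (j < 145)%N ->
  SL2_conj (nth 0 (nilp_reps R) i) (nth 0 (nilp_reps R) j) -> i = j.
Proof.
rewrite -size_allreps => i145 j145; rewrite nilp_repsE !(nth_map [::]) // => ij.
have := trep_conj_inj (mem_nth _ i145) (mem_nth _ j145) ij.
by move/eqP; rewrite nth_uniq ?uniq_allreps // => /eqP.
Qed.

End Main.

Theorem mainTheorem1 (R : realType) :
  (* exactly 145 nonzero nilpotent orbits *)
  (nilp_orbits R #= `I_145)%card /\
  (* a complete and irredundant list of representatives, in 30 families *)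
  size (nilp_families R) = 30%N /\
  size (nilp_reps R) = 145%N /\
  (forall x : tensor4 R, x \in nilp_reps R -> x <> 0 /\ nilpotent4 x) /\
  (forall x : tensor4 R, x <> 0 -> nilpotent4 x ->
     exists2 y : tensor4 R, y \in nilp_reps R & SL2_conj x y) /\
  (forall i j : nat, (i < 145)%N -> (j < 145)%N ->
     SL2_conj (nth 0 (nilp_reps R) i) (nth 0 (nilp_reps R) j) -> i = j) /\
  (* complex conjugacy *)
  (forall (k l : nat) (x y : tensor4 R), (k < 30)%N -> (l < 30)%N ->
     x \in fam R k -> y \in fam R l ->
     (SL2_conj (complexify4 x) (complexify4 y) <-> k = l)) /\
  (* dimensions *)
  (forall (k : nat) (x : tensor4 R), (k < 30)%N -> x \in fam R k ->
     manifold_of_dim R (orbit4 x) (fam_dim R k)).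
Proof.
split.
  rewrite nilp_orbitsE; apply: inj_card_eq => i j; rewrite !inE => i145 j145 E.
  apply: (@reps_conj_inj R) => //.
  have : orbit4 (nth 0 (nilp_reps R) j) (nth 0 (nilp_reps R) j).
    by apply/SL2_conjP; exact: cj_refl.
  by rewrite -E.
split; first by rewrite nilp_familiesE size_map size_iota.
split; first by rewrite nilp_repsE size_map size_allreps.
split; first by move=> x; rewrite nilp_repsE => /mapP[r rA ->]; exact: trep_nilpotent.
split.
  move=> x x0 xn; have [r rA xr] := trep_complete x0 xn.
  by exists (trep R r) => //; rewrite nilp_repsE map_f.
split; first exact: reps_conj_inj.
split.
  move=> k l x y k30 l30; rewrite !famE // => /mapP[r rk ->] /mapP[r' r'l ->].
  rewrite !complexify_trep; split; first by move/trep_conjP; exact: rep_family.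
  by move=> kl; apply/trep_conjP; rewrite -kl in r'l; exact: rep_complex k30 rk r'l.
move=> k x k30; rewrite famE // fam_dimE // => /mapP[r rk ->].
by rewrite -cdim_fdims //; exact: fam_manifold.
Qed.
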